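(* Let $\psi$ be a pure state of the CAR algebra $\mathfrak A=\mathfrak A(K)$, $K=K_L\oplus K_R$, which is $\Theta$ invariant. (1) Suppose that split property is valid for $\psi$. Then the restriction of $\psi$ to $\mathfrak A_R$ gives rise to a type I representation of $\mathfrak A_R$, and the restriction of $\psi$ to $\mathfrak A_L$ gives rise to a type I representation of $\mathfrak A_L$. (2) Conversely, if the restriction of $\psi$ to $\mathfrak A_R$ (respectively, the restriction of $\psi$ to $\mathfrak A_L$) gives rise to a type I representation, then split property is valid for $\psi$.
   Context: Setting. $K$ is a separable complex Hilbert space (inner product $(\cdot,\cdot)_K$ linear in the second variable) with a conjugate-linear map $J$ satisfying $J^2=1$ and $(Jh,Jk)_K=(k,h)_K$. The self-dual CAR algebra $\mathfrak A=\mathfrak A(K)$ is the unital $C^*$-algebra generated by elements $B(f)$, $f\in K$, linear in $f$, with $B(h)^*=B(Jh)$ and $B(h)B(k)^*+B(k)^*B(h)=(k,h)_K1$. The parity automorphism $\Theta$ is determined by $\Theta(B(f))=-B(f)$. We are given an orthogonal decomposition $K=K_R\oplus K_L$ into $J$-invariant closed infinite-dimensional subspaces; $\mathfrak A_R$ (resp. $\mathfrak A_L$) is the $C^*$-subalgebra generated by $B(f)$, $f\in K_R$ (resp. $f\in K_L$). Both are isomorphic to the UHF algebra of type $2^\infty$. For $Q\in\mathfrak A$ put $Q_\pm=\frac12(Q\pm\Theta(Q))$. Graded product states. Let $\psi_L,\psi_R$ be states of $\mathfrak A_L,\mathfrak A_R$, at least one of which is $\Theta$ invariant. The graded product state $\psi_L\otimes_{\mathbf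 Z_2}\psi_R$ is the state of $\mathfrak A$ determined, for $Q\in\mathfrak A_L$, $P\in\mathfrak A_R$, by $\psi_L\otimes_{\mathbf Z_2}\psi_R(QP)=\psi_L(Q_+)\psi_R(P)$ if $\psi_L$ is $\Theta$ invariant, and by $\psi_L\otimes_{\mathbf Z_2}\psi_R(QP)=\psi_L(Q)\psi_R(P_+)$ if $\psi_R$ is $\Theta$ invariant. Split property. Split property is valid for a state $\psi$ of $\mathfrak A$ if $\psi$ is quasi-equivalent to some graded product state $\psi_L\otimes_{\mathbf Z_2}\psi_R$ (with at least one of $\psi_L$, $\psi_R$ being $\Theta$ invariant). A state $\omega$ of a $C^*$-algebra $\mathfrak C$ gives rise to a type I representation if the von Neumann algebra $\pi_\omega(\mathfrak C)''$ generated by its GNS representation is of type I. *)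

(* Defs.v *)
From HB Require Import structures.
From mathcomp Require Import all_boot all_order all_algebra.
From mathcomp Require Import complex.
From mathcomp Require Import all_classical all_reals all_analysis.
Set Implicit Arguments.
Unset Strict Implicit.
Unset Printing Implicit Defensive.
Import Order.TTheory GRing.Theory Num.Theory.
Import numFieldNormedType.Exports.
Local Open Scope classical_set_scope.
Local Open Scope complex_scope.
Local Open Scope ring_scope.

(* The norms of all spaces and algebras below take their values in [R[i]]; a nonnegative
   element of [R[i]] is a nonnegative real. *)

(* Inner products are linear in the second variable. *)
HB.mixin Record CompleteNormed_isHilbert (R : realType) H
    of CompleteNormedModule R[i] H := {
  hdot : H -> H -> R[i] ;
  hdot_linearr : forall u (c : R[i]) v w,
    hdot u (c *: v + w) = c * hdot u v + hdot u w ;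
  hdot_conj : forall u v, hdot v u = Num.conj (hdot u v) ;
  hdot_norm : forall u, `|u| ^+ 2 = hdot u u
}.

#[short(type="hilbertType")]
HB.structure Definition Hilbert (R : realType) :=
  {H of CompleteNormedModule R[i] H & CompleteNormed_isHilbert R H}.

(* Unital C*-algebras. The norm is an operation [cnorm] of the structure, since
   the class of rings that are normed modules cannot be declared on top of the
   existing hierarchy (it would have to lie below [numDomainType]). *)
HB.mixin Record Algebra_isCStar (R : realType) A of GRing.Algebra R[i] A := {
  star : A -> A ;
  cnorm : A -> R[i] ;
  star_conj_linear : forall (c : R[i]) (a b : A),
    star (c *: a + b) = Num.conj c *: star a + star b ;
  starM : forall a b : A, star (a * b) = star b * star a ;
  starK : forall a, star (star a) = a ;
  cnorm_eq0 : forall a, cnorm a = 0 -> a = 0 ;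
  cnormZ : forall (c : R[i]) (a : A), cnorm (c *: a) = `|c| * cnorm a ;
  cnormD_le : forall a b : A, cnorm (a + b) <= cnorm a + cnorm b ;
  cnormM_le : forall a b : A, cnorm (a * b) <= cnorm a * cnorm b ;
  cstar_id : forall a : A, cnorm (star a * a) = cnorm a ^+ 2 ;
  cnorm_complete : forall u : nat -> A,
    (forall e, 0 < e -> exists N : nat, forall m n : nat,
       (N <= m)%N -> (N <= n)%N -> cnorm (u m - u n) < e) ->
    exists l : A, forall e, 0 < e -> exists N : nat, forall n : nat,
       (N <= n)%N -> cnorm (u n - l) < e
}.

#[short(type="cstarType")]
HB.structure Definition CStar (R : realType) :=
  {A of GRing.Algebra R[i] A & Algebra_isCStar R A}.

Section HilbertSpaces.
Context {R : realType}.
Implicit Types H K : hilbertType R.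

Definition separable_space (T : topologicalType) : Prop :=
  exists D : set T, countable D /\ dense D.

Definition closed_subspace H (V : set H) : Prop :=
  [/\ V 0, (forall (c : R[i]) u v, V u -> V v -> V (c *: u + v)) & closed V].

Definition infinite_dim H (V : set H) : Prop :=
  forall (n : nat) (e : 'I_n -> H), exists2 v, V v &
    forall c : 'I_n -> R[i], v <> \sum_(i < n) c i *: e i.

Definition orthogonal_decomposition H (V W : set H) : Prop :=
  (forall v w, V v -> W w -> hdot v w = 0) /\
  (forall u, exists v w, [/\ V v, W w & u = v + w]).

Definition conjugation K (J : K -> K) : Prop :=
  [/\ forall (c : R[i]) u v, J (c *: u + v) = Num.conj c *: J u + J v,
      forall u, J (J u) = u
    & forall u v, hdot (J u) (J v) = hdot v u].

Definition bounded_op H (T : H -> H) : Prop :=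
  (forall (c : R[i]) u v, T (c *: u + v) = c *: T u + T v) /\ continuous T.

Definition adjoint_pair H (S T : H -> H) : Prop :=
  forall u v, hdot (S u) v = hdot u (T v).

Definition commutant H (M : set (H -> H)) : set (H -> H) :=
  [set T | bounded_op T /\ forall X, M X -> T \o X = X \o T].

Definition bicommutant H (M : set (H -> H)) : set (H -> H) :=
  commutant (commutant M).

Definition projection H (p : H -> H) : Prop :=
  [/\ bounded_op p, p \o p = p & adjoint_pair p p].

Definition abelian_projection H (M : set (H -> H)) (e : H -> H) : Prop :=
  [/\ projection e, M e & forall x y, M x -> M y ->
      (e \o x \o e) \o (e \o y \o e) = (e \o y \o e) \o (e \o x \o e)].

(* Every nonzero central projection [z] of [M] majorizes a nonzero abelian
   projection [e] of [M]; for projections, [z \o e = e] means [e <= z]. *)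
Definition type_I H (M : set (H -> H)) : Prop :=
  forall z, projection z -> M z -> commutant M z -> z <> cst 0 ->
    exists e, [/\ abelian_projection M e, e <> cst 0 & z \o e = e].

End HilbertSpaces.

(* A functional or a representation of a C*-subalgebra [S] of [A] is given by a
   map defined on all of [A], of which only the values on [S] matter. Thus the
   restriction to [S] of a state [psi] of [A] is [psi] itself, regarded on [S];
   for [A] itself take [S := setT]. *)
Section CStarAlgebras.
Context {R : realType} {A : cstarType R}.
Implicit Types (S : set A) (phi psi : A -> R[i]).

Definition norm_closed S : Prop :=
  forall a, (forall e : R[i], 0 < e -> exists2 b, S b & cnorm (a - b) < e) -> S a.

Definition cstar_subalgebra S : Prop :=
  [/\ S 1,
      forall (c : R[i]) a b, S a -> S b -> S (c *: a + b),
      forall a b, S a -> S b -> S (a * b),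
      forall a, S a -> S (star a)
    & norm_closed S].

Definition cstar_generated (G : set A) : set A :=
  [set a | forall S, cstar_subalgebra S -> G `<=` S -> S a].

Definition state S phi : Prop :=
  [/\ forall (c : R[i]) a b, S a -> S b -> phi (c *: a + b) = c * phi a + phi b,
      forall a, S a -> 0 <= phi (star a * a)
    & phi 1 = 1].

Definition pure_state psi : Prop :=
  state setT psi /\
  forall phi1 phi2 (t : R[i]),
    state setT phi1 -> state setT phi2 -> 0 < t < 1 ->
    (forall a, psi a = t * phi1 a + (1 - t) * phi2 a) ->
    phi1 = psi /\ phi2 = psi.

Definition representation S (H : hilbertType R) (pi : A -> H -> H) : Prop :=
  [/\ forall a, S a -> bounded_op (pi a),
      forall (c : R[i]) a b, S a -> S b ->
        pi (c *: a + b) = (fun u => c *: pi a u + pi b u),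
      forall a b, S a -> S b -> pi (a * b) = pi a \o pi b,
      pi 1 = id
    & forall a, S a -> adjoint_pair (pi a) (pi (star a))].

(* [(H, pi, Omega)] is the GNS triple of [phi], which is unique up to unitary
   equivalence. *)
Definition GNS S phi (H : hilbertType R) (pi : A -> H -> H) (Omega : H) : Prop :=
  [/\ representation S pi,
      dense [set pi a Omega | a in S]
    & forall a, S a -> phi a = hdot Omega (pi a Omega)].

Definition vN_of S (H : hilbertType R) (pi : A -> H -> H) : set (H -> H) :=
  bicommutant [set pi a | a in S].

Definition type_I_state S phi : Prop :=
  exists (H : hilbertType R) (pi : A -> H -> H) (Omega : H),
    GNS S phi pi Omega /\ type_I (vN_of S pi).

(* The representations are intertwined by a *-isomorphism of the von Neumann
   algebras they generate. *)
Definition quasi_equivalent_rep S (H1 H2 : hilbertType R)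
    (pi1 : A -> H1 -> H1) (pi2 : A -> H2 -> H2) : Prop :=
  exists tau : (H1 -> H1) -> (H2 -> H2),
    [/\ set_bij (vN_of S pi1) (vN_of S pi2) tau,
        forall (c : R[i]) x y, vN_of S pi1 x -> vN_of S pi1 y ->
          tau (fun u => c *: x u + y u) = (fun u => c *: tau x u + tau y u),
        forall x y, vN_of S pi1 x -> vN_of S pi1 y ->
          tau (x \o y) = tau x \o tau y,
        forall x y, vN_of S pi1 x -> vN_of S pi1 y ->
          adjoint_pair x y -> adjoint_pair (tau x) (tau y)
      & forall a, S a -> tau (pi1 a) = pi2 a].

Definition quasi_equivalent S phi psi : Prop :=
  exists (H1 H2 : hilbertType R) (pi1 : A -> H1 -> H1) (pi2 : A -> H2 -> H2)
         (Omega1 : H1) (Omega2 : H2),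
    [/\ GNS S phi pi1 Omega1, GNS S psi pi2 Omega2
      & quasi_equivalent_rep S pi1 pi2].

End CStarAlgebras.

Section SelfDualCAR.
Context {R : realType} {K : hilbertType R} {A : cstarType R}.

(* [A], generated by the [B f], is the self-dual CAR algebra over [(K, J)]. For
   infinite-dimensional [K] the relations determine [A] up to isomorphism. *)
Definition selfdual_CAR (J : K -> K) (B : {linear K -> A}) : Prop :=
  [/\ forall h, star (B h) = B (J h),
      forall h k, B h * star (B k) + star (B k) * B h = (hdot k h)%:A
    & cstar_generated (range B) = setT].

Definition local_algebra (B : {linear K -> A}) (V : set K) : set A :=
  cstar_generated (B @` V).

Definition parity_automorphism (B : {linear K -> A})
    (Theta : {lrmorphism A -> A}) : Prop :=
  [/\ bijective Theta, forall a, Theta (star a) = star (Theta a)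
    & forall f, Theta (B f) = - B f].

Definition even_part (Theta : A -> A) (Q : A) : A :=
  (2^-1 : R[i]) *: (Q + Theta Q).

Definition invariant_state (Theta : A -> A) (S : set A) (phi : A -> R[i]) : Prop :=
  forall a, S a -> phi (Theta a) = phi a.

(* When both [psiL] and [psiR] are invariant the two formulas agree. *)
Definition graded_product (Theta : A -> A) (AL AR : set A)
    (psiL psiR phi : A -> R[i]) : Prop :=
  [/\ state setT phi,
      invariant_state Theta AL psiL \/ invariant_state Theta AR psiR,
      invariant_state Theta AL psiL -> forall Q P, AL Q -> AR P ->
        phi (Q * P) = psiL (even_part Theta Q) * psiR P
    & invariant_state Theta AR psiR -> forall Q P, AL Q -> AR P ->
        phi (Q * P) = psiL Q * psiR (even_part Theta P)].

Definition split_property (Theta : A -> A) (AL AR : set A)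
    (psi : A -> R[i]) : Prop :=
  exists psiL psiR phi : A -> R[i],
    [/\ state AL psiL, state AR psiR,
        graded_product Theta AL AR psiL psiR phi
      & quasi_equivalent setT psi phi].

End SelfDualCAR.

(* Main.v *)
Require Import Defs.
From HB Require Import structures.
From mathcomp Require Import all_boot all_order all_algebra.
From mathcomp Require Import complex.
From mathcomp Require Import all_classical all_reals all_analysis.
From mathcomp Require Import ring lra.
Set Implicit Arguments.
Unset Strict Implicit.
Unset Printing Implicit Defensive.
Import Order.TTheory GRing.Theory Num.Theory.
Import numFieldNormedType.Exports.
Local Open Scope classical_set_scope.
Local Open Scope complex_scope.
Local Open Scope ring_scope.

(* Let [S] be one of the two local algebras and let [G] implement the parity in the GNS
   representation of [psi], which is irreducible. An element [q] of the other local algebra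
   commutes with [S] if it is even, and [q G] does if it is odd.

   Type I implies split: let [e] be an abelian projection of the von Neumann algebra of [S]
   in the GNS space [H1] of [psi] restricted to [S]. Orthogonal subprojections of [e] have
   orthogonal central supports [z] in the von Neumann algebra of [S] on the GNS space of
   [psi], and [z + G z G], commuting with all of [A], is [1]; hence there are at most two of
   them, and [e] dominates a minimal projection. A vector [v] in its range satisfies
   [(v, x y v) = lam x (v, y v)] for [x] in [S] and [y] in the commutant of [S]. Adapting
   [v] to the parity gives a vector whose state is a graded product state.

   Split implies type I: since [psi] is pure, quasi-equivalence yields a map [tau] defined
   on all bounded operators. Averaging the graded product state over the parity makes it
   invariant on both sides. Let [V] embed the GNS space of its restriction to [S]. Given a
   central projection [z <> 0] on [H1] with cyclic vector [Om1], let [P] be the image under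
   [tau] of the rank one operator of [z Om1]. For a homogeneous [Q] of the other local algebra
   with [P Q V <> 0], the operator [h = V* Q* P Q V] lies in the von Neumann algebra of [S]
   and [|x h u| <= C |x z Om1| |u|]. By Bessel's inequality, a spectral projection of [h]
   dominates only boundedly many orthogonal projections, hence a minimal one. Carried back
   to [H1], a vector in its range gives [w = z w] inducing a product state of the algebra and
   its commutant, whence an abelian projection below [z]. *)


(** * Hilbert spaces and bounded operators *)

(** Both implications pass through a vector whose state factorizes over an algebra and its
    commutant. A minimal projection yields such a vector, and the vector yields an abelian
    projection, because each element of the algebra compresses to a scalar on the closure of the
    commutant orbit. This takes the place of tensor product decompositions: von Neumann algebras
    enter through the algebra of commutants and intertwiners alone, without weak topologies or
    density theorems.

    The obstacle is the grading. Odd elements of the other algebra reach the commutant of [S] only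
    after composition with [G], and [G] normalizes that commutant without belonging to it. Hence the
    bound two, not one, for orthogonal subprojections of an abelian projection, the adjustment of
    the product vector to an eigenvector of [G], and the twist by [Theta] when [Q] is odd. In the
    converse direction [tau] transports [G] as well, so that the averaged state becomes a vector
    state on two copies of one space. *)

Lemma addr_fix0 (V : zmodType) (x : V) : x = x + x -> x = 0.
Proof. by move/eqP; rewrite -subr_eq subrr eq_sym => /eqP. Qed.

(** * Real-valued modulus and completeness of the complex scalars *)

Section ComplexNumbers.
Context {R : realType}.
Implicit Types x y z : R[i].

Lemma Re_conj z : complex.Re (Num.conj z) = complex.Re z.
Proof. by case: z. Qed.

Lemma ReD x y : complex.Re (x + y) = complex.Re x + complex.Re y.
Proof. by case: x; case: y. Qed.

Lemma ReN x : complex.Re (- x) = - complex.Re x.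
Proof. by case: x. Qed.

Lemma ReB x y : complex.Re (x - y) = complex.Re x - complex.Re y.
Proof. by rewrite ReD ReN. Qed.

Lemma ReZ (r : R) x : complex.Re (r%:C * x) = r * complex.Re x.
Proof. by case: x => a b /=; rewrite mul0r subr0. Qed.

Lemma ReI x : complex.Re ('i%C * x) = - complex.Im x.
Proof. by case: x => a b /=; rewrite mul0r mul1r sub0r. Qed.

Lemma conjr (r : R) : Num.conj (r%:C : R[i]) = r%:C.
Proof. exact: conjc_real. Qed.

Lemma conji : Num.conj ('i%C : R[i]) = - 'i%C.
Proof. by apply/eqP; rewrite eq_complex /= oppr0 !eqxx. Qed.

Lemma ge0_Re z : 0 <= z -> z = (complex.Re z)%:C.
Proof. by move=> z0; rewrite RRe_real// ger0_real. Qed.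

Lemma Re_ge0 z : 0 <= z -> 0 <= complex.Re z.
Proof. by move=> z0; rewrite -ler0c -ge0_Re. Qed.

Lemma conj_fix_Re z : Num.conj z = z -> z = (complex.Re z)%:C.
Proof.
case: z => a b; rewrite /Num.conj /= => -[] /eqP.
by rewrite eqNr => /eqP ->.
Qed.

Lemma gt0_embed (e : R[i]) : 0 < e -> exists2 r : R, 0 < r & e = r%:C.
Proof.
move=> e0; exists (complex.Re e); last by rewrite -ge0_Re// ltW.
by rewrite -ltcR -ge0_Re// ltW.
Qed.

Definition nrmc z : R := complex.Re `|z|.

Lemma nrmcE z : `|z| = (nrmc z)%:C.
Proof. by rewrite /nrmc -ge0_Re. Qed.

Lemma nrmc_ge0 z : 0 <= nrmc z.
Proof. exact: Re_ge0. Qed.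

Lemma nrmcM x y : nrmc (x * y) = nrmc x * nrmc y.
Proof. by apply: complexI; rewrite rmorphM /= -!nrmcE normrM. Qed.

Lemma nrmcD x y : nrmc (x + y) <= nrmc x + nrmc y.
Proof. by rewrite -lecR rmorphD /= -!nrmcE ler_normD. Qed.

Lemma nrmcN x : nrmc (- x) = nrmc x.
Proof. by rewrite /nrmc normrN. Qed.

Lemma nrmc_conj z : nrmc (Num.conj z) = nrmc z.
Proof. by rewrite /nrmc norm_conjC. Qed.

Lemma nrmc_real (r : R) : nrmc r%:C = `|r|.
Proof.
apply: complexI; rewrite -nrmcE normc_def /= expr0n /= addr0 sqrtr_sqr.
by [].
Qed.

Lemma nrmc_half : nrmc ((2^-1)%:C : R[i]) = 2^-1.
Proof. by rewrite nrmc_real ger0_norm. Qed.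

Lemma half2 (L : lmodType R[i]) (u : L) : (2^-1)%:C *: (u + u) = u.
Proof.
rewrite -{1 2}[u]scale1r -scalerDl scalerA (_ : 1 + 1 = 2%:C :> R[i]).
  by rewrite -rmorphM /= mulVf ?pnatr_eq0// scale1r.
by rewrite -[2]/(1 + 1) rmorphD.
Qed.

Lemma nrmc0 : nrmc 0 = 0. Proof. by rewrite (nrmc_real 0) normr0. Qed.

Lemma nrmc1 : nrmc 1 = 1. Proof. by rewrite (nrmc_real 1) normr1. Qed.

Lemma nrmci : nrmc 'i%C = 1.
Proof. by apply: complexI; rewrite -nrmcE normc_def /= expr0n expr1n add0r sqrtr1. Qed.

Lemma nrmc_eq0 z : nrmc z = 0 -> z = 0.
Proof. by move=> z0; apply/eqP; rewrite -normr_eq0 nrmcE z0. Qed.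

Lemma Re_le_nrmc z : `|complex.Re z| <= nrmc z.
Proof. by rewrite -lecR -nrmcE normc_ge_Re. Qed.

Lemma Im_le_nrmc z : `|complex.Im z| <= nrmc z.
Proof.
have -> : complex.Im z = complex.Re (- 'i%C * z) by rewrite mulNr ReN ReI opprK.
by rewrite (le_trans (Re_le_nrmc _))// nrmcM nrmcN nrmci mul1r.
Qed.

Lemma mul_conjC_nrmc z : z * Num.conj z = (nrmc z ^+ 2)%:C.
Proof. by rewrite -normCK nrmcE rmorphXn. Qed.

Lemma nrmc_sum z : nrmc z <= `|complex.Re z| + `|complex.Im z|.
Proof.
rewrite {1}(complexE z); apply: le_trans (nrmcD _ _) _.
by rewrite nrmcM nrmci mul1r !nrmc_real.
Qed.

Lemma nrmc_small z : (forall e : R, 0 < e -> nrmc z <= e) -> z = 0.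
Proof.
move=> h; apply: nrmc_eq0; apply/eqP; rewrite eq_le nrmc_ge0 andbT.
by apply/ler_addgt0Pr => e e0; rewrite add0r h.
Qed.

Lemma complex_cauchy (u : nat -> R[i]) :
  (forall e : R, 0 < e -> exists N, forall m n, (N <= m)%N -> (N <= n)%N ->
     nrmc (u m - u n) < e) ->
  exists l, forall e : R, 0 < e -> exists N, forall n, (N <= n)%N ->
     nrmc (u n - l) < e.
Proof.
move=> hu.
have real_case (v : nat -> R) :
  (forall e : R, 0 < e -> exists N, forall m n, (N <= m)%N -> (N <= n)%N ->
     `|v m - v n| < e) ->
  exists l, forall e : R, 0 < e -> exists N, forall n, (N <= n)%N -> `|v n - l| < e.
  move=> hv; have : cvg (v @ \oo).
    apply/cauchy_cvgP/cauchy_ballP => e e0.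
    have [N hN] := hv e e0.
    exists (v @` [set n | (N <= n)%N], v @` [set n | (N <= n)%N]) => /=.
      by split; exists N => // n /= Nn; exists n.
    by move=> [a b] /= [[m Nm <-] [n Nn <-]]; exact: hN.
  move=> /cvg_ex [l vl]; exists l => e e0.
  move/cvgrPdist_lt: vl => /(_ e e0) [N _ hN]; exists N => n Nn.
  by rewrite distrC; exact: hN.
have [a ha] : exists l, forall e : R, 0 < e -> exists N, forall n, (N <= n)%N ->
     `|complex.Re (u n) - l| < e.
  apply: real_case => e /hu [N hN]; exists N => m n Nm Nn.
  by apply: le_lt_trans (hN _ _ Nm Nn); rewrite -ReB Re_le_nrmc.
have [b hb] : exists l, forall e : R, 0 < e -> exists N, forall n, (N <= n)%N ->
     `|complex.Im (u n) - l| < e.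
  apply: real_case => e /hu [N hN]; exists N => m n Nm Nn.
  apply: le_lt_trans (hN _ _ Nm Nn); apply: le_trans (Im_le_nrmc _).
  by case: (u m); case: (u n).
exists (a +i* b) => e e0.
have e2 : 0 < e / 2 by rewrite divr_gt0.
have [N hN] := ha _ e2; have [M hM] := hb _ e2.
exists (maxn N M) => n; rewrite geq_max => /andP[/hN h1 /hM h2].
apply: le_lt_trans (nrmc_sum _) _.
case: (u n) h1 h2 => x y /= h1 h2; lra.
Qed.

End ComplexNumbers.

(** * Limits through explicit epsilon estimates *)

Section EpsilonArguments.
Context {R : realType}.

Lemma le_eps (x y c : R) : 0 <= c -> (forall e, 0 < e -> x <= y + c * e) -> x <= y.
Proof.
move=> c0 h; apply/ler_addgt0Pr => e e0.
have c1 : 0 < c + 1 by rewrite ltr_wpDl.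
have e1 : 0 < e / (c + 1) by rewrite divr_gt0.
apply: le_trans (h _ e1) _; rewrite lerD2l mulrCA ger_pMr//.
by rewrite ler_pdivrMr// mul1r lerDl.
Qed.

Lemma eps_scale (k e : R) : 0 <= k -> 0 < e -> exists2 d, 0 < d & forall x, x < d -> k * x < e.
Proof.
move=> k0 e0; have k1 : 0 < k + 1 by rewrite ltr_wpDl.
exists (e / (k + 1)) => [|x]; first by rewrite divr_gt0.
by rewrite ltr_pdivlMr//; have [x0|x0] := leP 0 x; nra.
Qed.

Lemma eq0_eps (x c : R) : 0 <= x -> 0 <= c -> (forall e, 0 < e -> x <= c * e) -> x = 0.
Proof.
move=> x0 c0 h; apply/eqP; rewrite eq_le x0 andbT; apply: (le_eps c0) => e e0.
by rewrite add0r h.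
Qed.

Lemma inv_small (e : R) : 0 < e -> exists N : nat, forall n, (N <= n)%N -> n.+1%:R^-1 < e.
Proof.
move=> e0; exists (Num.bound e^-1) => n Nn.
rewrite invf_plt ?posrE ?ltr0n//.
apply: lt_le_trans (archi_boundP _) _; first by rewrite invr_ge0 ltW.
by rewrite ler_nat; apply: leq_trans Nn _.
Qed.

End EpsilonArguments.

Section LinearSets.
Context {R : realType} {V : lmodType R[i]}.
Implicit Types (X : set V) (u v : V).

Definition linear_set X : Prop := X 0 /\ forall (c : R[i]) u v, X u -> X v -> X (c *: u + v).

Lemma lin0 X : linear_set X -> X 0. Proof. by case. Qed.
Lemma linD X u v : linear_set X -> X u -> X v -> X (u + v).
Proof. by move=> [_ h] hu hv; rewrite -[u]scale1r; apply: h. Qed.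
Lemma linZ X c u : linear_set X -> X u -> X (c *: u).
Proof. by move=> [h0 h] hu; rewrite -[c *: u]addr0; apply: h. Qed.
Lemma linB X u v : linear_set X -> X u -> X v -> X (u - v).
Proof. by move=> h hu hv; rewrite -scaleN1r; apply: linD => //; apply: linZ. Qed.

End LinearSets.

(** * Semi-inner products on a linear subset *)

Section SemiInnerProducts.
Context {R : realType} {V : lmodType R[i]}.

(** Everything is required on [S] only: a functional on a subalgebra is a map on the whole algebra
    whose values off the subalgebra are arbitrary. *)
Record sip (S : set V) (s : V -> V -> R[i]) : Prop := Sip {
  sip_lin : linear_set S;
  sip_linearr : forall c a b d, S a -> S b -> S d -> s a (c *: b + d) = c * s a b + s a d;
  sip_conj : forall a b, S a -> S b -> s b a = Num.conj (s a b);
  sip_ge0 : forall a, S a -> 0 <= s a a }.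

Variables (S : set V) (s : V -> V -> R[i]).
Hypothesis hs : sip S s.

Let linS := sip_lin hs.

Definition sn (a : V) : R := Num.sqrt (complex.Re (s a a)).

Lemma sn_ge0 a : 0 <= sn a. Proof. exact: sqrtr_ge0. Qed.

Lemma sn_sqr a : S a -> s a a = (sn a ^+ 2)%:C.
Proof. by move=> Sa; have h := sip_ge0 hs Sa; rewrite sqr_sqrtr ?Re_ge0// -ge0_Re. Qed.

Lemma sip_Dr a b d : S a -> S b -> S d -> s a (b + d) = s a b + s a d.
Proof. by move=> Sa Sb Sd; have := sip_linearr hs 1 Sa Sb Sd; rewrite scale1r mul1r. Qed.

Lemma sip_0r a : S a -> s a 0 = 0.
Proof. by move=> Sa; apply: addr_fix0; rewrite -sip_Dr ?addr0//; exact: lin0. Qed.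

Lemma sip_Zr a c b : S a -> S b -> s a (c *: b) = c * s a b.
Proof.
move=> Sa Sb; have := sip_linearr hs c Sa Sb (lin0 linS).
by rewrite !addr0 sip_0r// addr0.
Qed.

Lemma sip_Br a b d : S a -> S b -> S d -> s a (b - d) = s a b - s a d.
Proof.
move=> Sa Sb Sd; rewrite -scaleN1r sip_Dr// ?sip_Zr ?mulN1r//; exact: linZ.
Qed.

Lemma sip_Dl a b d : S a -> S b -> S d -> s (a + b) d = s a d + s b d.
Proof.
move=> Sa Sb Sd; have Sab := linD linS Sa Sb.
by rewrite (sip_conj hs Sd Sab) sip_Dr// rmorphD /= -!(sip_conj hs).
Qed.

Lemma sip_Zl c a b : S a -> S b -> s (c *: a) b = Num.conj c * s a b.
Proof.
move=> Sa Sb; have Sca := linZ c linS Sa.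
by rewrite (sip_conj hs Sb Sca) sip_Zr// rmorphM /= -(sip_conj hs).
Qed.

Lemma sip_Bl a b d : S a -> S b -> S d -> s (a - b) d = s a d - s b d.
Proof.
move=> Sa Sb Sd; have SN := linZ (-1) linS Sb.
by rewrite -scaleN1r sip_Dl// sip_Zl// rmorphN rmorph1 mulN1r.
Qed.

(** Positivity at [a - t c b] for real [t], where [c = s b a], gives a real quadratic polynomial in
    [t]; null vectors are treated directly instead of being divided out. *)
Lemma sip_cauchy_schwarz a b : S a -> S b -> nrmc (s a b) <= sn a * sn b.
Proof.
move=> Sa Sb; set c := s b a.
have hc : s a b = Num.conj c by rewrite /c -(sip_conj hs).
have key (t : R) : 0 <= sn a ^+ 2 - 2 * t * nrmc c ^+ 2 + t ^+ 2 * nrmc c ^+ 2 * sn b ^+ 2.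
  have Sx : S (a - (t%:C * c) *: b) by apply: linB => //; exact: linZ.
  have := sip_ge0 hs Sx; have Sc := linZ (t%:C * c) linS Sb.
  rewrite sip_Br// sip_Bl// sip_Bl// !sip_Zr// !sip_Zl// hc (sn_sqr Sa) (sn_sqr Sb) -/c.
  have -> : Num.conj (t%:C * c) = t%:C * Num.conj c by rewrite rmorphM /= conjr.
  move=> h; rewrite -ler0c; apply: le_trans h _.
  rewrite le_eqVlt; apply/orP; left; apply/eqP.
  have hh : c * Num.conj c = (nrmc c ^+ 2)%:C by exact: mul_conjC_nrmc.
  move: hh; set N := nrmc c ^+ 2; set A := sn a ^+ 2; set B := sn b ^+ 2 => hh.
  have -> : (A - 2 * t * N + t ^+ 2 * N * B)%:C
      = A%:C - 2 * t%:C * N%:C + t%:C ^+ 2 * N%:C * B%:C :> R[i].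
    by rewrite rmorphD rmorphB !rmorphM /= rmorph_nat expr2.
  by rewrite -hh; ring.
rewrite hc nrmc_conj.
have [b0|b0] := eqVneq (sn b) 0.
  rewrite b0 mulr0.
  have [->//|c0] := eqVneq (nrmc c) 0.
  have c2 : 0 < nrmc c ^+ 2 by rewrite exprn_gt0// lt0r c0 nrmc_ge0.
  (* With [b] null the polynomial is affine in [t], and this [t] makes it equal to [-1]. *)
  have := key ((sn a ^+ 2 + 1) / (2 * nrmc c ^+ 2)); rewrite b0 expr0n /= mulr0 addr0.
  rewrite (_ : 2 * _ * _ = sn a ^+ 2 + 1) => [h|]; first lra.
  by field; rewrite -sqrf_eq0 gt_eqF.
have b2 : 0 < sn b ^+ 2 by rewrite exprn_gt0// lt0r b0 sn_ge0.
(* The polynomial attains its minimum at this [t]. *)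
have := key (sn b ^+ 2)^-1.
rewrite (_ : _ + _ = (sn a ^+ 2 * sn b ^+ 2 - nrmc c ^+ 2) / sn b ^+ 2); last by field.
rewrite pmulr_lge0 ?invr_gt0// subr_ge0 => h.
by rewrite -(ler_pXn2r (n := 2))// ?nnegrE ?nrmc_ge0 ?mulr_ge0 ?sn_ge0// exprMn.
Qed.

Lemma sn_triangle a b : S a -> S b -> sn (a + b) <= sn a + sn b.
Proof.
move=> Sa Sb; have Sab := linD linS Sa Sb.
rewrite -(ler_pXn2r (n := 2))// ?nnegrE ?addr_ge0 ?sn_ge0//.
have e : (sn (a + b) ^+ 2)%:C = (sn a ^+ 2)%:C + (sn b ^+ 2)%:C + (s a b + Num.conj (s a b)).
  by rewrite -!sn_sqr// sip_Dr// !sip_Dl// -(sip_conj hs Sa Sb); ring.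
have {}e := congr1 (@complex.Re R) e; rewrite !ReD Re_conj /= in e.
have h : complex.Re (s a b) <= sn a * sn b.
  by apply: le_trans (sip_cauchy_schwarz Sa Sb); apply: le_trans (Re_le_nrmc _); exact: ler_norm.
by rewrite e; nra.
Qed.

Lemma snZ c a : S a -> sn (c *: a) = nrmc c * sn a.
Proof.
move=> Sa; have Sc := linZ c linS Sa.
apply/eqP; rewrite -(eqrXn2 (n := 2))// ?mulr_ge0 ?sn_ge0 ?nrmc_ge0//; apply/eqP.
apply: complexI; rewrite -sn_sqr// sip_Zr// sip_Zl// sn_sqr// exprMn mulrA mul_conjC_nrmc.
by rewrite -rmorphM.
Qed.

End SemiInnerProducts.

(** * Elementary geometry of a Hilbert space *)

Section HilbertBasics.
Context {R : realType}.
Implicit Types H K : hilbertType R.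

Section OneSpace.
Context {H : hilbertType R}.
Implicit Types (u v w : H) (c : R[i]).

Lemma hdotDr u v w : hdot u (v + w) = hdot u v + hdot u w.
Proof. by have := hdot_linearr u 1 v w; rewrite scale1r mul1r. Qed.

Lemma hdot0r u : hdot u 0 = 0.
Proof. by apply: addr_fix0; rewrite -hdotDr addr0. Qed.

Lemma hdotZr u c v : hdot u (c *: v) = c * hdot u v.
Proof. by have := hdot_linearr u c v 0; rewrite !addr0 hdot0r addr0. Qed.

Lemma hdotNr u v : hdot u (- v) = - hdot u v.
Proof. by rewrite -scaleN1r hdotZr mulN1r. Qed.

Lemma hdotBr u v w : hdot u (v - w) = hdot u v - hdot u w.
Proof. by rewrite hdotDr hdotNr. Qed.

Lemma hdotDl u v w : hdot (u + v) w = hdot u w + hdot v w.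
Proof. by rewrite hdot_conj hdotDr rmorphD /= -!hdot_conj. Qed.

Lemma hdotZl u c v : hdot (c *: u) v = Num.conj c * hdot u v.
Proof. by rewrite hdot_conj hdotZr rmorphM /= -hdot_conj. Qed.

Lemma hdot0l u : hdot 0 u = 0.
Proof. by rewrite hdot_conj hdot0r rmorph0. Qed.

Lemma hdotNl u v : hdot (- u) v = - hdot u v.
Proof. by rewrite hdot_conj hdotNr rmorphN /= -hdot_conj. Qed.

Lemma hdotBl u v w : hdot (u - v) w = hdot u w - hdot v w.
Proof. by rewrite hdotDl hdotNl. Qed.

Lemma hdot_sym0 u v : hdot v u = 0 -> hdot u v = 0.
Proof. by move=> h; rewrite hdot_conj h rmorph0. Qed.

Definition nrm u : R := complex.Re `|u|.

Lemma nrmE u : `|u| = (nrm u)%:C.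
Proof. by rewrite /nrm -ge0_Re. Qed.

Lemma nrm_ge0 u : 0 <= nrm u.
Proof. exact: Re_ge0. Qed.

Lemma hdot_nrm u : hdot u u = (nrm u ^+ 2)%:C.
Proof. by rewrite -hdot_norm nrmE rmorphXn. Qed.

Lemma nrm_sqr u : nrm u ^+ 2 = complex.Re (hdot u u).
Proof. by rewrite hdot_nrm. Qed.

Lemma nrmD u v : nrm (u + v) <= nrm u + nrm v.
Proof. by rewrite -lecR rmorphD /= -!nrmE ler_normD. Qed.

Lemma nrmN u : nrm (- u) = nrm u.
Proof. by rewrite /nrm normrN. Qed.

Lemma nrmB u v : nrm (u - v) <= nrm u + nrm v.
Proof. by rewrite -(nrmN v) nrmD. Qed.

Lemma nrm_distC u v : nrm (u - v) = nrm (v - u).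
Proof. by rewrite -nrmN opprB. Qed.

Lemma nrmZ c u : nrm (c *: u) = nrmc c * nrm u.
Proof. by apply: complexI; rewrite rmorphM /= -nrmE -nrmcE normrZ -nrmE. Qed.

Lemma nrm0 : nrm (0 : H) = 0.
Proof. by rewrite /nrm normr0. Qed.

Lemma nrm_eq0 u : nrm u = 0 -> u = 0.
Proof. by move=> u0; apply/eqP; rewrite -normr_eq0 nrmE u0. Qed.

Lemma nrm_gt0 u : u <> 0 -> 0 < nrm u.
Proof. by move=> u0; rewrite lt0r nrm_ge0 andbT; apply/eqP => /nrm_eq0. Qed.

Lemma nrm_small u : (forall e : R, 0 < e -> nrm u <= e) -> u = 0.
Proof.
move=> h; apply: nrm_eq0; apply/eqP; rewrite eq_le nrm_ge0 andbT.
by apply/ler_addgt0Pr => e e0; rewrite add0r h.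
Qed.

Lemma hdot_eq0 u : hdot u u = 0 -> u = 0.
Proof.
rewrite hdot_nrm => /(congr1 (@complex.Re R)) /= /eqP.
by rewrite sqrf_eq0 => /eqP /nrm_eq0.
Qed.

Lemma hdot_all0 u : (forall v, hdot v u = 0) -> u = 0.
Proof. by move=> /(_ u) /hdot_eq0. Qed.

Lemma hdot_inj u v : (forall w, hdot w u = hdot w v) -> u = v.
Proof.
by move=> h; apply/eqP; rewrite -subr_eq0; apply/eqP/hdot_all0 => w; rewrite hdotBr h subrr.
Qed.

Lemma nrm_sqrD u v :
  nrm (u + v) ^+ 2 = nrm u ^+ 2 + nrm v ^+ 2 + 2 * complex.Re (hdot u v).
Proof.
rewrite !nrm_sqr hdotDl !hdotDr (hdot_conj u v) !ReD Re_conj; ring.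
Qed.

Lemma nrm_sqrB u v :
  nrm (u - v) ^+ 2 = nrm u ^+ 2 + nrm v ^+ 2 - 2 * complex.Re (hdot u v).
Proof. rewrite nrm_sqrD nrmN hdotNr ReN; ring. Qed.

Lemma parallelogram u v :
  nrm (u + v) ^+ 2 + nrm (u - v) ^+ 2 = 2 * nrm u ^+ 2 + 2 * nrm v ^+ 2.
Proof. rewrite nrm_sqrB nrm_sqrD; ring. Qed.

Lemma hdot_sip : sip setT (hdot : H -> H -> R[i]).
Proof.
split=> [//|c a b d _ _ _|a b _ _|a _]; [exact: hdot_linearr|exact: hdot_conj|].
by rewrite -hdot_norm exprn_ge0.
Qed.

Lemma cauchy_schwarz u v : nrmc (hdot u v) <= nrm u * nrm v.
Proof.
have e w : sn (hdot : H -> H -> R[i]) w = nrm w.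
  by rewrite /sn hdot_nrm /= sqrtr_sqr ger0_norm ?nrm_ge0.
by rewrite -!e; exact: (sip_cauchy_schwarz hdot_sip).
Qed.

End OneSpace.

End HilbertBasics.

(** * Closed subspaces and orthogonal projections *)

Section Subspaces.
Context {R : realType} {H : hilbertType R}.
Implicit Types (V X : set H) (u v w : H).

Definition clos X : set H :=
  [set u | forall e : R, 0 < e -> exists2 v, X v & nrm (u - v) < e].

Definition csub V : Prop := linear_set V /\ clos V `<=` V.

Lemma ball_nrm u v (e : R) : ball u e%:C v <-> nrm (u - v) < e.
Proof. by rewrite -ball_normE /= nrmE ltcR. Qed.

Lemma dense_clos X : dense X <-> forall u, clos X u.
Proof.
split=> [dX u e e0|h O [u Ou] oO].
  have e0' : 0 < e%:C :> R[i] by rewrite ltcR.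
  have [|v [/= /ball_nrm uv Xv]] := dX (ball u e%:C) _ (ball_open u _).
    by exists u; apply: ballxx.
  by exists v.
have [e /= e0 hb] : nbhs_ball u O by rewrite nbhs_ballE; exact: open_nbhs_nbhs.
have [r r0 er] := gt0_embed e0.
have [v Xv uv] := h u r r0; exists v; split=> //; apply: hb.
by rewrite er; apply/ball_nrm.
Qed.

Lemma hilbert_complete (a : nat -> H) :
  (forall e : R, 0 < e -> exists N, forall m n, (N <= m)%N -> (N <= n)%N ->
     nrm (a m - a n) < e) ->
  exists l, forall e : R, 0 < e -> exists N, forall n, (N <= n)%N -> nrm (a n - l) < e.
Proof.
move=> hu; have : cvg (a @ \oo).
  apply/cauchy_cvgP/cauchy_ballP => e e0.
  have [r r0 er] := gt0_embed e0.
  have [N hN] := hu r r0.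
  exists (a @` [set n | (N <= n)%N], a @` [set n | (N <= n)%N]) => /=.
    by split; exists N => // n /= Nn; exists n.
  move=> [x y] /= [[m Nm <-] [n Nn <-]]; rewrite er; apply/ball_nrm; exact: hN.
move=> /cvg_ex [l al]; exists l => e e0.
have e0' : 0 < e%:C :> R[i] by rewrite ltcR.
move/cvgrPdist_lt: al => /(_ _ e0') [N _ hN]; exists N => n Nn.
by rewrite nrm_distC -ltcR -nrmE; exact: hN.
Qed.

Lemma clos_sub X : X `<=` clos X.
Proof. by move=> u Xu e e0; exists u => //; rewrite subrr nrm0. Qed.

Lemma clos_linear X : linear_set X -> csub (clos X).
Proof.
move=> [X0 XD]; split; first split; first exact: clos_sub.
  move=> c u v hu hv e e0.
  have e2 : 0 < e / 2 by rewrite divr_gt0.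
  have [d d0 hd] := eps_scale (nrmc_ge0 c) e2.
  have [u' Xu' /hd uu'] := hu d d0; have [v' Xv' vv'] := hv _ e2.
  exists (c *: u' + v'); first exact: XD.
  rewrite opprD addrACA -scalerBr; apply: le_lt_trans (nrmD _ _) _.
  by rewrite nrmZ [ltRHS]splitr ltrD.
move=> u hu e e0; have e2 : 0 < e / 2 by rewrite divr_gt0.
have [v hv uv] := hu _ e2; have [w Xw vw] := hv _ e2.
exists w => //; have -> : u - w = (u - v) + (v - w) by rewrite addrA subrK.
by apply: le_lt_trans (nrmD _ _) _; lra.
Qed.

Lemma closed_csub V : closed_subspace V -> csub V.
Proof.
move=> [V0 VD cV]; split=> // u hu; apply: cV => B.
rewrite -nbhs_ballE => -[e /= e0 hB].
have [r r0 er] := gt0_embed e0.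
have [v Vv uv] := hu r r0; exists v; split=> //.
by apply: hB; rewrite er; apply/ball_nrm.
Qed.

(** A sequence minimizing the distance is Cauchy by the parallelogram law, and varying the limit
    along [w] gives orthogonality. *)
Lemma proj_exists V u : csub V -> exists v, V v /\ forall w, V w -> hdot w (u - v) = 0.
Proof.
move=> [linV clV].
pose D := [set nrm (u - v) ^+ 2 | v in V].
have hD : has_inf D.
  split; first by exists (nrm (u - 0) ^+ 2), 0 => //; exact: lin0.
  by exists 0 => _ [v _ <-]; rewrite sqr_ge0.
pose d := inf D.
have dle v : V v -> d <= nrm (u - v) ^+ 2.
  by move=> Vv; apply: ge_inf; [case: hD|exists v].
have happ (n : nat) : exists v, V v /\ nrm (u - v) ^+ 2 < d + n.+1%:R^-1.
  have n0 : (0 : R) < n.+1%:R^-1 by rewrite invr_gt0.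
  by have [_ [v Vv <-] lt] := inf_adherent n0 hD; exists v.
have [a ha] := choice happ.
have cau m n : nrm (a m - a n) ^+ 2 <= 2 * m.+1%:R^-1 + 2 * n.+1%:R^-1.
  have [Vm um] := ha m; have [Vn un] := ha n.
  have := parallelogram (u - a n) (u - a m).
  have -> : u - a n - (u - a m) = a m - a n by rewrite opprB addrC addrA subrK.
  have -> : u - a n + (u - a m) = (2%:C : R[i]) *: (u - (2^-1)%:C *: (a n + a m)).
    rewrite scalerBr scalerA -rmorphM /= divff ?pnatr_eq0// scale1r.
    rewrite (_ : (2%:C : R[i]) = 1 + 1); last by rewrite -[2]/(1+1) rmorphD.
    by rewrite scalerDl scale1r opprD addrACA.
  rewrite nrmZ nrmc_real exprMn ger0_norm// => hp.
  have hm : V ((2^-1)%:C *: (a n + a m)) by apply: linZ => //; apply: linD.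
  have := dle _ hm; move: hp um un; set A := nrm _ ^+ 2; set B := nrm _ ^+ 2.
  set C := nrm _ ^+ 2; set E := nrm _ ^+ 2.
  rewrite expr2 => hp um un h; move: hp um un h; set p := _^-1; set q := _^-1; move=> hp um un h; lra.
have [|l hl] := @hilbert_complete a.
  move=> e e0; have e2 : 0 < e ^+ 2 / 4 by rewrite divr_gt0// exprn_gt0.
  have [N hN] := inv_small e2; exists N => m n Nm Nn.
  rewrite -(ltr_pXn2r (n := 2))// ?nnegrE ?nrm_ge0// ?(ltW e0)//.
  apply: le_lt_trans (cau m n) _.
  have h1 := hN _ Nm; have h2 := hN _ Nn.
  move: h1 h2; set p := m.+1%:R^-1; set q := n.+1%:R^-1; move=> h1 h2; lra.
have Vl : V l.
  apply: clV => e e0; have [N hN] := hl _ e0; exists (a N); first by case: (ha N).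
  by rewrite nrm_distC hN.
have lmin : nrm (u - l) ^+ 2 <= d.
  set t := nrm (u - l); have t0 : 0 <= t by exact: nrm_ge0.
  have c0 : 0 <= 1 + 2 * t by rewrite addr_ge0// mulr_ge0.
  apply: (le_eps c0) => e e0.
  have [N1 hN1] := hl _ e0; have [N2 hN2] := inv_small e0.
  set n := maxn N1 N2.
  have h1 := hN1 n (leq_maxl _ _); have h2 := hN2 n (leq_maxr _ _).
  have [_ h3] := ha n.
  have h4 : t <= nrm (u - a n) + nrm (a n - l).
    by apply: le_trans (nrmD _ _); rewrite addrA subrK.
  have s0 : 0 <= nrm (u - a n) by exact: nrm_ge0.
  move: h1 h2 h3 h4 s0; set s := nrm _; set r := nrm _; set q := _^-1.
  have [ts h1 h2 h3 h4 s0|st h1 h2 h3 h4 s0] := leP t s; nra.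
exists l; split=> // w Vw.
have [->|/eqP w0] := eqVneq w 0; first by rewrite hdot0l.
pose c := hdot w (u - l); have nw := nrm_gt0 w0.
pose s := (nrm w ^+ 2)^-1.
(* This is the point of the line through [l] in direction [w] that is closest to [u]; it is no
   closer than [l], which forces [c = 0]. *)
have hm : V (l + (s%:C * c) *: w) by apply: linD => //; apply: linZ.
have := le_trans lmin (dle _ hm).
rewrite opprD addrA (nrm_sqrB (u - l)) => h.
have {h}: 2 * complex.Re (hdot (u - l) ((s%:C * c) *: w)) <= nrm ((s%:C * c) *: w) ^+ 2 by lra.
rewrite hdotZr nrmZ nrmcM nrmc_real (hdot_conj w (u - l)) -/c -mulrA mul_conjC_nrmc.
rewrite -rmorphM /= => h.
have s0 : 0 < s by rewrite invr_gt0 exprn_gt0.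
rewrite ger0_norm ?(ltW s0)// in h.
have sw : s * nrm w ^+ 2 = 1 by rewrite mulVf// expf_neq0// gt_eqF.
have h2 : (s * nrmc c * nrm w) ^+ 2 = s * nrmc c ^+ 2 by rewrite -[RHS]mul1r -sw; ring.
rewrite h2 in h.
have h3 : s * nrmc c ^+ 2 <= 0 by lra.
rewrite pmulr_rle0// in h3.
apply: nrmc_eq0; apply/eqP; rewrite -sqrf_eq0 eq_le h3 sqr_ge0//.
Qed.

Definition pj V u : H := xget 0 [set v | V v /\ forall w, V w -> hdot w (u - v) = 0].

Section Projection.
Variables (V : set H) (cV : csub V).

Lemma pj_in u : V (pj V u).
Proof. by rewrite /pj; case: xgetP => [v _ []//|]; have [v hv] := proj_exists u cV; move=> /(_ v). Qed.

Lemma pj_orth u w : V w -> hdot w (u - pj V u) = 0.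
Proof.
rewrite /pj; case: xgetP => [v _ [_ h]|]; first exact: h.
by have [v hv] := proj_exists u cV; move=> /(_ v).
Qed.

Lemma pj_unique u v : V v -> (forall w, V w -> hdot w (u - v) = 0) -> pj V u = v.
Proof.
move=> Vv h; apply/eqP; rewrite -subr_eq0; apply/eqP/hdot_eq0.
have Vd : V (pj V u - v) by apply: linB => //; [case: cV|exact: pj_in].
have : hdot (pj V u - v) ((u - v) - (u - pj V u)) = 0.
  by rewrite hdotBr h// pj_orth// subrr.
by have -> : u - v - (u - pj V u) = pj V u - v by rewrite opprB addrC addrA subrK.
Qed.

Lemma pj_id u : V u -> pj V u = u.
Proof. by move=> Vu; apply: pj_unique => // w _; rewrite subrr hdot0r. Qed.

Lemma pj_eq0 u : (forall w, V w -> hdot w u = 0) -> pj V u = 0.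
Proof. by move=> h; apply: pj_unique => [|w Vw]; [case: cV => -[]|rewrite subr0 h]. Qed.

Lemma pj_linear (c : R[i]) u v : pj V (c *: u + v) = c *: pj V u + pj V v.
Proof.
apply: pj_unique.
  by case: cV => -[_ h] _; apply: h; exact: pj_in.
move=> w Vw; rewrite opprD addrACA -scalerBr hdotDr hdotZr !pj_orth//.
by rewrite mulr0 addr0.
Qed.

Lemma pj_dot u v : hdot (pj V u) v = hdot (pj V u) (pj V v).
Proof.
apply/eqP; rewrite -subr_eq0 -hdotBr; apply/eqP/pj_orth; exact: pj_in.
Qed.

Lemma pj_sa u v : hdot (pj V u) v = hdot u (pj V v).
Proof. by rewrite pj_dot [RHS]hdot_conj (pj_dot v) -hdot_conj. Qed.

Lemma pj_le u : nrm (pj V u) <= nrm u.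
Proof.
have h : nrm (pj V u) ^+ 2 <= nrm (pj V u) * nrm u.
  rewrite nrm_sqr -pj_dot.
  by apply: le_trans (cauchy_schwarz _ _); apply: le_trans (Re_le_nrmc _); exact: ler_norm.
have [->|/eqP p0] := eqVneq (pj V u) 0; first by rewrite nrm0 nrm_ge0.
by rewrite expr2 ler_pM2l ?nrm_gt0 in h.
Qed.

End Projection.

End Subspaces.

(** * Bounded operators, Riesz representation and adjoints *)

Section Operators.
Context {R : realType}.

Definition bop {H K : hilbertType R} (T : H -> K) : Prop :=
  (forall (c : R[i]) u v, T (c *: u + v) = c *: T u + T v) /\
  exists2 M : R, 0 <= M & forall u, nrm (T u) <= M * nrm u.

Section BasicOps.
Context {H K L : hilbertType R}.
Implicit Types (S T : H -> K).

Lemma bopD T u v : bop T -> T (u + v) = T u + T v.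
Proof. by move=> [h _]; have := h 1 u v; rewrite !scale1r. Qed.

Lemma bop0 T : bop T -> T 0 = 0.
Proof. by move=> h; apply: addr_fix0; rewrite -bopD// addr0. Qed.

Lemma bopZ T c u : bop T -> T (c *: u) = c *: T u.
Proof. by move=> h; case: (h) => l _; have := l c u 0; rewrite (bop0 h) !addr0. Qed.

Lemma bopN T u : bop T -> T (- u) = - T u.
Proof. by move=> h; rewrite -scaleN1r bopZ// scaleN1r. Qed.

Lemma bopB T u v : bop T -> T (u - v) = T u - T v.
Proof. by move=> h; rewrite bopD// bopN. Qed.

Lemma bop_comp T (S : K -> L) : bop T -> bop S -> bop (S \o T).
Proof.
move=> [lT [M M0 hM]] [lS [N N0 hN]]; split=> [c u v /=|]; first by rewrite lT lS.
exists (N * M) => [|u /=]; first exact: mulr_ge0.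
by apply: le_trans (hN _) _; rewrite -mulrA ler_wpM2l.
Qed.

Lemma bop_lin T S (c : R[i]) : bop T -> bop S -> bop (fun u => c *: T u + S u).
Proof.
move=> [lT [M M0 hM]] [lS [N N0 hN]]; split=> [d u v|].
  rewrite lT lS !scalerDr !scalerA -!addrA; congr (_ + _); first by rewrite mulrC.
  by rewrite !addrA; congr (_ + _); rewrite addrC.
exists (nrmc c * M + N) => [|u]; first by rewrite addr_ge0// mulr_ge0// nrmc_ge0.
apply: le_trans (nrmD _ _) _; rewrite nrmZ mulrDl -mulrA lerD//.
by rewrite ler_wpM2l ?nrmc_ge0.
Qed.

Lemma bop_cst0 : bop (cst 0 : H -> K).
Proof.
by split=> [c u v|]; rewrite ?scaler0 ?addr0//; exists 0 => // u; rewrite nrm0 mul0r.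
Qed.

Lemma bop_scale T (c : R[i]) : bop T -> bop (fun u => c *: T u).
Proof.
move=> hT; have := bop_lin c hT bop_cst0.
by congr bop; apply/funext => u /=; rewrite addr0.
Qed.

Lemma bop_add T S : bop T -> bop S -> bop (fun u => T u + S u).
Proof.
move=> hT hS; have := bop_lin 1 hT hS.
by congr bop; apply/funext => u /=; rewrite scale1r.
Qed.

Lemma bop_sub T S : bop T -> bop S -> bop (fun u => T u - S u).
Proof.
move=> hT hS; have := bop_lin (-1) hS hT.
by congr bop; apply/funext => u /=; rewrite scaleN1r addrC.
Qed.

Lemma bop_bound T : bop T -> exists2 M : R, 0 < M & forall u, nrm (T u) <= M * nrm u.
Proof.
move=> [_ [M M0 hM]]; exists (M + 1); first by rewrite ltr_wpDl.
by move=> u; apply: le_trans (hM u) _; rewrite ler_wpM2r ?nrm_ge0// lerDl.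
Qed.

Lemma bop_clos T (X : set H) (Y : set K) u : bop T ->
  (forall v, X v -> Y (T v)) -> clos X u -> clos Y (T u).
Proof.
move=> hT XY hu e e0; have [M M0 hM] := bop_bound hT.
have [|v Xv uv] := hu (e / M); first by rewrite divr_gt0.
exists (T v); first exact: XY.
by rewrite -bopB//; apply: le_lt_trans (hM _) _; rewrite mulrC -ltr_pdivlMr.
Qed.

Lemma clos_eq0 T (X : set H) u : bop T ->
  (forall v, X v -> T v = 0) -> clos X u -> T u = 0.
Proof.
move=> hT h0 hu; apply: nrm_small => e e0.
have [_ -> /ltW] := bop_clos (Y := [set 0]) hT h0 hu e0.
by rewrite subr0.
Qed.

Lemma clos_eq T S (X : set H) u : bop T -> bop S ->
  (forall v, X v -> T v = S v) -> clos X u -> T u = S u.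
Proof.
move=> hT hS h hu; apply/eqP; rewrite -subr_eq0; apply/eqP.
apply: (clos_eq0 (T := fun u => T u - S u) (bop_sub hT hS)) hu => v Xv.
by rewrite h// subrr.
Qed.

Lemma clos_orth (X : set H) u v : (forall w, X w -> hdot u w = 0) -> clos X v -> hdot u v = 0.
Proof.
move=> h hv; apply: nrmc_small => e e0.
have [d d0 hd] := eps_scale (nrm_ge0 u) e0; have [w Xw /hd vw] := hv d d0.
have -> : hdot u v = hdot u (v - w) by rewrite hdotBr (h w)// subr0.
exact: le_trans (cauchy_schwarz _ _) (ltW vw).
Qed.

End BasicOps.

Lemma bop_id {H : hilbertType R} : bop (@id H).
Proof. by split=> //; exists 1 => // u; rewrite mul1r. Qed.

Lemma bop_pj {H : hilbertType R} (V : set H) : csub V -> bop (pj V).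
Proof.
move=> cV; split=> [c u v|]; first exact: pj_linear.
by exists 1 => // u; rewrite mul1r pj_le.
Qed.

(** Continuity at [0] and scaling give the norm estimate that stands for continuity in all later
    arguments. *)
Lemma bounded_opP {H : hilbertType R} (T : H -> H) : bounded_op T <-> bop T.
Proof.
split=> [[lT cT]|hT].
  split=> //.
  have := cT 0; have T0 : T 0 = 0.
    by have := lT (-1) 0 0; rewrite !scaler0 !scaleN1r addNr addr0.
  rewrite /continuous_at T0 => /cvgrPdist_lt /(_ 1 ltr01); rewrite -nbhs_ballE => -[e /= e0 he].
  have [r r0 er] := gt0_embed e0.
  exists (2 / r) => [|u]; first by rewrite divr_ge0// ltW.
  have [->|/eqP u0] := eqVneq u 0; first by rewrite T0 nrm0 mulr0.
  have nu := nrm_gt0 u0; set c := r / (2 * nrm u).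
  have c0 : 0 < c by rewrite divr_gt0// mulr_gt0.
  have : ball 0 e (c%:C *: u).
    rewrite er; apply/ball_nrm; rewrite sub0r nrmN nrmZ nrmc_real gtr0_norm//.
    rewrite /c invfM mulrA mulfVK ?gt_eqF//; lra.
  move=> /he; rewrite sub0r normrN nrmE -[1]/(1%:C) ltcR.
  have -> : T (c%:C *: u) = c%:C *: T u by rewrite -[c%:C *: u]addr0 lT T0 addr0.
  rewrite nrmZ nrmc_real gtr0_norm// => h.
  have -> : 2 / r * nrm u = c^-1 by rewrite /c invf_div; ring.
  by rewrite -div1r ler_pdivlMr// mulrC ltW.
split; first by case: hT.
move=> u; apply/cvgrPdist_lt => e e0.
have [M M0 hM] := bop_bound hT.
have [r r0 er] := gt0_embed e0; apply/nbhs_ballP; exists (r / M)%:C => /=.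
  by rewrite ltcR divr_gt0.
move=> v /ball_nrm; rewrite er nrmE ltcR -bopB// ltr_pdivlMr// mulrC.
by apply: le_lt_trans.
Qed.

(** The orthogonal complement of the kernel is spanned by one vector [z], and [f u *: z - f z *: u]
    lies in the kernel. *)
Lemma riesz {H : hilbertType R} (f : H -> R[i]) (M : R) :
  (forall (c : R[i]) u v, f (c *: u + v) = c * f u + f v) -> 0 <= M ->
  (forall u, nrmc (f u) <= M * nrm u) -> exists w, forall u, f u = hdot w u.
Proof.
move=> lf M0 hM.
have f0 : f 0 = 0.
  by have := lf (-1) 0 0; rewrite !scaler0 !mulN1r addNr addr0.
have fZ c u : f (c *: u) = c * f u by rewrite -[c *: u]addr0 lf f0 addr0.
have fB u v : f (u - v) = f u - f v by rewrite -scaleN1r addrC lf mulN1r addrC.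
have [hall|] := pselect (forall u, f u = 0).
  by exists 0 => u; rewrite hdot0l hall.
move=> /existsNP [u0 fu0].
pose V := [set u | f u = 0].
have cV : csub V.
  split; first by split=> // c u v; rewrite /V /= => hu hv; rewrite lf hu hv mulr0 addr0.
  move=> u hu /=; apply: nrmc_small => e e0.
  have [d d0 hd] := eps_scale M0 e0; have [v Vv /hd uv] := hu d d0.
  have -> : f u = f (u - v) by rewrite fB Vv subr0.
  exact: le_trans (hM _) (ltW uv).
pose z := u0 - pj V u0.
have fz : f z = f u0 by rewrite fB (pj_in cV u0) subr0.
have z0 : z <> 0 by move=> z0; apply: fu0; rewrite -fz z0.
have nz : (nrm z ^+ 2)%:C != 0 :> R[i].
  by rewrite eq_complex /= eqxx andbT expf_neq0// gt_eqF// nrm_gt0.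
exists ((Num.conj (f z / (nrm z ^+ 2)%:C)) *: z) => u.
rewrite hdotZl /Num.conj /= conjcK.
have Vw : V (f u *: z - f z *: u) by rewrite /V /= fB !fZ mulrC subrr.
have := hdot_sym0 (pj_orth cV u0 Vw); rewrite -/z.
rewrite hdotBr !hdotZr hdot_nrm => /eqP; rewrite subr_eq0 => /eqP h.
by rewrite mulrAC -h mulfK.
Qed.

Definition adj {H K : hilbertType R} (T : H -> K) (v : K) : H :=
  xget 0 [set w | forall u, hdot w u = hdot v (T u)].

Section Adjoint.
Context {H K : hilbertType R}.
Implicit Types (T : H -> K).

Lemma adjl T u v : bop T -> hdot (adj T v) u = hdot v (T u).
Proof.
move=> hT; rewrite /adj; case: xgetP => [w _ h|]; first exact: h.
have [M M0 hM] := bop_bound hT; case: (hT) => lT _.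
have [|||w hw] := @riesz H (fun u => hdot v (T u)) (nrm v * M).
- by move=> c x y; rewrite lT hdotDr hdotZr.
- by rewrite mulr_ge0 ?nrm_ge0// ltW.
- by move=> x; apply: le_trans (cauchy_schwarz _ _) _; rewrite -mulrA ler_wpM2l ?nrm_ge0.
by move=> /(_ w) []; move=> x; rewrite hw.
Qed.

Lemma adjr T u v : bop T -> hdot u (adj T v) = hdot (T u) v.
Proof. by move=> hT; rewrite hdot_conj adjl// -hdot_conj. Qed.

Lemma adj_bound T (M : R) : bop T -> 0 <= M -> (forall u, nrm (T u) <= M * nrm u) ->
  forall v, nrm (adj T v) <= M * nrm v.
Proof.
move=> hT M0 hM v.
have [->|/eqP a0] := eqVneq (adj T v) 0; first by rewrite nrm0 mulr_ge0 ?nrm_ge0.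
have h : nrm (adj T v) ^+ 2 <= nrm v * (M * nrm (adj T v)).
  rewrite nrm_sqr adjl//; apply: le_trans (ler_norm _) _.
  apply: le_trans (Re_le_nrmc _) _; apply: le_trans (cauchy_schwarz _ _) _.
  by rewrite ler_wpM2l ?nrm_ge0.
by rewrite mulrA expr2 ler_pM2r ?nrm_gt0// mulrC in h.
Qed.

Lemma bop_adj T : bop T -> bop (adj T).
Proof.
move=> hT; split=> [c u v|].
  by apply: hdot_inj => w; rewrite hdotDr hdotZr !adjr// hdotDr hdotZr.
by have [M M0 hM] := bop_bound hT; exists M; [exact: ltW|apply: adj_bound => //; exact: ltW].
Qed.

End Adjoint.

Lemma adj_unique {H K : hilbertType R} (T : H -> K) (S : K -> H) : bop T ->
  (forall u v, hdot (S v) u = hdot v (T u)) -> S = adj T.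
Proof.
move=> hT h; apply/funext => v; apply: hdot_inj => w.
by rewrite [LHS]hdot_conj h -hdot_conj adjr.
Qed.

End Operators.

(** Norm, topology and completeness are derived from the inner product, so that a new Hilbert space
    is given by algebraic data and a condition on Cauchy sequences. *)
HB.factory Record Lmodule_isHilbert (R : realType) H of GRing.Lmodule R[i] H := {
  dot : H -> H -> R[i] ;
  dot_linearr : forall u (c : R[i]) v w, dot u (c *: v + w) = c * dot u v + dot u w ;
  dot_conj : forall u v, dot v u = Num.conj (dot u v) ;
  dot_ge0 : forall u, 0 <= dot u u ;
  dot_eq0 : forall u, dot u u = 0 -> u = 0 ;
  dot_complete : forall u : nat -> H,
    (forall e : R, 0 < e -> exists N : nat, forall m n : nat,
       (N <= m)%N -> (N <= n)%N -> sn dot (u m - u n) < e) ->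
    exists l : H, forall e : R, 0 < e -> exists N : nat, forall n : nat,
       (N <= n)%N -> sn dot (u n - l) < e
}.

HB.builders Context R H & Lmodule_isHilbert R H.

Lemma dot_sip : sip setT dot.
Proof.
split.
- by split.
- by move=> c a b d _ _ _; exact: dot_linearr.
- by move=> a b _ _; exact: dot_conj.
- by move=> a _; exact: dot_ge0.
Qed.

Let norm (u : H) : R[i] := (sn dot u)%:C.

Lemma norm_triangle u v : norm (u + v) <= norm u + norm v.
Proof. by rewrite -rmorphD lecR; exact: (sn_triangle dot_sip). Qed.

Lemma norm_homog (c : R[i]) u : norm (c *: u) = `|c| * norm u.
Proof. by rewrite /norm (snZ dot_sip)// rmorphM /= nrmcE. Qed.

Lemma norm_definite u : norm u = 0 -> u = 0.
Proof.
move=> /(congr1 (@complex.Re R)) /= u0; apply: dot_eq0.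
by rewrite (sn_sqr dot_sip)// u0 expr0n.
Qed.

HB.instance Definition _ := Lmodule_isNormed.Build R[i] H norm_triangle norm_homog norm_definite.

Lemma H_complete (F : set_system H) : ProperFilter F -> cauchy F -> cvg F.
Proof.
move=> FF /cauchyP cF.
have hn (u : H) : `|u| = (sn dot u)%:C by [].
(* The Cauchy filter is reduced to a sequence: [x n] is the centre of a ball of radius [1 / (n + 1)]
   that belongs to the filter. *)
have ex (n : nat) : exists x : H, F (ball x (n.+1%:R^-1)%:C).
  by apply: cF; rewrite ltcR invr_gt0.
have [x hx] := choice ex.
have dist m n : sn dot (x m - x n) < m.+1%:R^-1 + n.+1%:R^-1.
  have /filter_ex [y] : F (ball (x m) (m.+1%:R^-1)%:C `&` ball (x n) (n.+1%:R^-1)%:C).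
    by apply: filterI; exact: hx.
  rewrite -ball_normE /= => -[h1 h2].
  have : `|x m - x n| < (m.+1%:R^-1 + n.+1%:R^-1 : R)%:C.
    rewrite rmorphD /=; apply: le_lt_trans (ltrD h1 h2).
    by rewrite (distrC (x n)) -[x m - x n](subrKA y) ler_normD.
  by rewrite hn ltcR.
have [|l hl] := @dot_complete x.
  move=> e e0; have [|N hN] := @inv_small R (e / 2); first by rewrite divr_gt0.
  exists N => m n Nm Nn; apply: lt_trans (dist m n) _.
  have h1 := hN _ Nm; have h2 := hN _ Nn; rewrite [ltRHS]splitr; exact: ltrD.
apply/cvg_ex; exists l; apply/cvgrPdist_lt => e e0.
have [r r0 ->] := gt0_embed e0.
have [|N hN] := @inv_small R (r / 2); first by rewrite divr_gt0.
have [|M hM] := hl (r / 2); first by rewrite divr_gt0.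
set n := maxn N M.
have := hx n; apply: filterS => y; rewrite -ball_normE /= => h1.
rewrite -[l - y](subrKA (x n)); apply: le_lt_trans (ler_normD _ _) _.
have h2 := hM n (leq_maxr _ _); have h3 := hN n (leq_maxl _ _).
rewrite hn in h1; rewrite ltcR in h1.
rewrite (distrC l) !hn -rmorphD /= ltcR; rewrite [ltRHS]splitr; apply: ltrD => //.
exact: lt_trans h1 h3.
Qed.

HB.instance Definition _ := Uniform_isComplete.Build H H_complete.

Lemma norm_dot (u : H) : `|u| ^+ 2 = dot u u.
Proof. by rewrite (sn_sqr dot_sip)// rmorphXn. Qed.

HB.instance Definition _ :=
  CompleteNormed_isHilbert.Build R H dot_linearr dot_conj norm_dot.

HB.end.

(** * Hilbert space completion of a semi-inner product *)

Section Completion.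
Context {R : realType} {V : lmodType R[i]}.
Variables (S : set V) (s : V -> V -> R[i]) (hs : sip S s).

Let linS := sip_lin hs.

(** In the dual norm on [S], [f] is within [e] of the functional [s^~ v]. *)
Definition approx (f : V -> R[i]) (e : R) (v : V) : Prop :=
  S v /\ forall w, S w -> nrmc (f w - s w v) <= e * sn s w.

(** Prescribing [0] off [S] makes a function determined by its values on [S], so that equal vectors
    are equal functions. Null vectors of [s] give the zero function, hence no quotient has to be
    formed. *)
Definition in_completion (f : V -> R[i]) : Prop :=
  (forall w, ~ S w -> f w = 0) /\ forall e : R, 0 < e -> exists v, approx f e v.

(* The completion consists of the functions [w |-> (w, v)] on [S] and their limits in the dual norm. *)
Record completion : Type :=
  Completion { cpl_fun : V -> R[i]; cplP : `[< in_completion cpl_fun >] }.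

HB.instance Definition _ := [isSub for cpl_fun].
HB.instance Definition _ := [Choice of completion by <:].

Lemma cpl_inj (f g : completion) : cpl_fun f = cpl_fun g -> f = g.
Proof. by move=> h; apply: val_inj. Qed.

Lemma cpl_out (f : completion) w : ~ S w -> cpl_fun f w = 0.
Proof. by case: (asboolW (cplP f)) => h _; exact: h. Qed.

Lemma cpl_approx (f : completion) (e : R) : 0 < e -> exists v, approx (cpl_fun f) e v.
Proof. by case: (asboolW (cplP f)) => _; exact. Qed.

Lemma approx_lin f g e e' v v' c : approx f e v -> approx g e' v' ->
  approx (fun w => c * f w + g w) (nrmc c * e + e') (c *: v + v').
Proof.
move=> [Sv hf] [Sv' hg]; split=> [|w Sw]; first by case: linS => _; exact.
rewrite (sip_linearr hs)// opprD addrACA -mulrBr; apply: le_trans (nrmcD _ _) _.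
rewrite nrmcM mulrDl -mulrA lerD ?hg// ler_wpM2l ?nrmc_ge0//; exact: hf.
Qed.

Lemma completion_lin f g c : in_completion f -> in_completion g ->
  in_completion (fun w => c * f w + g w).
Proof.
move=> [f0 hf] [g0 hg]; split=> [w Sw|e e0]; first by rewrite f0// g0// mulr0 addr0.
have e2 : 0 < e / 2 by rewrite divr_gt0.
have [d d0 hd] := eps_scale (nrmc_ge0 c) e2; have d2 : 0 < d / 2 by rewrite divr_gt0.
have [v hv] := hf _ d2; have [v' hv'] := hg _ e2.
exists (c *: v + v'); have [Sc hc] := approx_lin c hv hv'; split=> // w Sw.
apply: le_trans (hc w Sw) _; rewrite ler_wpM2r ?sn_ge0//.
by rewrite [leRHS]splitr lerD2r ltW// hd// ltr_pdivrMr// ltr_pMr// ltr1n.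
Qed.

Lemma completion0 : in_completion (cst 0).
Proof.
split=> // e e0; exists 0; split=> [|w Sw]; first exact: lin0.
by rewrite (sip_0r hs)// subrr nrmc0 mulr_ge0 ?sn_ge0// ltW.
Qed.

Lemma completion_add f g : in_completion f -> in_completion g -> in_completion (fun w => f w + g w).
Proof.
move=> hf hg; have := completion_lin 1 hf hg; congr in_completion.
by apply/funext => w; rewrite mul1r.
Qed.

Lemma completion_scale c f : in_completion f -> in_completion (fun w => c * f w).
Proof.
move=> hf; have := completion_lin c hf completion0; congr in_completion.
by apply/funext => w; rewrite addr0.
Qed.

Definition cpl_zero := Completion (asboolT completion0).
Definition cpl_add (f g : completion) := Completion (asboolT
  (completion_add (asboolW (cplP f)) (asboolW (cplP g)))).
Definition cpl_scale (c : R[i]) (f : completion) := Completion (asboolT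
  (completion_scale c (asboolW (cplP f)))).
Definition cpl_opp := cpl_scale (-1).

Let addA : associative cpl_add.
Proof. by move=> f g h; apply: cpl_inj; apply/funext => w /=; rewrite addrA. Qed.
Let addC : commutative cpl_add.
Proof. by move=> f g; apply: cpl_inj; apply/funext => w /=; rewrite addrC. Qed.
Let add0 : left_id cpl_zero cpl_add.
Proof. by move=> f; apply: cpl_inj; apply/funext => w /=; rewrite add0r. Qed.
Let addN : left_inverse cpl_zero cpl_opp cpl_add.
Proof. by move=> f; apply: cpl_inj; apply/funext => w /=; rewrite mulN1r addNr. Qed.

HB.instance Definition _ := GRing.isZmodule.Build completion addA addC add0 addN.

Let scaleA (a b : R[i]) (f : completion) :
  cpl_scale a (cpl_scale b f) = cpl_scale (a * b) f.
Proof. by apply: cpl_inj; apply/funext => w /=; rewrite mulrA. Qed.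
Let scale1 : left_id (1 : R[i]) cpl_scale.
Proof. by move=> f; apply: cpl_inj; apply/funext => w /=; rewrite mul1r. Qed.
Let scaleDr : right_distributive cpl_scale +%R.
Proof. by move=> a f g; apply: cpl_inj; apply/funext => w /=; rewrite mulrDr. Qed.
Let scaleDl (f : completion) : {morph cpl_scale^~ f : a b / a + b}.
Proof. by move=> a b; apply: cpl_inj; apply/funext => w /=; rewrite mulrDl. Qed.

HB.instance Definition _ :=
  GRing.Zmodule_isLmodule.Build R[i] completion scaleA scale1 scaleDr scaleDl.

Lemma cpl_funE (c : R[i]) (f g : completion) w :
  cpl_fun (c *: f + g) w = c * cpl_fun f w + cpl_fun g w.
Proof. by []. Qed.

Lemma cpl_funB (f g : completion) w : cpl_fun (f - g) w = cpl_fun f w - cpl_fun g w.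
Proof. by rewrite /= mulN1r. Qed.

Lemma cpl_linear (f : completion) c v w : S v -> S w ->
  cpl_fun f (c *: v + w) = Num.conj c * cpl_fun f v + cpl_fun f w.
Proof.
move=> Sv Sw; apply/eqP; rewrite -subr_eq0; apply/eqP/nrmc_small => e e0.
have Sx : S (c *: v + w) by case: linS => _; exact.
set K := sn s (c *: v + w) + nrmc c * sn s v + sn s w.
have K0 : 0 <= K by rewrite !addr_ge0 ?mulr_ge0 ?nrmc_ge0 ?sn_ge0.
have [d0 d00 hd0] := eps_scale K0 e0; pose d := d0 / 2.
have [|u [Su hu]] := cpl_approx f (e := d); first by rewrite divr_gt0.
have hd : d * K <= e.
  by rewrite mulrC ltW// hd0// ltr_pdivrMr// ltr_pMr// ltr1n.
apply: le_trans hd.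
have -> : cpl_fun f (c *: v + w) - (Num.conj c * cpl_fun f v + cpl_fun f w) =
  (cpl_fun f (c *: v + w) - s (c *: v + w) u) - Num.conj c * (cpl_fun f v - s v u)
   - (cpl_fun f w - s w u).
  by rewrite (sip_Dl hs)//; [rewrite (sip_Zl hs)//; ring|exact: linZ].
apply: le_trans (nrmcD _ _) _; rewrite /K [leRHS]mulrDr nrmcN [X in _ <= X + _]mulrDr lerD ?hu//.
apply: le_trans (nrmcD _ _) _; rewrite nrmcN lerD ?hu// nrmcM nrmc_conj mulrCA.
by rewrite ler_wpM2l ?nrmc_ge0// hu.
Qed.

Definition seq_approx (f : completion) (n : nat) : V :=
  xget 0 [set v | approx (cpl_fun f) n.+1%:R^-1 v].

Lemma seq_approxP f n : approx (cpl_fun f) n.+1%:R^-1 (seq_approx f n).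
Proof.
rewrite /seq_approx; case: xgetP => [v _ //|].
by have [|v hv] := cpl_approx f (e := n.+1%:R^-1); [rewrite invr_gt0|move=> /(_ v)].
Qed.

Lemma cpl_bound (f : completion) : exists2 N : R, 0 < N &
  forall w, S w -> nrmc (cpl_fun f w) <= N * sn s w.
Proof.
have [v [Sv hv]] := cpl_approx f ltr01.
exists (1 + sn s v) => [|w Sw]; first by rewrite ltr_pwDl ?sn_ge0.
rewrite -[cpl_fun f w](subrK (s w v)); apply: le_trans (nrmcD _ _) _.
rewrite mulrDl lerD ?hv// mulrC; exact: (sip_cauchy_schwarz hs).
Qed.

(** [cpl_fun g w] is the inner product of [w] with [g], so the inner product of [f] with [g] is the
    limit of [cpl_fun g] along approximants of [f]. *)
Definition cpl_dot (f g : completion) : R[i] :=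
  xget 0 [set l | forall e : R, 0 < e -> exists N, forall n, (N <= n)%N ->
    nrmc (cpl_fun g (seq_approx f n) - l) < e].

Lemma approx_dist f (e e' : R) v v' : 0 <= e -> 0 <= e' -> approx f e v -> approx f e' v' ->
  sn s (v - v') <= e + e'.
Proof.
move=> e0 e0' [Sv h] [Sv' h']; have Sd : S (v - v') by exact: linB.
set d := v - v' in Sd *.
have hd : sn s d ^+ 2 <= (e + e') * sn s d.
  have -> : sn s d ^+ 2 = nrmc (s d d).
    by rewrite (sn_sqr hs)// nrmc_real ger0_norm// sqr_ge0.
  rewrite {2}/d (sip_Br hs)// -[s d v](subrK (f d)) -addrA.
  apply: le_trans (nrmcD _ _) _; rewrite mulrDl lerD ?h'// -nrmcN opprB; exact: h.
have [->|nz] := eqVneq (sn s d) 0; first by rewrite addr_ge0.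
by rewrite expr2 ler_pM2r ?lt0r ?nz ?sn_ge0 in hd.
Qed.

Lemma cpl_linB (f : completion) v w : S v -> S w ->
  cpl_fun f (v - w) = cpl_fun f v - cpl_fun f w.
Proof.
move=> Sv Sw; rewrite addrC -scaleN1r cpl_linear// rmorphN rmorph1 mulN1r.
by rewrite addrC.
Qed.

(** Any approximant of [f], not only a term of the chosen sequence, computes the inner product up to
    an error linear in [e]; all properties of the inner product are read off from this estimate. *)
Lemma cpl_dotP f g e v (N : R) : 0 <= e -> 0 <= N -> approx (cpl_fun f) e v ->
  (forall w, S w -> nrmc (cpl_fun g w) <= N * sn s w) ->
  nrmc (cpl_dot f g - cpl_fun g v) <= N * e.
Proof.
move=> e0 N0 hv hN; have [Sv _] := hv.
have hx n : S (seq_approx f n) by case: (seq_approxP f n).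
have i0 n : 0 <= n.+1%:R^-1 :> R by rewrite invr_ge0.
have dist n u e' : 0 <= e' -> approx (cpl_fun f) e' u ->
    nrmc (cpl_fun g (seq_approx f n) - cpl_fun g u) <= N * (n.+1%:R^-1 + e').
  move=> e'0 hu; have [Su _] := hu; rewrite -cpl_linB//; apply: le_trans (hN _ _) _.
    exact: linB.
  by rewrite ler_wpM2l// (approx_dist (f := cpl_fun f))//; exact: seq_approxP.
have lim : forall e : R, 0 < e -> exists M, forall n, (M <= n)%N ->
    nrmc (cpl_fun g (seq_approx f n) - cpl_dot f g) < e.
  rewrite /cpl_dot; case: xgetP => [l _ //|].
  have [|l hl] := @complex_cauchy R (fun n => cpl_fun g (seq_approx f n)).
    move=> d d0; have [d' d'0 hd'] := eps_scale N0 d0.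
    have [|M hM] := @inv_small R (d' / 2); first by rewrite divr_gt0.
    exists M => m n Mm Mn; apply: le_lt_trans (dist m _ _ (i0 n) (seq_approxP f n)) _.
    by apply: hd'; rewrite [d']splitr ltrD ?hM.
  by move=> /(_ l).
apply: (le_eps (c := N + 1)) => [|d d0]; first by rewrite addr_ge0.
have [M1 hM1] := lim d d0; have [M2 hM2] := inv_small d0.
set n := maxn M1 M2.
have h1 := hM1 n (leq_maxl _ _); have h2 := hM2 n (leq_maxr _ _).
rewrite -[cpl_dot f g](subrK (cpl_fun g (seq_approx f n))) -addrA.
apply: le_trans (nrmcD _ _) _; rewrite -nrmcN opprB.
have h3 := dist n v e e0 hv.
have h4 : N * (n.+1%:R^-1 + e) <= N * e + N * d by rewrite addrC -mulrDr ler_wpM2l// lerD2l ltW.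
apply: le_trans (lerD (ltW h1) (le_trans h3 h4)) _.
by rewrite mulrDl mul1r addrC addrA.
Qed.

Lemma cpl_dot_linear f (c : R[i]) g h :
  cpl_dot f (c *: g + h) = c * cpl_dot f g + cpl_dot f h.
Proof.
have [N1 N10 h1] := cpl_bound g; have [N2 N20 h2] := cpl_bound h.
have [N3 N30 h3] := cpl_bound (c *: g + h).
set K := N3 + (nrmc c * N1 + N2).
have K0 : 0 <= K by rewrite !addr_ge0 ?mulr_ge0 ?nrmc_ge0 ?(ltW N10) ?(ltW N20) ?(ltW N30).
apply/eqP; rewrite -subr_eq0; apply/eqP/nrmc_eq0/(eq0_eps (c := K)) => // [|e e0].
  exact: nrmc_ge0.
have [v hv] := cpl_approx f e0.
have d1 := cpl_dotP (ltW e0) (ltW N10) hv h1.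
have d2 := cpl_dotP (ltW e0) (ltW N20) hv h2.
have d3 := cpl_dotP (ltW e0) (ltW N30) hv h3.
have -> : cpl_dot f (c *: g + h) - (c * cpl_dot f g + cpl_dot f h) =
  (cpl_dot f (c *: g + h) - cpl_fun (c *: g + h) v) -
  (c * (cpl_dot f g - cpl_fun g v) + (cpl_dot f h - cpl_fun h v)).
  by rewrite cpl_funE; ring.
apply: le_trans (nrmcD _ _) _; rewrite mulrDl lerD// nrmcN.
apply: le_trans (nrmcD _ _) _; rewrite mulrDl lerD// nrmcM -mulrA ler_wpM2l ?nrmc_ge0//.
Qed.

Lemma approx_sn f e v (N : R) : 0 <= e -> 0 <= N ->
  (forall w, S w -> nrmc (cpl_fun f w) <= N * sn s w) ->
  approx (cpl_fun f) e v -> sn s v <= N + e.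
Proof.
move=> e0 N0 hN [Sv hv].
have h : sn s v ^+ 2 <= (N + e) * sn s v.
  have -> : sn s v ^+ 2 = nrmc (s v v).
    by rewrite (sn_sqr hs)// nrmc_real ger0_norm// sqr_ge0.
  rewrite -[s v v](subrK (cpl_fun f v)) mulrDl [leRHS]addrC.
  by apply: le_trans (nrmcD _ _) _; rewrite lerD ?hN// -nrmcN opprB hv.
have [->|nz] := eqVneq (sn s v) 0; first by rewrite addr_ge0.
by rewrite expr2 ler_pM2r ?lt0r ?nz ?sn_ge0 in h.
Qed.

Lemma cpl_dot_conj f g : cpl_dot g f = Num.conj (cpl_dot f g).
Proof.
have [N1 N10 h1] := cpl_bound f; have [N2 N20 h2] := cpl_bound g.
set K := N1 + (N2 + 1) + (N2 + (N1 + 1)).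
have K0 : 0 <= K by rewrite !addr_ge0 ?(ltW N10) ?(ltW N20).
apply/eqP; rewrite -subr_eq0; apply/eqP/nrmc_eq0/eqP.
rewrite eq_le nrmc_ge0 andbT.
apply: (le_eps K0) => e' e'0; rewrite add0r.
(* With [e <= 1] the norms of [v] and [w] stay below [N1 + 1] and [N2 + 1], so the total error is
   linear in [e]. *)
pose e := Num.min e' 1.
have e0 : 0 < e by rewrite lt_min e'0 ltr01.
have e1 : e <= 1 by rewrite ge_min lexx orbT.
apply: (@le_trans _ _ (K * e)); last by rewrite ler_wpM2l// ge_min lexx.
have [v hv] := cpl_approx f e0; have [w hw] := cpl_approx g e0.
have [Sv hv'] := hv; have [Sw hw'] := hw.
have d1 := cpl_dotP (ltW e0) (ltW N20) hv h2.
have d2 := cpl_dotP (ltW e0) (ltW N10) hw h1.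
have s1 := approx_sn (ltW e0) (ltW N10) h1 hv.
have s2 := approx_sn (ltW e0) (ltW N20) h2 hw.
have -> : cpl_dot g f - Num.conj (cpl_dot f g) =
  (cpl_dot g f - cpl_fun f w) + (cpl_fun f w - s w v) -
  Num.conj ((cpl_dot f g - cpl_fun g v) + (cpl_fun g v - s v w)).
  by rewrite !(rmorphD, rmorphB) /= (sip_conj hs Sv Sw); ring.
apply: le_trans (nrmcD _ _) _; rewrite nrmcN nrmc_conj /K mulrDl; apply: lerD.
  apply: le_trans (nrmcD _ _) _; rewrite mulrDl lerD//.
  apply: le_trans (hv' _ Sw) _; rewrite mulrC ler_wpM2r ?(ltW e0)//.
  by apply: le_trans s2 _; rewrite lerD2l.
apply: le_trans (nrmcD _ _) _; rewrite mulrDl lerD//.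
apply: le_trans (hw' _ Sv) _; rewrite mulrC ler_wpM2r ?(ltW e0)//.
by apply: le_trans s1 _; rewrite lerD2l.
Qed.

Lemma cpl_dot_le f (C : R) : 0 <= C -> (forall w, S w -> nrmc (cpl_fun f w) <= C * sn s w) ->
  complex.Re (cpl_dot f f) <= C ^+ 2.
Proof.
move=> C0 hC; have K0 : 0 <= C + C by rewrite addr_ge0.
apply: (le_eps K0) => e e0.
have [v hv] := cpl_approx f e0; have [Sv hv'] := hv.
have d1 := cpl_dotP (ltW e0) C0 hv hC.
have s1 := approx_sn (ltW e0) C0 hC hv.
apply: le_trans (ler_norm _) _; apply: le_trans (Re_le_nrmc _) _.
rewrite -[cpl_dot f f](subrK (cpl_fun f v)); apply: le_trans (nrmcD _ _) _.
have := hC _ Sv; nra.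
Qed.

Lemma cpl_dot_ge0 f : 0 <= cpl_dot f f.
Proof.
rewrite (conj_fix_Re (esym (cpl_dot_conj f f))) ler0c.
have [N N0 hN] := cpl_bound f.
set K := N + (N + 1).
have K0 : 0 <= K by rewrite !addr_ge0 ?(ltW N0).
rewrite -oppr_le0; apply: (le_eps K0) => e' e'0; rewrite add0r.
pose e := Num.min e' 1.
have e0 : 0 < e by rewrite lt_min e'0 ltr01.
have e1 : e <= 1 by rewrite ge_min lexx orbT.
apply: (@le_trans _ _ (K * e)); last by rewrite ler_wpM2l// ge_min lexx.
have [v hv] := cpl_approx f e0; have [Sv hv'] := hv.
have d1 := cpl_dotP (ltW e0) (ltW N0) hv hN.
have s1 := approx_sn (ltW e0) (ltW N0) hN hv.
have p := Re_ge0 (sip_ge0 hs Sv).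
have h : nrmc (cpl_dot f f - s v v) <= K * e.
  rewrite -[cpl_dot f f](subrK (cpl_fun f v)) -addrA; apply: le_trans (nrmcD _ _) _.
  rewrite /K mulrDl lerD//; apply: le_trans (hv' _ Sv) _; rewrite mulrC ler_wpM2r ?(ltW e0)//.
  by apply: le_trans s1 _; rewrite lerD2l.
apply: le_trans h; apply: le_trans (Re_le_nrmc _); rewrite ReB -normrN.
apply: le_trans (ler_norm _); lra.
Qed.

Lemma emb_in v : in_completion (fun w => if `[< S v /\ S w >] then s w v else 0).
Proof.
have [Sv|nSv] := pselect (S v); last first.
  rewrite (_ : (fun _ => _) = cst 0); first exact: completion0.
  by apply/funext => w; rewrite asboolF// => -[].
split=> [w nSw|e e0]; first by rewrite asboolF// => -[].
exists v; split=> // w Sw; rewrite asboolT// subrr nrmc0.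
by rewrite mulr_ge0 ?sn_ge0// ltW.
Qed.

Definition emb v : completion := Completion (asboolT (emb_in v)).

Lemma embE v w : S v -> S w -> cpl_fun (emb v) w = s w v.
Proof. by move=> Sv Sw /=; rewrite asboolT. Qed.

Lemma emb_approx v : S v -> approx (cpl_fun (emb v)) 0 v.
Proof. by move=> Sv; split=> // w Sw; rewrite embE// subrr nrmc0 mul0r. Qed.

Lemma emb_dot v f : S v -> cpl_dot (emb v) f = cpl_fun f v.
Proof.
move=> Sv; have [N N0 hN] := cpl_bound f.
have := cpl_dotP (lexx 0) (ltW N0) (emb_approx Sv) hN; rewrite mulr0 => h.
apply/eqP; rewrite -subr_eq0; apply/eqP/nrmc_eq0/eqP.
by rewrite eq_le h nrmc_ge0.
Qed.

Lemma emb_lin c v w : S v -> S w -> emb (c *: v + w) = c *: emb v + emb w.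
Proof.
move=> Sv Sw; apply: cpl_inj; apply/funext => x.
have Sx : S (c *: v + w) by case: linS => _; exact.
rewrite cpl_funE; have [S'|nS] := pselect (S x); last by rewrite !cpl_out// mulr0 addr0.
by rewrite !embE// (sip_linearr hs).
Qed.

Let dot_sip : sip setT cpl_dot.
Proof.
split.
- by split.
- by move=> c a b d _ _ _; exact: cpl_dot_linear.
- by move=> a b _ _; exact: cpl_dot_conj.
- by move=> a _; exact: cpl_dot_ge0.
Qed.

Lemma cpl_fun_le f w : S w -> nrmc (cpl_fun f w) <= sn s w * sn cpl_dot f.
Proof.
move=> Sw; have e : sn cpl_dot (emb w) = sn s w by rewrite /sn emb_dot// embE.
by rewrite -emb_dot// -e; exact: (sip_cauchy_schwarz dot_sip).
Qed.

Lemma cpl_dot_eq0 f : cpl_dot f f = 0 -> f = 0.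
Proof.
move=> h; apply: cpl_inj; apply/funext => w.
have [Sw|nSw] := pselect (S w); last by rewrite !cpl_out.
apply: nrmc_eq0; apply/eqP; rewrite eq_le nrmc_ge0 andbT.
by apply: le_trans (cpl_fun_le f Sw) _; rewrite /sn h sqrtr0 mulr0.
Qed.

Lemma sn_cpl_le f (C : R) : 0 <= C ->
  (forall w, S w -> nrmc (cpl_fun f w) <= C * sn s w) -> sn cpl_dot f <= C.
Proof.
move=> C0 hC; rewrite -(ler_pXn2r (n := 2))// ?nnegrE ?sn_ge0//.
rewrite sqr_sqrtr; last exact/Re_ge0/cpl_dot_ge0.
exact: cpl_dot_le.
Qed.

Lemma cpl_complete (f : nat -> completion) :
  (forall e : R, 0 < e -> exists N : nat, forall m n : nat,
     (N <= m)%N -> (N <= n)%N -> sn cpl_dot (f m - f n) < e) ->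
  exists l : completion, forall e : R, 0 < e -> exists N : nat, forall n : nat,
     (N <= n)%N -> sn cpl_dot (f n - l) < e.
Proof.
move=> cf.
have ptw w : exists l, S w -> forall e : R, 0 < e -> exists N, forall n, (N <= n)%N ->
    nrmc (cpl_fun (f n) w - l) < e.
  have [Sw|nSw] := pselect (S w); last by exists 0.
  have [|l hl] := @complex_cauchy R (fun n => cpl_fun (f n) w); last by exists l.
  move=> e e0; have [d d0 hd] := eps_scale (sn_ge0 s w) e0; have [N hN] := cf d d0.
  exists N => m n Nm Nn; rewrite -cpl_funB; apply: le_lt_trans (cpl_fun_le _ Sw) _.
  by apply: hd; exact: hN.
have [l0 hl0] := choice ptw.
pose l w := if `[< S w >] then l0 w else 0.
have lE w : S w -> l w = l0 w by move=> Sw; rewrite /l asboolT.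
have lim e N : 0 < e -> (forall m n : nat, (N <= m)%N -> (N <= n)%N ->
     sn cpl_dot (f m - f n) < e) -> forall n, (N <= n)%N ->
     forall w, S w -> nrmc (cpl_fun (f n) w - l w) <= e * sn s w.
  move=> e0 hN n Nn w Sw; rewrite lE//.
  apply: (le_eps ler01) => d d0; rewrite mul1r.
  have [M hM] := hl0 w Sw d d0; set m := maxn N M.
  rewrite -[cpl_fun (f n) w](subrK (cpl_fun (f m) w)) -addrA.
  apply: le_trans (nrmcD _ _) _; apply: lerD; last by apply/ltW/hM; exact: leq_maxr.
  rewrite -cpl_funB; apply: le_trans (cpl_fun_le _ Sw) _.
  rewrite mulrC ler_wpM2r ?sn_ge0// ltW// hN//; exact: leq_maxl.
have inl : in_completion l.
  split=> [w nSw|e e0]; first by rewrite /l asboolF.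
  have e2 : 0 < e / 2 by rewrite divr_gt0.
  have [N hN] := cf _ e2; have [v [Sv hv]] := cpl_approx (f N) e2.
  exists v; split=> // w Sw.
  rewrite -[l w](subrK (cpl_fun (f N) w)) -addrA [e]splitr mulrDl.
  apply: le_trans (nrmcD _ _) _; apply: lerD; last exact: hv.
  by rewrite -nrmcN opprB; exact: (lim _ N).
exists (Completion (asboolT inl)) => e e0.
have e2 : 0 < e / 2 by rewrite divr_gt0.
have [N hN] := cf _ e2; exists N => n Nn.
apply: (@le_lt_trans _ _ (e / 2)); last lra.
apply: sn_cpl_le => [|w Sw]; first exact: ltW.
by rewrite cpl_funB; exact: (lim _ N).
Qed.

HB.instance Definition _ := @Lmodule_isHilbert.Build R completion
  cpl_dot cpl_dot_linear cpl_dot_conj cpl_dot_ge0 cpl_dot_eq0 cpl_complete.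

Lemma completion_exists : exists (H : hilbertType R) (j : V -> H),
  [/\ forall c a b, S a -> S b -> j (c *: a + b) = c *: j a + j b,
      forall a b, S a -> S b -> hdot (j a) (j b) = s a b
    & forall u, clos [set j a | a in S] u].
Proof.
exists completion, emb; split; first exact: emb_lin.
  by move=> a b Sa Sb; rewrite -(embE Sb Sa) -emb_dot.
move=> u e e0; have e2 : 0 < e / 2 by rewrite divr_gt0.
have [v [Sv hv]] := cpl_approx u e2; exists (emb v); first by exists v.
have -> : nrm (u - emb v) = sn cpl_dot (u - emb v) by [].
apply: (@le_lt_trans _ _ (e / 2)); last lra.
apply: sn_cpl_le => [|w Sw]; first exact: ltW.
by rewrite cpl_funB embE// hv.
Qed.

End Completion.

(** * Extension of densely defined bounded maps *)

Section Extension.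
Context {R : realType} {V : lmodType R[i]} {H K : hilbertType R}.
Variables (S : set V) (f : V -> H) (g : V -> K) (C : R).
Hypothesis linS : linear_set S.
Hypothesis lf : forall c a b, S a -> S b -> f (c *: a + b) = c *: f a + f b.
Hypothesis lg : forall c a b, S a -> S b -> g (c *: a + b) = c *: g a + g b.
Hypothesis C0 : 0 <= C.
Hypothesis gf : forall a, S a -> nrm (g a) <= C * nrm (f a).

(** The closure of the graph of [f a |-> g a]. *)
Let rel (u : H) (k : K) := forall e : R, 0 < e ->
  exists a, [/\ S a, nrm (u - f a) < e & nrm (k - g a) < e].

Lemma linear_image (W : hilbertType R) (h : V -> W) :
  (forall c a b, S a -> S b -> h (c *: a + b) = c *: h a + h b) ->
  linear_set [set h a | a in S].
Proof.
move=> lh; have h0 : h 0 = 0.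
  have := lh (-1) 0 0 (lin0 linS) (lin0 linS).
  by rewrite scaler0 addr0 scaleN1r addNr.
split; first by exists 0 => //; exact: lin0.
move=> c _ _ [a Sa <-] [b Sb <-]; exists (c *: a + b); last exact: lh.
by case: linS => _; exact.
Qed.

Let D := clos [set f a | a in S].
Let cD : csub D := clos_linear (linear_image lf).

Let rel_lin c u v k l : rel u k -> rel v l -> rel (c *: u + v) (c *: k + l).
Proof.
move=> h1 h2 e e0; have e2 : 0 < e / 2 by rewrite divr_gt0.
have [d d0 hd] := eps_scale (nrmc_ge0 c) e2.
have [a [Sa ua ka]] := h1 d d0; have [b [Sb vb lb]] := h2 _ e2.
have aux (W : hilbertType R) (x x' y y' : W) : nrm (x - x') < d ->
    nrm (y - y') < e / 2 -> nrm (c *: x + y - (c *: x' + y')) < e.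
  move=> h h'; rewrite opprD addrACA -scalerBr; apply: le_lt_trans (nrmD _ _) _.
  by rewrite nrmZ [e]splitr ltrD// hd.
exists (c *: a + b); split; first by case: linS => _; exact.
  by rewrite lf//; exact: aux.
by rewrite lg//; exact: aux.
Qed.

Let rel_le u k : rel u k -> nrm k <= C * nrm u.
Proof.
move=> h; have c0 : 0 <= 1 + C by rewrite addr_ge0.
apply: (le_eps c0) => e e0; have [a [Sa ua ka]] := h e e0.
have h1 : nrm k <= nrm (k - g a) + nrm (g a).
  by apply: le_trans (nrmD _ _); rewrite subrK.
have h2 : nrm (f a) <= nrm (u - f a) + nrm u.
  by rewrite nrm_distC; apply: le_trans (nrmD _ _); rewrite subrK.
have h3 := gf Sa.
have h4 : C * nrm (f a) <= C * (e + nrm u).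
  by rewrite ler_wpM2l//; apply: le_trans h2 _; rewrite lerD2r ltW.
apply: le_trans h1 _; apply: le_trans (lerD (ltW ka) (le_trans h3 h4)) _.
by rewrite mulrDr mulrDl mul1r addrA addrC.
Qed.

Let rel_ex u : D u -> exists k, rel u k.
Proof.
move=> Du.
have ex (n : nat) : exists a, S a /\ nrm (u - f a) < n.+1%:R^-1.
  by have [|_ [a Sa <-] h] := Du n.+1%:R^-1; [rewrite invr_gt0|exists a].
have [a ha] := choice ex.
have fB x y : S x -> S y -> f (x - y) = f x - f y.
  by move=> Sx Sy; rewrite addrC -scaleN1r lf// scaleN1r addrC.
have gB x y : S x -> S y -> g (x - y) = g x - g y.
  by move=> Sx Sy; rewrite addrC -scaleN1r lg// scaleN1r addrC.
have [|k hk] := @hilbert_complete R K (fun n => g (a n)).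
  move=> e e0; have [d d0 hd] := eps_scale C0 e0.
  have [|N hN] := @inv_small R (d / 2); first by rewrite divr_gt0.
  exists N => m n Nm Nn; have [Sm um] := ha m; have [Sn un] := ha n.
  have Smn : S (a m - a n) by exact: linB.
  rewrite -gB//; apply: le_lt_trans (gf Smn) _; apply: hd.
  rewrite fB// -[f (a m)](subrK u) -addrA; apply: le_lt_trans (nrmD _ _) _.
  rewrite nrm_distC [ltRHS]splitr; apply: ltrD.
    exact: lt_trans um (hN _ Nm).
  exact: lt_trans un (hN _ Nn).
exists k => e e0; have [N1 h1] := hk e e0; have [N2 h2] := inv_small e0.
exists (a (maxn N1 N2)); have [Sn un] := ha (maxn N1 N2); split=> //.
  by apply: lt_trans un (h2 _ _); exact: leq_maxr.
by rewrite nrm_distC h1// leq_maxl.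
Qed.

(** Continuity extends the map to the closure of the range of [f], and the value [0] on the
    orthogonal complement extends it to the whole space. The third clause makes the complement of an
    orbit invisible to the intertwiners built from it. *)
Lemma extend_bounded : exists W : H -> K,
  [/\ bop W, forall a, S a -> W (f a) = g a,
      forall u, (forall a, S a -> hdot (f a) u = 0) -> W u = 0
    & forall u, nrm (W u) <= C * nrm u].
Proof.
have ex u : exists k, rel (pj D u) k by apply: rel_ex; exact: pj_in.
have [W hW] := choice ex.
have uniq u k l : rel u k -> rel u l -> k = l.
  move=> h1 h2; have := rel_le (rel_lin (-1) h1 h2).
  rewrite !scaleN1r addNr nrm0 mulr0 => h.
  apply/eqP; rewrite eq_sym -subr_eq0; apply/eqP/nrm_eq0/eqP.
  by rewrite eq_le nrm_ge0 andbT addrC.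
have bW u : nrm (W u) <= C * nrm u.
  by apply: le_trans (rel_le (hW u)) _; rewrite ler_wpM2l// pj_le.
exists W; split=> //.
- split=> [c u v|]; last by exists C.
  by apply: (uniq (pj D (c *: u + v))) => //; rewrite pj_linear//; exact: rel_lin.
- move=> a Sa; apply: (uniq (pj D (f a))) => //.
  rewrite pj_id//; last by apply: clos_sub; exists a.
  by move=> e e0; exists a; rewrite !subrr !nrm0.
- move=> u hu; apply: (uniq (pj D u)) => //.
  rewrite pj_eq0//.
    move=> e e0; have := rel_ex (lin0 cD.1) => -[k hk].
    have -> : 0 = k.
      apply/esym/nrm_eq0/eqP; rewrite eq_le nrm_ge0 andbT.
      by apply: le_trans (rel_le hk) _; rewrite nrm0 mulr0.
    exact: hk.
  move=> w Dw; apply: hdot_sym0.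
  by apply: clos_orth Dw => _ [a Sa <-]; rewrite hdot_conj hu// rmorph0.
Qed.

End Extension.

(** * The direct sum of two copies of a Hilbert space *)

Section DirectSum.
Context {R : realType} {H : hilbertType R}.

Definition dsum : Type := (H * H)%type.

HB.instance Definition _ := GRing.Lmodule.on dsum.

Definition dsum_dot (u v : dsum) : R[i] := hdot u.1 v.1 + hdot u.2 v.2.

Lemma dsum_dot_linear u (c : R[i]) v w :
  dsum_dot u (c *: v + w) = c * dsum_dot u v + dsum_dot u w.
Proof. by rewrite /dsum_dot /= !hdotDr !hdotZr; ring. Qed.

Lemma dsum_dot_conj u v : dsum_dot v u = Num.conj (dsum_dot u v).
Proof. by rewrite /dsum_dot rmorphD /= -!hdot_conj. Qed.

Lemma dsum_dot_nrm u : dsum_dot u u = (nrm u.1 ^+ 2 + nrm u.2 ^+ 2)%:C.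
Proof. by rewrite /dsum_dot !hdot_nrm rmorphD. Qed.

Lemma dsum_dot_ge0 u : 0 <= dsum_dot u u.
Proof. by rewrite dsum_dot_nrm ler0c addr_ge0// sqr_ge0. Qed.

Lemma dsum_dot_eq0 u : dsum_dot u u = 0 -> u = 0.
Proof.
rewrite dsum_dot_nrm => /(congr1 (@complex.Re R)) /= /eqP.
rewrite paddr_eq0 ?sqr_ge0// !sqrf_eq0 => /andP[/eqP h1 /eqP h2].
by case: u h1 h2 => a b /= /nrm_eq0 -> /nrm_eq0 ->.
Qed.

Lemma sn_dsum_ge u : nrm u.1 <= sn dsum_dot u /\ nrm u.2 <= sn dsum_dot u.
Proof.
rewrite /sn dsum_dot_nrm /=; split.
  rewrite -[leLHS]ger0_norm ?nrm_ge0// -sqrtr_sqr.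
  by rewrite ler_sqrt ?addr_ge0 ?sqr_ge0// lerDl sqr_ge0.
rewrite -[leLHS]ger0_norm ?nrm_ge0// -sqrtr_sqr.
by rewrite ler_sqrt ?addr_ge0 ?sqr_ge0// lerDr sqr_ge0.
Qed.

Lemma sn_dsum_le u : sn dsum_dot u <= nrm u.1 + nrm u.2.
Proof.
rewrite -(ler_pXn2r (n := 2))// ?nnegrE ?sn_ge0 ?addr_ge0 ?nrm_ge0//.
rewrite sqr_sqrtr dsum_dot_nrm /= ?addr_ge0 ?sqr_ge0//.
have := nrm_ge0 u.1; have := nrm_ge0 u.2; nra.
Qed.

Lemma dsum_complete (u : nat -> dsum) :
  (forall e : R, 0 < e -> exists N : nat, forall m n : nat,
     (N <= m)%N -> (N <= n)%N -> sn dsum_dot (u m - u n) < e) ->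
  exists l : dsum, forall e : R, 0 < e -> exists N : nat, forall n : nat,
     (N <= n)%N -> sn dsum_dot (u n - l) < e.
Proof.
move=> cu.
have [|l1 h1] := @hilbert_complete R H (fun n => (u n).1).
  move=> e /cu [N hN]; exists N => m n Nm Nn.
  by apply: le_lt_trans (hN _ _ Nm Nn); case: (sn_dsum_ge (u m - u n)).
have [|l2 h2] := @hilbert_complete R H (fun n => (u n).2).
  move=> e /cu [N hN]; exists N => m n Nm Nn.
  by apply: le_lt_trans (hN _ _ Nm Nn); case: (sn_dsum_ge (u m - u n)).
exists (l1, l2) => e e0; have e2 : 0 < e / 2 by rewrite divr_gt0.
have [N1 hN1] := h1 _ e2; have [N2 hN2] := h2 _ e2.
exists (maxn N1 N2) => n; rewrite geq_max => /andP[/hN1 k1 /hN2 k2].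
by apply: le_lt_trans (sn_dsum_le _) _; rewrite [e]splitr; exact: ltrD.
Qed.

HB.instance Definition _ := @Lmodule_isHilbert.Build R dsum
  dsum_dot dsum_dot_linear dsum_dot_conj dsum_dot_ge0 dsum_dot_eq0 dsum_complete.

Lemma dsumE (u v : dsum) : hdot u v = hdot u.1 v.1 + hdot u.2 v.2.
Proof. by []. Qed.

Lemma dsum_nrm_ge (u : dsum) : nrm u.1 <= nrm u /\ nrm u.2 <= nrm u.
Proof. exact: sn_dsum_ge. Qed.

Lemma dsum_nrm_le (u : dsum) : nrm u <= nrm u.1 + nrm u.2.
Proof. exact: sn_dsum_le. Qed.

End DirectSum.
Arguments dsum {R} H.

(** * Commutants, projections, real and imaginary parts *)

Section VonNeumann.
Context {R : realType} {H : hilbertType R}.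
Implicit Types (X M : set (H -> H)) (T p : H -> H) (V : set H).

Definition star_closed X : Prop := forall T, X T -> bop T /\ X (adj T).

Lemma comm_app X T S u : commutant X T -> X S -> T (S u) = S (T u).
Proof. by move=> [_ h] /h /(congr1 (fun f => f u)). Qed.

Lemma commutant_bop X T : commutant X T -> bop T.
Proof. by move=> [/bounded_opP]. Qed.

Lemma commutantP X T : bop T -> (forall S u, X S -> T (S u) = S (T u)) -> commutant X T.
Proof.
by move=> hT h; split=> [|S XS]; [exact/bounded_opP|apply/funext => u; exact: h].
Qed.

Lemma commutant_comp X S T : commutant X S -> commutant X T -> commutant X (S \o T).
Proof.
move=> hS hT; apply: commutantP => [|Y u XY /=].
  by apply: bop_comp; [exact: commutant_bop hT|exact: commutant_bop hS].
by rewrite (comm_app _ hT)// (comm_app _ hS).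
Qed.

Lemma commutant_lin X S T (c : R[i]) : X `<=` bop -> commutant X S -> commutant X T ->
  commutant X (fun u => c *: S u + T u).
Proof.
move=> bX hS hT; apply: commutantP => [|Y u XY].
  by apply: bop_lin; [exact: commutant_bop hS|exact: commutant_bop hT].
rewrite (comm_app _ hT)// (comm_app _ hS)//.
by have [-> _] := bX _ XY.
Qed.

Lemma commutant_id X : commutant X id.
Proof. by apply: commutantP => //; exact: bop_id. Qed.

Lemma commutant0 X : X `<=` bop -> commutant X (cst 0).
Proof. by move=> bX; apply: commutantP => [|Y u /bX hY /=]; [exact: bop_cst0|rewrite bop0]. Qed.

Lemma commutant_scale X T (c : R[i]) : X `<=` bop -> commutant X T ->
  commutant X (fun u => c *: T u).
Proof.
move=> bX hT; have := commutant_lin c bX hT (commutant0 bX).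
by congr commutant; apply/funext => u /=; rewrite addr0.
Qed.

Lemma commutant_add X S T : X `<=` bop -> commutant X S -> commutant X T ->
  commutant X (fun u => S u + T u).
Proof.
move=> bX hS hT; have := commutant_lin 1 bX hS hT.
by congr commutant; apply/funext => u /=; rewrite scale1r.
Qed.

Lemma commutant_sub X S T : X `<=` bop -> commutant X S -> commutant X T ->
  commutant X (fun u => S u - T u).
Proof.
move=> bX hS hT; have := commutant_lin (-1) bX hT hS.
by congr commutant; apply/funext => u /=; rewrite scaleN1r addrC.
Qed.

Lemma star_closed_bop X : star_closed X -> X `<=` bop.
Proof. by move=> h T /h []. Qed.

Lemma commutant_star X : star_closed X -> star_closed (commutant X).
Proof.
move=> sX T hT; have bT := commutant_bop hT; split=> //.
apply: commutantP => [|S u XS]; first exact: bop_adj.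
have [bS XS'] := sX _ XS; apply: hdot_inj => w.
by rewrite adjr// -(adjl u (T w) bS) -(comm_app _ hT XS') -adjr// adjl.
Qed.

Lemma bicommutant_sub X : X `<=` bop -> X `<=` bicommutant X.
Proof.
move=> bX T XT; apply: commutantP => [|S u hS]; first exact: bX.
by rewrite (comm_app _ hS).
Qed.

Lemma tricommutant X : X `<=` bop -> commutant (bicommutant X) = commutant X.
Proof.
move=> bX; apply/seteqP; split=> [T hT|T hT].
  apply: commutantP => [|S u XS]; first exact: commutant_bop hT.
  by rewrite (comm_app _ hT)//; exact: bicommutant_sub.
apply: commutantP => [|S u hS]; first exact: commutant_bop hT.
by rewrite (comm_app _ hS).
Qed.

Lemma bicommutant_star X : star_closed X -> star_closed (bicommutant X).
Proof. by move=> sX; do 2 apply: commutant_star. Qed.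

Lemma commutant_bops X : commutant X `<=` bop.
Proof. by move=> T /commutant_bop. Qed.

(** The orthogonal complement of [V] is invariant too, because [X] contains the adjoints of its
    elements. *)
Lemma pj_commutant X V : star_closed X -> csub V ->
  (forall T u, X T -> V u -> V (T u)) -> commutant X (pj V).
Proof.
move=> sX cV inv; apply: commutantP => [|T u XT]; first exact: bop_pj.
have [bT XT'] := sX _ XT.
apply: pj_unique => //; first by apply: inv => //; exact: pj_in.
by move=> w Vw; rewrite -bopB// -adjl// pj_orth//; exact: inv.
Qed.

Lemma projection_pj V : csub V -> projection (pj V).
Proof.
move=> cV; split; first exact/bounded_opP/bop_pj.
  by apply/funext => u /=; apply: pj_id => //; exact: pj_in.
by move=> u v; exact: pj_sa.
Qed.

Lemma re_part_sa T u v : bop T -> hdot (T u + adj T u) v = hdot u (T v + adj T v).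
Proof. by move=> bT; rewrite hdotDl hdotDr adjl// adjr// addrC. Qed.

Lemma im_part_sa T u v : bop T ->
  hdot ('i%C *: (T u - adj T u)) v = hdot u ('i%C *: (T v - adj T v)).
Proof. by move=> bT; rewrite hdotZl hdotZr conji hdotBl hdotBr adjl// adjr//; ring. Qed.

Lemma cartesian_decomposition T u :
  T u = (2^-1)%:C *: ((T u + adj T u) - 'i%C *: ('i%C *: (T u - adj T u))).
Proof. by rewrite scalerA -expr2 sqr_i scaleN1r opprK addrACA subrr addr0 half2. Qed.

Lemma proj_bop p : projection p -> bop p.
Proof. by move=> [/bounded_opP]. Qed.

Lemma proj_idem p u : projection p -> p (p u) = p u.
Proof. by move=> [_ /(congr1 (fun f => f u))]. Qed.

Lemma proj_sa p u v : projection p -> hdot (p u) v = hdot u (p v).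
Proof. by move=> [_ _]; exact. Qed.

Lemma proj_neq0 p : p <> cst 0 -> exists u, p u <> 0.
Proof.
move=> h; apply: contrapT => /forallNP k; apply: h; apply/funext => u /=.
exact: contrapT (k u).
Qed.

End VonNeumann.

(** * States and representations of C*-algebras *)

Section ScalarIteration.
Context {R : realType}.

(* The Picard iteration for [t = (1 + t^2) / 2]; it dominates the operator iterations that
   compute square roots, since it bounds their norms and the norms of their increments. *)
Fixpoint sqrt_iter (n : nat) : R := if n is m.+1 then 2^-1 * (1 + sqrt_iter m ^+ 2) else 0.

Lemma sqrt_iter_bounds n : 0 <= sqrt_iter n <= 1.
Proof. by elim: n => [|n /andP[h1 h2]] /=; [rewrite lexx ler01|nra]. Qed.

Lemma sqrt_iter_incr n : sqrt_iter n <= sqrt_iter n.+1.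
Proof. by have := sqrt_iter_bounds n => /=; nra. Qed.

Lemma sqrt_iter_cauchy (e : R) : 0 < e -> exists N, forall m n, (N <= n)%N -> (n <= m)%N ->
  sqrt_iter m - sqrt_iter n < e.
Proof.
move=> e0.
have incr : nondecreasing_seq sqrt_iter by apply/nondecreasing_seqP; exact: sqrt_iter_incr.
have : cvgn sqrt_iter.
  apply: nondecreasing_is_cvgn => //; exists 1 => _ [n _ <-].
  by case/andP: (sqrt_iter_bounds n).
move=> /cvg_ex [l hl]; have e2 : 0 < e / 2 by rewrite divr_gt0.
move/cvgrPdist_lt: hl => /(_ _ e2) [N _ hN]; exists N => m n Nn nm.
have h1 := hN n Nn; have h2 := hN m (leq_trans Nn nm).
rewrite /= in h1 h2; move: h1 h2; rewrite !ltr_norml => /andP[h1 h2] /andP[h3 h4]; lra.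
Qed.

End ScalarIteration.

(** * Norm, square roots and states of a C*-algebra *)

Section CStarBasics.
Context {R : realType} {A : cstarType R}.
Implicit Types (S : set A) (a b x y : A).

Lemma starD a b : star (a + b) = star a + star b.
Proof. by have := star_conj_linear 1 a b; rewrite scale1r rmorph1 scale1r. Qed.

Lemma star0 : star (0 : A) = 0.
Proof. by apply: addr_fix0; rewrite -starD addr0. Qed.

Lemma starZ (c : R[i]) a : star (c *: a) = Num.conj c *: star a.
Proof. by have := star_conj_linear c a 0; rewrite !addr0 star0 addr0. Qed.

Lemma starN a : star (- a) = - star a.
Proof. by rewrite -scaleN1r starZ rmorphN rmorph1 scaleN1r. Qed.

Lemma starB a b : star (a - b) = star a - star b.
Proof. by rewrite starD starN. Qed.

Lemma star1 : star (1 : A) = 1.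
Proof. by rewrite -[LHS]mul1r -{1}(starK 1) -starM mul1r starK. Qed.

Definition cn a : R := complex.Re (cnorm a).

Lemma cnorm0 : cnorm (0 : A) = 0.
Proof. by rewrite -(scale0r 0) cnormZ normr0 mul0r. Qed.

Lemma cnorm_ge0 a : 0 <= cnorm a.
Proof.
have := cnormD_le a (-1 *: a); rewrite scaleN1r subrr cnorm0.
by rewrite -scaleN1r cnormZ normrN1 mul1r -mulr2n pmulrn_lge0.
Qed.

Lemma cnE a : cnorm a = (cn a)%:C.
Proof. by rewrite /cn -ge0_Re// cnorm_ge0. Qed.

Lemma cn_ge0 a : 0 <= cn a.
Proof. exact/Re_ge0/cnorm_ge0. Qed.

Lemma cn0 : cn 0 = 0. Proof. by rewrite /cn cnorm0. Qed.

Lemma cn_eq0 a : cn a = 0 -> a = 0.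
Proof. by move=> a0; apply: cnorm_eq0; rewrite cnE a0. Qed.

Lemma cnD a b : cn (a + b) <= cn a + cn b.
Proof. by rewrite -lecR rmorphD /= -!cnE cnormD_le. Qed.

Lemma cnM a b : cn (a * b) <= cn a * cn b.
Proof. by rewrite -lecR rmorphM /= -!cnE cnormM_le. Qed.

Lemma cnZ (c : R[i]) a : cn (c *: a) = nrmc c * cn a.
Proof. by apply: complexI; rewrite rmorphM /= -cnE -nrmcE cnormZ -cnE. Qed.

Lemma cnN a : cn (- a) = cn a.
Proof. by rewrite -scaleN1r cnZ nrmcN nrmc1 mul1r. Qed.

Lemma cn_distC a b : cn (a - b) = cn (b - a).
Proof. by rewrite -cnN opprB. Qed.

Lemma cn_starM a : cn (star a * a) = cn a ^+ 2.
Proof. by apply: complexI; rewrite -cnE cstar_id cnE rmorphXn. Qed.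

Lemma cn_star a : cn (star a) = cn a.
Proof.
have h x : cn x <= cn (star x).
  have [->|x0] := eqVneq (cn x) 0; first exact: cn_ge0.
  by have := cnM (star x) x; rewrite cn_starM expr2 ler_pM2r// lt0r x0 cn_ge0.
by apply/eqP; rewrite eq_le h andbT -{2}(starK a) h.
Qed.

Lemma cn1 : cn 1 <= 1.
Proof.
have h : cn 1 = cn 1 ^+ 2 by rewrite -cn_starM star1 mul1r.
have := cn_ge0 1; nra.
Qed.

Lemma cn_complete (u : nat -> A) :
  (forall e : R, 0 < e -> exists N, forall m n, (N <= m)%N -> (N <= n)%N ->
     cn (u m - u n) < e) ->
  exists l, forall e : R, 0 < e -> exists N, forall n, (N <= n)%N -> cn (u n - l) < e.
Proof.
move=> cu; have [|l hl] := cnorm_complete u.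
  move=> e e0; have [r r0 ->] := gt0_embed e0; have [N hN] := cu r r0.
  by exists N => m n Nm Nn; rewrite cnE ltcR hN.
exists l => e e0; have [|N hN] := hl e%:C; first by rewrite ltcR.
by exists N => n Nn; have := hN n Nn; rewrite cnE ltcR.
Qed.

Definition cclos S : set A := [set a | forall e : R, 0 < e -> exists2 b, S b & cn (a - b) < e].

Lemma norm_closedP S : norm_closed S <-> cclos S `<=` S.
Proof.
split=> h a ha; apply: h => e e0.
  have [r r0 ->] := gt0_embed e0; have [b Sb hb] := ha r r0.
  by exists b => //; rewrite cnE ltcR.
have [|b Sb hb] := ha e%:C; first by rewrite ltcR.
by exists b => //; move: hb; rewrite cnE ltcR.
Qed.

Lemma closed_kernel (B : zmodType) (N : B -> R) (F : A -> B) (C : R) (a : A) S :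
  (forall x : B, 0 <= N x) -> (forall x : B, N x = 0 -> x = 0) -> 0 <= C ->
  {morph F : x y / x - y} -> (forall x, N (F x) <= C * cn x) ->
  (forall b, S b -> F b = 0) -> cclos S a -> F a = 0.
Proof.
move=> N0 N1 C0 FB FN F0 ha; apply/N1/(eq0_eps (c := C)) => // e e0.
have [b Sb hb] := ha e e0.
have -> : F a = F (a - b) by rewrite FB (F0 _ Sb) subr0.
by apply: le_trans (FN _) _; rewrite ler_wpM2l// ltW.
Qed.

Lemma norm_closed_eq (F G : A -> A) (M N : R) : {morph F : x y / x - y} ->
  {morph G : x y / x - y} -> (forall x, cn (F x) <= M * cn x) ->
  (forall x, cn (G x) <= N * cn x) -> 0 <= M -> 0 <= N -> norm_closed [set x | F x = G x].
Proof.
move=> FB GB hF hG M0 N0; apply/norm_closedP => x hx /=; apply/eqP; rewrite -subr_eq0; apply/eqP.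
apply: (closed_kernel (F := fun x => F x - G x) (N := cn) (C := M + N) _ _ _ _ _ _ hx).
- exact: cn_ge0.
- exact: cn_eq0.
- exact: addr_ge0.
- by move=> a b; rewrite FB GB !opprD !opprK addrACA.
- by move=> a; apply: le_trans (cnD _ _) _; rewrite cnN mulrDl lerD.
- by move=> b /= ->; rewrite subrr.
Qed.

Section Subalgebra.
Variables (S : set A) (hS : cstar_subalgebra S).

Lemma csa1 : S 1. Proof. by case: hS. Qed.
Lemma csa_lin : linear_set S.
Proof.
case: hS => S1 SD _ _ _; split=> //.
by have := SD (-1) 1 1 S1 S1; rewrite scaleN1r addNr.
Qed.
Lemma csaM a b : S a -> S b -> S (a * b). Proof. by case: hS => _ _ h _ _; exact: h. Qed.
Lemma csa_star a : S a -> S (star a). Proof. by case: hS => _ _ _ h _; exact: h. Qed.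
Lemma csa_closed : cclos S `<=` S.
Proof. by case: hS => _ _ _ _ /norm_closedP. Qed.

Let lS := csa_lin.

Fixpoint csqrt_iter x (n : nat) : A :=
  if n is m.+1 then (2^-1)%:C *: (x + csqrt_iter x m * csqrt_iter x m) else 0.

(** The limit of the iteration solves [2 y = x + y^2], that is [(1 - y)^2 = 1 - x]; thus [1 - x]
    gets a self-adjoint square root inside [S] without spectral theory. *)
Lemma csqrt_exists x : S x -> star x = x -> cn x <= 1 ->
  exists y, [/\ S y, star y = y, (1 - y) * (1 - y) = 1 - x
    & forall b, b * x = x * b -> b * y = y * b].
Proof.
move=> Sx sx nx; pose y n := csqrt_iter x n; pose t := @sqrt_iter R.
have Sy n : S (y n).
  by elim: n => [|n IH] /=; [exact: lin0|apply: linZ => //; apply: linD => //; exact: csaM].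
have sy n : star (y n) = y n.
  by elim: n => [|n IH] /=; rewrite ?star0// starZ conjr starD starM IH sx.
have ny n : cn (y n) <= t n.
  elim: n => [|n IH]; first by rewrite cn0.
  rewrite /y /t /= cnZ nrmc_half ler_wpM2l ?invr_ge0//.
  apply: le_trans (cnD _ _) _; apply: lerD => //; apply: le_trans (cnM _ _) _.
  by rewrite expr2 ler_pM ?cn_ge0.
have t1 n : t n <= 1 by case/andP: (sqrt_iter_bounds (R := R) n).
have sqB u v : u * u - v * v = u * (u - v) + (u - v) * v.
  by rewrite mulrBr mulrBl addrA subrK.
have dy n : cn (y n.+1 - y n) <= t n.+1 - t n.
  elim: n => [|n IH].
    rewrite subr0 /y /t /= mulr0 addr0 cnZ nrmc_half expr0n /= addr0 subr0.
    by rewrite ler_wpM2l ?invr_ge0.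
  have -> : y n.+2 - y n.+1 = (2^-1)%:C *: (y n.+1 * y n.+1 - y n * y n).
    by rewrite {1}/y /= -scalerBr opprD addrACA subrr add0r.
  have -> : t n.+2 - t n.+1 = 2^-1 * (t n.+1 * (t n.+1 - t n) + (t n.+1 - t n) * t n).
    by rewrite /t /=; set s := sqrt_iter n; field.
  rewrite cnZ nrmc_half ler_wpM2l ?invr_ge0// sqB.
  apply: le_trans (cnD _ _) _; apply: lerD.
    by apply: le_trans (cnM _ _) _; rewrite ler_pM ?cn_ge0.
  by apply: le_trans (cnM _ _) _; rewrite ler_pM ?cn_ge0.
have dmn k n : cn (y (n + k)%N - y n) <= t (n + k)%N - t n.
  elim: k => [|k IH]; first by rewrite addn0 !subrr cn0.
  rewrite addnS -[y (n + k).+1](subrK (y (n + k)%N)) -addrA.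
  apply: le_trans (cnD _ _) _; apply: le_trans (lerD (dy _) IH) _.
  by rewrite addrA subrK.
have [|l hl] := @cn_complete y.
  move=> e e0; have [N hN] := sqrt_iter_cauchy e0; exists N => m n Nm Nn.
  wlog nm : m n Nm Nn / (n <= m)%N => [hw|].
    by have [nm|/ltnW mn] := leqP n m; [exact: hw|rewrite cn_distC; exact: hw].
  by rewrite -(subnKC nm); apply: le_lt_trans (dmn _ _) _; apply: hN => //; rewrite leq_addr.
have nl : cn l <= 1.
  apply: (le_eps ler01) => e e0; have [N hN] := hl e e0.
  have h := hN N (leqnn _); rewrite -[l](subrK (y N)); apply: le_trans (cnD _ _) _.
  by rewrite cn_distC mul1r addrC lerD ?(ltW h)//; apply: le_trans (ny N) _.
have fix_l : l = (2^-1)%:C *: (x + l * l).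
  apply/eqP; rewrite -subr_eq0; apply/eqP/cn_eq0/(eq0_eps (c := 2)) => // [|e e0].
    exact: cn_ge0.
  have [N hN] := hl e e0; have h1 := hN N (leqnn _); have h2 := hN N.+1 (leqnSn _).
  rewrite -[l - _](subrKA (y N.+1)); apply: le_trans (cnD _ _) _.
  rewrite mulrDl mul1r; apply: lerD; first by rewrite cn_distC ltW.
  rewrite {1}/y /= -scalerBr opprD addrACA subrr add0r cnZ nrmc_half sqB.
  have h3 : cn (y N * (y N - l)) <= e.
    apply: le_trans (cnM _ _) _; rewrite -[e]mul1r ler_pM ?cn_ge0 ?(ltW h1)//.
    exact: le_trans (ny N) _.
  have h4 : cn ((y N - l) * l) <= e.
    by apply: le_trans (cnM _ _) _; rewrite -[e]mulr1 ler_pM ?cn_ge0 ?(ltW h1).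
  have := cnD (y N * (y N - l)) ((y N - l) * l); rewrite /y in h3 h4 *; lra.
exists l; split.
- by apply: csa_closed => e /hl [N hN]; exists (y N) => //; rewrite cn_distC hN.
- apply/eqP; rewrite -subr_eq0; apply/eqP/cn_eq0/(eq0_eps (c := 2)) => // [|e e0].
    exact: cn_ge0.
  have [N hN] := hl e e0; have h1 := hN N (leqnn _).
  rewrite -[star l - _](subrKA (y N)); apply: le_trans (cnD _ _) _.
  rewrite -{1}(sy N) -starB cn_star cn_distC mulrDl mul1r.
  by apply: lerD; exact: ltW.
- have h : l + l = x + l * l by rewrite {1 2}fix_l -scalerDr half2.
  have -> : (1 - l) * (1 - l) = 1 - (l + l) + l * l.
    by rewrite mulrBr mulr1 mulrBl mul1r opprB opprD !addrA addrAC.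
  by rewrite h opprD addrA subrK.
- move=> b bx; have by_ n : b * y n = y n * b.
    elim: n => [|n IH]; first by rewrite /y /= mulr0 mul0r.
    rewrite /y /= -scalerAr -scalerAl mulrDr mulrDl bx mulrA -/(y n) IH.
    by rewrite -mulrA IH mulrA.
  apply/eqP; rewrite -subr_eq0; apply/eqP/cn_eq0/(eq0_eps (c := 2 * cn b)) => // [||e e0].
  + exact: cn_ge0.
  + by rewrite mulr_ge0// cn_ge0.
  have [N hN] := hl e e0; have h1 := ltW (hN N (leqnn _)).
  have -> : b * l - l * b = (y N - l) * b - b * (y N - l).
    by rewrite mulrBl mulrBr by_ opprB [RHS]addrC addrA subrK.
  have -> : 2 * cn b * e = cn b * e + cn b * e by ring.
  apply: le_trans (cnD _ _) _; rewrite cnN; apply: lerD.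
    by apply: le_trans (cnM _ _) _; rewrite mulrC ler_wpM2l ?cn_ge0.
  by apply: le_trans (cnM _ _) _; rewrite ler_wpM2l ?cn_ge0.
Qed.

End Subalgebra.

Lemma csa_setT : cstar_subalgebra (setT : set A).
Proof. by []. Qed.

Lemma csa_generated (G : set A) : cstar_subalgebra (cstar_generated G).
Proof.
split.
- by move=> S hS _; exact: csa1.
- move=> c a b ha hb S hS GS; have [_ h] := csa_lin hS.
  by apply: h; [exact: ha|exact: hb].
- by move=> a b ha hb S hS GS; apply: csaM => //; [exact: ha|exact: hb].
- by move=> a ha S hS GS; apply: csa_star => //; exact: ha.
apply/norm_closedP => a ha S hS GS; apply: csa_closed => // e e0.
by have [b hb ab] := ha e e0; exists b => //; exact: hb.
Qed.

Lemma gen_sub (G : set A) : G `<=` cstar_generated G.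
Proof. by move=> a Ga S _; exact. Qed.

Section States.
Variables (S : set A) (phi : A -> R[i]).
Hypotheses (hS : cstar_subalgebra S) (hphi : state S phi).

Let lS := csa_lin hS.

Lemma state_lin c a b : S a -> S b -> phi (c *: a + b) = c * phi a + phi b.
Proof. by case: hphi => h _ _; exact: h. Qed.

Lemma state_ge0 a : S a -> 0 <= phi (star a * a).
Proof. by case: hphi => _ h _; exact: h. Qed.

Lemma state1 : phi 1 = 1. Proof. by case: hphi. Qed.

Lemma stateD a b : S a -> S b -> phi (a + b) = phi a + phi b.
Proof. by move=> Sa Sb; have := state_lin 1 Sa Sb; rewrite scale1r mul1r. Qed.

Lemma state0 : phi 0 = 0.
Proof. by apply: addr_fix0; rewrite -stateD ?addr0//; exact: lin0. Qed.

Lemma stateZ c a : S a -> phi (c *: a) = c * phi a.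
Proof. by move=> Sa; have := state_lin c Sa (lin0 lS); rewrite !addr0 state0 addr0. Qed.

Lemma stateB a b : S a -> S b -> phi (a - b) = phi a - phi b.
Proof.
by move=> Sa Sb; rewrite -scaleN1r stateD ?stateZ ?mulN1r//; exact: linZ.
Qed.

Definition state_form (a b : A) : R[i] := phi (star a * b).

(** Hermitian symmetry comes from positivity at [a + b] and at [a + i b]: both values are real, and
    this fixes the real and the imaginary part. *)
Lemma state_form_sip : sip S state_form.
Proof.
have Sm a b : S a -> S b -> S (star a * b) by move=> Sa Sb; apply: csaM => //; exact: csa_star.
split=> // [c a b d Sa Sb Sd|a b Sa Sb|a Sa]; last exact: state_ge0.
  by rewrite /state_form mulrDr -scalerAr state_lin//; exact: Sm.
have real a' : S a' -> complex.Im (phi (star a' * a')) = 0.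
  by move=> Sa'; exact/ger0_Im/state_ge0.
have h1 : S (a + b) by exact: linD.
have h2 : S (a + 'i%C *: b) by apply: linD => //; exact: linZ.
have := real _ h1; have := real _ h2; rewrite /state_form.
rewrite !starD !mulrDl !mulrDr starZ conji -!scalerAl -!scalerAr.
have Saa := Sm _ _ Sa Sa; have Sbb := Sm _ _ Sb Sb.
have Sab := Sm _ _ Sa Sb; have Sba := Sm _ _ Sb Sa.
have Z c x : S x -> S (c *: x) by move=> Sx; exact: linZ.
have D x y : S x -> S y -> S (x + y) by move=> Sx Sy; exact: linD.
have Zi x : S x -> S ('i%C *: x) by exact: Z.
have ZN x : S x -> S (- 'i%C *: x) by exact: Z.
rewrite !stateD ?stateZ//; do ?by [exact/ZN/Zi|apply: D; [exact: ZN|exact/ZN/Zi]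
  |exact: Zi|exact: ZN|exact: D|exact: D _ _ _ (Zi _ _)].
have := real _ Sa; have := real _ Sb.
case: (phi (star a * a)) => a1 a2; case: (phi (star b * b)) => b1 b2.
case: (phi (star a * b)) => x1 x2; case: (phi (star b * a)) => y1 y2 /=.
move=> -> -> h h'; rewrite /Num.conj /=; congr (_ +i* _); lra.
Qed.

(** With [y] the root obtained for [x = star a * a / |a|^2], the element
    [star b * (|a|^2 - star a * a) * b] is [|a|^2] times [star z * z] for [z = (1 - y) * b]. This
    bounds left multiplication in the GNS construction. *)
Lemma state_bound a b : S a -> S b ->
  complex.Re (phi (star (a * b) * (a * b))) <= cn a ^+ 2 * complex.Re (phi (star b * b)).
Proof.
move=> Sa Sb.
have [a0|a0] := eqVneq (cn a) 0.
  by rewrite (cn_eq0 a0) mul0r mulr0 state0 cn0 expr0n mul0r.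
have t0 : 0 < cn a ^+ 2 by rewrite exprn_gt0// lt0r a0 cn_ge0.
pose x := ((cn a ^+ 2)^-1)%:C *: (star a * a).
have Sm (c d : A) : S c -> S d -> S (star c * d) by move=> Sc Sd; apply: csaM => //; exact: csa_star.
have Sx : S x by apply: linZ => //; exact: Sm.
have [||y [Sy sy hy _]] := csqrt_exists hS Sx.
- by rewrite starZ conjr starM starK.
- by rewrite cnZ cn_starM nrmc_real ger0_norm ?invr_ge0 ?(ltW t0)// mulVf ?gt_eqF.
have Sz : S ((1 - y) * b) by apply: csaM => //; apply: linB => //; exact: csa1.
have := state_ge0 Sz.
have -> : star ((1 - y) * b) * ((1 - y) * b) = star b * ((1 - y) * (1 - y)) * b.
  by rewrite starM starB star1 sy !mulrA.
rewrite hy mulrBr mulr1 mulrBl.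
rewrite /x -scalerAr -scalerAl.
have -> : star b * (star a * a) * b = star (a * b) * (a * b) by rewrite starM !mulrA.
have Sab := csaM hS Sa Sb.
rewrite stateB ?stateZ//; [|exact: Sm|exact: Sm|by apply: linZ => //; exact: Sm].
move=> /Re_ge0; rewrite ReB ReZ subr_ge0 => h.
by rewrite mulrC -ler_pdivrMr// mulrC.
Qed.

End States.

End CStarBasics.

(** * Norms under star homomorphisms *)

Section StarHomomorphism.
Context {R : realType} {A : cstarType R} (f : {lrmorphism A -> A}).
Hypothesis f_star : forall a, f (star a) = star (f a).

(* For self-adjoint [b] in the unit ball, [b + i sqrt(1 - b^2)] is unitary, and so is its image. *)
Lemma star_hom_contractive_sa (b : A) : star b = b -> cn b <= 1 -> cn (f b) <= 1.
Proof.
move=> sb nb.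
have [|||y [_ sy hy cy]] := csqrt_exists csa_setT (x := b * b) => //.
- by rewrite starM sb.
- by apply: le_trans (cnM _ _) _; rewrite -[1]mulr1 ler_pM ?cn_ge0.
pose c := 1 - y.
have cb : b * c = c * b by rewrite /c mulrBr mulrBl mulr1 mul1r cy// mulrA.
have sc : star c = c by rewrite /c starB star1 sy.
have uu (u : A) : star u * u = 1 -> cn u <= 1.
  move=> h; have := cn_starM u; rewrite h => hu.
  have h1 := cn1 (A := A); rewrite hu in h1.
  by rewrite -(ler_pXn2r (n := 2)) ?nnegrE ?cn_ge0// expr1n.
have hsum : f b * f b + f c * f c = 1.
  by rewrite -!rmorphM -rmorphD /= hy addrC subrK rmorph1.
have hcom : f b * f c = f c * f b by rewrite -!rmorphM cb.
have sfb : star (f b) = f b by rewrite -f_star sb.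
have sfc : star (f c) = f c by rewrite -f_star sc.
have nu (z : R[i]) : z = 'i%C \/ z = - 'i%C -> cn (f b + z *: f c) <= 1.
  move=> hz; apply: uu; rewrite starD starZ sfb sfc mulrDl !mulrDr.
  rewrite -!scalerAl -!scalerAr scalerA hcom.
  have -> : Num.conj z = - z by case: hz => ->; rewrite ?rmorphN /= conji.
  have -> : - z * z = 1 by case: hz => ->; rewrite ?mulrNN ?mulNr -expr2 sqr_i opprK.
  by rewrite scale1r scaleNr addrA addrK.
have -> : f b = (2^-1)%:C *: ((f b + 'i%C *: f c) + (f b + (- 'i%C) *: f c)).
  by rewrite addrACA scaleNr subrr addr0 half2.
rewrite cnZ nrmc_half; have := nu 'i%C (or_introl erefl).
have := nu (- 'i%C) (or_intror erefl).
have := cnD (f b + 'i%C *: f c) (f b + (- 'i%C) *: f c); lra.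
Qed.

(** The C*-identity reduces the claim to the self-adjoint element [star a * a], scaled into the unit
    ball. *)
Lemma star_hom_contractive (a : A) : cn (f a) <= cn a.
Proof.
have [a0|a0] := eqVneq (cn a) 0; first by rewrite (cn_eq0 a0) linear0 cn0.
have t0 : 0 < cn a ^+ 2 by rewrite exprn_gt0// lt0r a0 cn_ge0.
rewrite -(ler_pXn2r (n := 2)) ?nnegrE ?cn_ge0// -cn_starM -f_star -rmorphM.
have i0 : 0 <= (cn a ^+ 2)^-1 by rewrite invr_ge0 ltW.
have := @star_hom_contractive_sa (((cn a ^+ 2)^-1)%:C *: (star a * a)).
rewrite linearZ /= !cnZ cn_starM nrmc_real ger0_norm// mulVf ?gt_eqF//.
rewrite starZ conjr starM starK => /(_ erefl (lexx _)).
by rewrite mulrC ler_pdivrMr// mul1r.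
Qed.

End StarHomomorphism.

(** * Representations, intertwiners and the GNS construction *)

Section Representations.
Context {R : realType} {A : cstarType R}.
Variables (S : set A) (hS : cstar_subalgebra S).

Let lS := csa_lin hS.

Section OneRepresentation.
Context {H : hilbertType R}.
Variable (pi : A -> H -> H).
Hypothesis hpi : representation S pi.

Lemma rep_bop a : S a -> bop (pi a).
Proof. by case: hpi => h _ _ _ _ /h /bounded_opP. Qed.

Lemma rep_lin c a b u : S a -> S b -> pi (c *: a + b) u = c *: pi a u + pi b u.
Proof. by case: hpi => _ h _ _ _ Sa Sb; rewrite h. Qed.

Lemma repD a b u : S a -> S b -> pi (a + b) u = pi a u + pi b u.
Proof. by move=> Sa Sb; rewrite -{1}[a]scale1r rep_lin// scale1r. Qed.

Lemma repM a b u : S a -> S b -> pi (a * b) u = pi a (pi b u).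
Proof. by case: hpi => _ _ h _ _ Sa Sb; rewrite h. Qed.

Lemma rep1 u : pi 1 u = u.
Proof. by case: hpi => _ _ _ -> _. Qed.

Lemma rep_adj a u v : S a -> hdot (pi a u) v = hdot u (pi (star a) v).
Proof. by case: hpi => _ _ _ _ h Sa; exact: h. Qed.

Lemma rep_adjl a u v : S a -> hdot u (pi a v) = hdot (pi (star a) u) v.
Proof. by move=> Sa; rewrite rep_adj ?starK//; exact: csa_star. Qed.

Lemma adj_rep a : S a -> adj (pi a) = pi (star a).
Proof.
move=> Sa; apply/esym/adj_unique => [|u v]; first exact: rep_bop.
by rewrite -rep_adjl.
Qed.

Lemma rep_star_closed : star_closed [set pi a | a in S].
Proof.
move=> _ [a Sa <-]; split; first exact: rep_bop.
by rewrite adj_rep//; exists (star a) => //; exact: csa_star.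
Qed.

Lemma rep_bops : [set pi a | a in S] `<=` bop.
Proof. exact/star_closed_bop/rep_star_closed. Qed.

Lemma com_rep T a u : commutant [set pi a | a in S] T -> S a -> T (pi a u) = pi a (T u).
Proof. by move=> hT Sa; apply: comm_app hT _; exists a. Qed.

Lemma com_repP T : bop T -> (forall a u, S a -> T (pi a u) = pi a (T u)) ->
  commutant [set pi a | a in S] T.
Proof. by move=> bT h; apply: commutantP => // _ u [a Sa <-]; exact: h. Qed.

Lemma orbit_linear (w : H) : linear_set [set pi a w | a in S].
Proof. by apply: linear_image => // c a b Sa Sb; rewrite rep_lin. Qed.

Definition orbit (w : H) : set H := clos [set pi a w | a in S].

Lemma csub_orbit w : csub (orbit w).
Proof. exact/clos_linear/orbit_linear. Qed.

Lemma orbit_in w a : S a -> orbit w (pi a w).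
Proof. by move=> Sa; apply: clos_sub; exists a. Qed.

Lemma orbit_self w : orbit w w.
Proof. by rewrite -{2}(rep1 w); apply: orbit_in; exact: csa1. Qed.

Lemma orbit_inv w a u : S a -> orbit w u -> orbit w (pi a u).
Proof.
move=> Sa; apply: bop_clos; first exact: rep_bop.
by move=> _ [b Sb <-]; exists (a * b); [exact: csaM|rewrite repM].
Qed.

Lemma pj_orbit_com w : commutant [set pi a | a in S] (pj (orbit w)).
Proof.
apply: pj_commutant; [exact: rep_star_closed|exact: csub_orbit|].
by move=> _ u [a Sa <-]; exact: orbit_inv.
Qed.

Lemma rep_nrm_sqr a u : S a -> nrm (pi a u) ^+ 2 = complex.Re (hdot u (pi (star a * a) u)).
Proof.
by move=> Sa; rewrite nrm_sqr rep_adj// repM//; exact: csa_star.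
Qed.

End OneRepresentation.

Section Intertwiners.
Context {H1 H2 : hilbertType R}.
Variables (pi1 : A -> H1 -> H1) (pi2 : A -> H2 -> H2).
Hypotheses (h1 : representation S pi1) (h2 : representation S pi2).

(** The map [pi1 a w1 |-> pi2 a w2] is extended by [0] off the orbit of [w1]. The complement of the
    orbit is invariant, so the extension still intertwines. *)
Lemma intertwiner (w1 : H1) (w2 : H2) (C : R) : 0 <= C ->
  (forall a, S a -> nrm (pi2 a w2) <= C * nrm (pi1 a w1)) ->
  exists W : H1 -> H2, [/\ bop W, forall a u, S a -> W (pi1 a u) = pi2 a (W u),
    W w1 = w2, forall u, (forall a, S a -> hdot (pi1 a w1) u = 0) -> W u = 0
    & forall u, nrm (W u) <= C * nrm u].
Proof.
move=> C0 hC.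
have [||||W [bW Wf W0 Wn]] := @extend_bounded R A H1 H2 S (pi1^~ w1) (pi2^~ w2) C lS.
- by move=> c a b Sa Sb; rewrite (rep_lin h1).
- by move=> c a b Sa Sb; rewrite (rep_lin h2).
- by [].
- exact: hC.
exists W; split=> //; last by rewrite -(rep1 h1 w1) Wf ?(rep1 h2)//; exact: csa1.
move=> a u Sa; pose p := pj (orbit pi1 w1) u.
have cO := csub_orbit h1 w1.
have e1 : W (pi1 a p) = pi2 a (W p).
  apply: (clos_eq (T := W \o pi1 a) (S := pi2 a \o W) _ _ _ (pj_in cO u)).
  - exact: bop_comp (rep_bop h1 Sa) bW.
  - exact: bop_comp bW (rep_bop h2 Sa).
  - by move=> _ [b Sb <-] /=; rewrite -(repM h1)// !Wf ?(repM h2)//; exact: csaM.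
have e2 b : S b -> hdot (pi1 b w1) (u - p) = 0.
  by move=> Sb; apply: pj_orth => //; exact: orbit_in.
have -> : u = p + (u - p) by rewrite addrC subrK.
rewrite (bopD p _ (rep_bop h1 Sa)) (bopD (pi1 a p) _ bW) (bopD p _ bW).
rewrite (bopD (W p) _ (rep_bop h2 Sa)) e1.
congr (_ + _); rewrite (W0 _ e2) (bop0 (rep_bop h2 Sa)) W0// => b Sb.
rewrite (rep_adjl h1)// -(repM h1)//; last exact: csa_star.
by apply: e2; apply: csaM => //; exact: csa_star.
Qed.

Lemma intertwiner_adj (W : H1 -> H2) : bop W ->
  (forall a u, S a -> W (pi1 a u) = pi2 a (W u)) ->
  forall a v, S a -> adj W (pi2 a v) = pi1 a (adj W v).
Proof.
move=> bW hW a v Sa; apply: hdot_inj => w.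
rewrite adjr// (rep_adjl h2)// (rep_adjl h1)// adjr// hW//; exact: csa_star.
Qed.

(** Equal states make the intertwiner isometric on the orbit of [w1], which is recorded in the form
    [adj W w2 = w1]. *)
Lemma state_isometry (w1 : H1) (w2 : H2) :
  (forall a, S a -> hdot w1 (pi1 a w1) = hdot w2 (pi2 a w2)) ->
  exists W : H1 -> H2, [/\ bop W, forall a u, S a -> W (pi1 a u) = pi2 a (W u),
    W w1 = w2, adj W w2 = w1 & forall u, nrm (W u) <= nrm u].
Proof.
move=> h.
have nn a : S a -> nrm (pi2 a w2) = nrm (pi1 a w1).
  move=> Sa; apply/eqP; rewrite -(eqrXn2 (n := 2)) ?nrm_ge0//.
  by rewrite (rep_nrm_sqr h1)// (rep_nrm_sqr h2)// h//; apply: csaM => //; exact: csa_star.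
have [|W [bW Wi Ww W0 Wn]] := @intertwiner w1 w2 1 ler01.
  by move=> a Sa; rewrite nn// mul1r.
exists W; split=> //; last by move=> u; rewrite -[leRHS]mul1r.
pose p := pj (orbit pi1 w1) (adj W w2).
have cO := csub_orbit h1 w1.
suff ep : p = w1.
  apply/eqP; rewrite -subr_eq0 -ep; apply/eqP/hdot_eq0.
  have e2 : W (adj W w2 - p) = 0.
    by apply: W0 => a Sa; apply: pj_orth => //; exact: orbit_in.
  rewrite hdotBl pj_sa// (pj_eq0 cO) ?hdot0r ?subr0.
    by rewrite adjl// e2 hdot0r.
  by move=> w Ow; exact: pj_orth.
apply: pj_unique => //; first exact: orbit_self.
move=> w Ow; apply: hdot_sym0.
apply: clos_orth Ow => _ [a Sa <-].
by rewrite hdotBl adjl// Wi// Ww h// subrr.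
Qed.

End Intertwiners.

(** An operator of the commutant carries [v] to [w] and its adjoint carries [w] back to [v];
    elements of the von Neumann algebra commute with it. No density of the represented algebra in
    its bicommutant is involved. *)
Lemma vN_state_eq {H : hilbertType R} (pi : A -> H -> H) (v w : H) (y : H -> H) :
  representation S pi -> (forall a, S a -> hdot v (pi a v) = hdot w (pi a w)) ->
  vN_of S pi y -> hdot v (y v) = hdot w (y w).
Proof.
move=> hpi h hy; have [W [bW Wi Wv Ww _]] := state_isometry hpi hpi h.
have cW : commutant [set pi a | a in S] W by apply: com_repP.
by rewrite -{2}Wv (comm_app _ hy cW) -(adjl _ _ bW) Ww.
Qed.

Lemma rep_state {H : hilbertType R} (pi : A -> H -> H) (w : H) :
  representation S pi -> nrm w = 1 -> state S (fun a => hdot w (pi a w)).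
Proof.
move=> hpi nw; split.
- by move=> c a b Sa Sb; rewrite (rep_lin hpi)// hdotDr hdotZr.
- move=> a Sa; rewrite (repM hpi)//; last exact: csa_star.
  by rewrite -(rep_adj hpi)// hdot_nrm ler0c sqr_ge0.
- by rewrite (rep1 hpi) hdot_nrm nw expr1n.
Qed.

(** The space is the completion of [S] for the form of [phi]; left multiplication is bounded by
    [state_bound] and extends. *)
Lemma GNS_exists (phi : A -> R[i]) : state S phi ->
  exists (H : hilbertType R) (pi : A -> H -> H) (Omega : H), GNS S phi pi Omega.
Proof.
move=> hphi.
have [H [j [jl jd jc]]] := completion_exists (state_form_sip hS hphi).
have ex a : exists W : H -> H, S a -> bop W /\ forall b, S b -> W (j b) = j (a * b).
  have [Sa|nSa] := pselect (S a); last by exists id.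
  have [||||W [bW Wf _ _]] := @extend_bounded R A H H S j (fun b => j (a * b)) (cn a) lS.
  - by move=> c b d Sb Sd; rewrite jl.
  - by move=> c b d Sb Sd; rewrite mulrDr -scalerAr jl//; exact: csaM.
  - exact: cn_ge0.
  - move=> b Sb; have Sab := csaM hS Sa Sb.
    rewrite -(ler_pXn2r (n := 2)) ?nnegrE ?mulr_ge0 ?nrm_ge0 ?cn_ge0//.
    by rewrite exprMn !nrm_sqr !jd//; exact: state_bound hphi _ _ Sa Sb.
  by exists W.
have [pi hpi] := choice ex.
have uniq (T T' : H -> H) : bop T -> bop T' -> (forall b, S b -> T (j b) = T' (j b)) -> T = T'.
  move=> bT bT' e; apply/funext => u; apply: clos_eq (jc u) => // _ [b Sb <-]; exact: e.
have S1 := csa1 hS.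
have Sst := csa_star hS; have Smul := csaM hS.
exists H, pi, (j 1); split; [split| |].
- by move=> a Sa; apply/bounded_opP; case: (hpi a Sa).
- move=> c a b Sa Sb; have Sab : S (c *: a + b) by case: lS => _; exact.
  have [h1 e1] := hpi a Sa; have [h2 e2] := hpi b Sb; have [h3 e3] := hpi _ Sab.
  apply: uniq => //; first exact: bop_lin.
  by move=> d Sd; rewrite e1// e2// e3// mulrDl -scalerAl jl//; exact: Smul.
- move=> a b Sa Sb; have [h1 e1] := hpi a Sa; have [h2 e2] := hpi b Sb.
  have [h3 e3] := hpi _ (Smul _ _ Sa Sb).
  apply: uniq => //; first exact: bop_comp.
  by move=> d Sd /=; rewrite e3// e2// e1 ?mulrA//; exact: Smul.
- have [h1 e1] := hpi 1 S1; apply: uniq => //; first exact: bop_id.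
  by move=> d Sd; rewrite e1// mul1r.
- move=> a Sa; have [h1 e1] := hpi a Sa; have [h2 e2] := hpi _ (Sst _ Sa).
  suff -> : pi (star a) = adj (pi a) by move=> u v; rewrite adjr.
  apply: uniq => //; first exact: bop_adj.
  move=> b Sb; rewrite e2//; apply: hdot_inj => w.
  apply/eqP; rewrite -subr_eq0 -hdotBr; apply/eqP/hdot_sym0.
  apply: clos_orth (jc w) => _ [d Sd <-].
  rewrite hdotBl adjl// e1// !jd//; do ?by apply: Smul => //; exact: Sst.
  by rewrite /state_form starM starK mulrA subrr.
- apply/dense_clos => u e e0; have [_ [a Sa <-] h] := jc u e e0; exists (j a) => //.
  by exists a => //; have [_ ->] := hpi a Sa; rewrite ?mulr1.
- move=> a Sa; have [_ ->//] := hpi a Sa.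
  by rewrite mulr1 jd// /state_form star1 mul1r.
Qed.

End Representations.

Section GNSFacts.
Context {R : realType} {A : cstarType R}.
Variables (S : set A) (hS : cstar_subalgebra S) (phi : A -> R[i]).
Context {H : hilbertType R}.
Variables (pi : A -> H -> H) (Omega : H).
Hypothesis hG : GNS S phi pi Omega.

Lemma GNS_rep : representation S pi. Proof. by case: hG. Qed.

Lemma GNS_orbit u : orbit S pi Omega u.
Proof. by case: hG => _ /dense_clos h _; exact: h. Qed.

Lemma GNS_state a : S a -> hdot Omega (pi a Omega) = phi a.
Proof. by case: hG => _ _ h Sa; rewrite h. Qed.

Lemma GNS_nrm : state S phi -> nrm Omega = 1.
Proof.
move=> hphi; have := GNS_state (csa1 hS); rewrite (rep1 GNS_rep) hdot_nrm (state1 hphi).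
move=> /(congr1 (@complex.Re R)) /= h.
by apply/eqP; rewrite -(eqrXn2 (n := 2)) ?nrm_ge0// h expr1n.
Qed.

Lemma GNS_ext (K : hilbertType R) (T T' : H -> K) : bop T -> bop T' ->
  (forall a, S a -> T (pi a Omega) = T' (pi a Omega)) -> T = T'.
Proof.
by move=> bT bT' e; apply/funext => u; apply: clos_eq (GNS_orbit u) => // _ [a Sa <-]; exact: e.
Qed.

End GNSFacts.

(** * Spectral cuts and minimal projections *)

Section OperatorLimits.
Context {R : realType} {H : hilbertType R}.

Lemma nrm_le_dist (a b : H) : nrm a <= nrm b + nrm (b - a).
Proof.
by have := nrmD b (a - b); rewrite addrC subrK (nrm_distC a).
Qed.

Lemma uniform_limit (y : nat -> H -> H) : (forall n, bop (y n)) ->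
  (forall e : R, 0 < e -> exists N, forall m n, (N <= m)%N -> (N <= n)%N ->
     forall u, nrm (y m u - y n u) <= e * nrm u) ->
  exists2 l : H -> H, bop l & forall e : R, 0 < e -> exists N, forall n, (N <= n)%N ->
     forall u, nrm (y n u - l u) <= e * nrm u.
Proof.
move=> by_ cy.
have ex u : exists l, forall e : R, 0 < e -> exists N, forall n, (N <= n)%N -> nrm (y n u - l) < e.
  apply: hilbert_complete => e e0.
  have [d d0 hd] := eps_scale (nrm_ge0 u) e0.
  have [|N hN] := cy (d / 2); first by rewrite divr_gt0.
  exists N => m n Nm Nn; apply: le_lt_trans (hN m n Nm Nn u) _.
  by rewrite mulrC hd// ltr_pdivrMr// ltr_pMr// ltr1n.
have [l hl] := choice ex.
have unif (e : R) : 0 < e -> exists N, forall n, (N <= n)%N ->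
     forall u, nrm (y n u - l u) <= e * nrm u.
  move=> e0; have [N hN] := cy e e0; exists N => n Nn u.
  apply: (le_eps ler01) => d d0; rewrite mul1r.
  have [M hM] := hl u d d0; set m := maxn N M.
  rewrite -[y n u - l u](subrKA (y m u)); apply: le_trans (nrmD _ _) _.
  by apply: lerD; [exact: (hN n m Nn (leq_maxl _ _))|apply/ltW/hM; exact: leq_maxr].
exists l => //; split=> [c u v|].
  apply/eqP; rewrite -subr_eq0; apply/eqP/nrm_eq0.
  apply: (eq0_eps (c := nrm (c *: u + v) + (nrmc c * nrm u + nrm v))); rewrite ?nrm_ge0//.
    by rewrite !addr_ge0 ?mulr_ge0 ?nrm_ge0 ?nrmc_ge0.
  move=> e e0; have [N hN] := unif e e0; have h := hN N (leqnn _).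
  have -> : l (c *: u + v) - (c *: l u + l v) =
      - (y N (c *: u + v) - l (c *: u + v)) + (c *: (y N u - l u) + (y N v - l v)).
    rewrite (bopD _ _ (by_ N)) (bopZ _ _ (by_ N)) opprB scalerBr.
    by rewrite [X in _ = _ + X]addrACA -opprD addrA subrK.
  rewrite mulrDl; apply: le_trans (nrmD _ _) _; rewrite nrmN; apply: lerD; first by rewrite mulrC.
  apply: le_trans (nrmD _ _) _; rewrite mulrDl; apply: lerD; last by rewrite mulrC.
  by rewrite nrmZ -mulrA ler_wpM2l ?nrmc_ge0// mulrC.
have [N hN] := unif 1 ltr01; have [M M0 hM] := bop_bound (by_ N).
exists (M + 1) => [|u]; first by rewrite addr_ge0// ltW.
rewrite mulrDl; apply: le_trans (nrm_le_dist _ (y N u)) _.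
by apply: lerD; [exact: hM|exact: hN].
Qed.

Section SquareRoot.
Variable (k : H -> H).
Hypotheses (bk : bop k) (sk : forall u v, hdot (k u) v = hdot u (k v)).
Hypothesis nk : forall u, nrm (k u) <= nrm u.

Let x (u : H) := u - k (k u).

Fixpoint op_iter (n : nat) : H -> H :=
  if n is m.+1 then fun u => (2^-1)%:C *: (x u + op_iter m (op_iter m u)) else fun=> 0.

Let bx : bop x.
Proof. exact: bop_sub bop_id (bop_comp bk bk). Qed.

Let nx u : nrm (x u) <= nrm u.
Proof.
rewrite -(ler_pXn2r (n := 2)) ?nnegrE ?nrm_ge0// /x nrm_sqrB -sk -nrm_sqr.
have := nk (k u); have := nrm_ge0 (k (k u)); have := nrm_ge0 (k u); nra.
Qed.

Let by_ n : bop (op_iter n).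
Proof.
elim: n => [|n IH] /=; first exact: bop_cst0.
exact: bop_scale (bop_add bx (bop_comp IH IH)).
Qed.

Let t := @sqrt_iter R.

Let t1 n : t n <= 1.
Proof. by case/andP: (sqrt_iter_bounds (R := R) n). Qed.
Let t0 n : 0 <= t n.
Proof. by case/andP: (sqrt_iter_bounds (R := R) n). Qed.

Let ny n u : nrm (op_iter n u) <= t n * nrm u.
Proof.
elim: n u => [|n IH] u; first by rewrite nrm0 mul0r.
rewrite /t /= nrmZ nrmc_half -mulrA ler_wpM2l ?invr_ge0//.
apply: le_trans (nrmD _ _) _; rewrite mulrDl mul1r; apply: lerD => //.
apply: le_trans (IH _) _; rewrite expr2 -mulrA ler_wpM2l//; exact: t0.
Qed.

Let dy n u : nrm (op_iter n.+1 u - op_iter n u) <= (t n.+1 - t n) * nrm u.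
Proof.
elim: n u => [|n IH] u.
  rewrite subr0 /t /= addr0 nrmZ nrmc_half expr0n /= addr0 subr0 mulr1.
  by rewrite ler_wpM2l ?invr_ge0.
have -> : op_iter n.+2 u - op_iter n.+1 u =
    (2^-1)%:C *: (op_iter n.+1 (op_iter n.+1 u) - op_iter n (op_iter n u)).
  by rewrite [op_iter n.+2 u]/= [X in _ - X]/= -scalerBr opprD addrACA subrr add0r.
have -> : t n.+2 - t n.+1 = 2^-1 * (t n.+1 * (t n.+1 - t n) + (t n.+1 - t n) * t n).
  by rewrite /t /=; set s := sqrt_iter n; field.
rewrite nrmZ nrmc_half -mulrA ler_wpM2l ?invr_ge0//.
rewrite -[_ - op_iter n (op_iter n u)](subrKA (op_iter n.+1 (op_iter n u))) mulrDl.
apply: le_trans (nrmD _ _) _; apply: lerD.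
  by rewrite -bopB//; apply: le_trans (ny _ _) _; rewrite -mulrA ler_wpM2l//; exact: t0.
apply: le_trans (IH _) _; rewrite -mulrA ler_wpM2l//.
by rewrite subr_ge0; exact: sqrt_iter_incr.
Qed.

Let dmn j n u : nrm (op_iter (n + j)%N u - op_iter n u) <= (t (n + j)%N - t n) * nrm u.
Proof.
elim: j => [|j IH]; first by rewrite addn0 !subrr nrm0 mul0r.
rewrite addnS -[_ - op_iter n u](subrKA (op_iter (n + j)%N u)).
apply: le_trans (nrmD _ _) _; apply: le_trans (lerD (dy _ _) IH) _.
by rewrite -mulrDl subrKA.
Qed.

(** [s] is the absolute value of [k]: the iteration for [x = 1 - k^2] converges to [l] with
    [(1 - l)^2 = k^2], and [|l u| <= |u|] makes [1 - l] positive. *)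
Lemma op_sqrt : exists s : H -> H, [/\ bop s, forall u v, hdot (s u) v = hdot u (s v),
  forall u, s (s u) = k (k u), forall u, 0 <= complex.Re (hdot u (s u))
  & forall T, bop T -> (forall u, T (k u) = k (T u)) -> forall u, T (s u) = s (T u)].
Proof.
have [|l bl hl] := uniform_limit by_.
  move=> e e0; have [N hN] := sqrt_iter_cauchy e0; exists N => m n Nm Nn u.
  wlog nm : m n Nm Nn / (n <= m)%N => [hw|].
    by have [nm|/ltnW mn] := leqP n m; [exact: hw|rewrite nrm_distC; exact: hw].
  rewrite -(subnKC nm); apply: le_trans (dmn _ _ _) _.
  by rewrite ler_wpM2r ?nrm_ge0// ltW// hN// leq_addr.
have nl u : nrm (l u) <= nrm u.
  apply: (le_eps (nrm_ge0 u)) => e e0; have [N hN] := hl e e0.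
  apply: le_trans (nrm_le_dist _ (op_iter N u)) _.
  rewrite mulrC; apply: lerD; last exact: hN.
  apply: le_trans (ny _ _) _; rewrite -[leRHS]mul1r ler_wpM2r ?nrm_ge0//; exact: t1.
have sl u v : hdot (l u) v = hdot u (l v).
  have sx u' v' : hdot (x u') v' = hdot u' (x v') by rewrite /x hdotBl hdotBr !sk.
  have sy n : forall u v, hdot (op_iter n u) v = hdot u (op_iter n v).
    elim: n => [|n IH] u' v' /=; first by rewrite hdot0l hdot0r.
    by rewrite hdotZl hdotZr conjr hdotDl hdotDr sx !IH.
  apply/eqP; rewrite -subr_eq0; apply/eqP/nrmc_eq0.
  apply: (eq0_eps (c := 2 * (nrm u * nrm v))); rewrite ?nrmc_ge0 ?mulr_ge0 ?nrm_ge0// => e e0.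
  have [N hN] := hl e e0.
  have -> : hdot (l u) v - hdot u (l v) =
      hdot u (op_iter N v - l v) - hdot (op_iter N u - l u) v.
    by rewrite hdotBl hdotBr sy; ring.
  apply: le_trans (nrmcD _ _) _; rewrite nrmcN.
  have -> : 2 * (nrm u * nrm v) * e = nrm u * (e * nrm v) + (e * nrm u) * nrm v by ring.
  apply: lerD; apply: le_trans (cauchy_schwarz _ _) _.
    by rewrite ler_wpM2l ?nrm_ge0// hN.
  by rewrite ler_wpM2r ?nrm_ge0// hN.
have fl u : l u = (2^-1)%:C *: (x u + l (l u)).
  apply/eqP; rewrite -subr_eq0; apply/eqP/nrm_eq0.
  apply: (eq0_eps (c := 2 * nrm u)); rewrite ?nrm_ge0 ?mulr_ge0 ?nrm_ge0// => e e0.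
  have [N hN] := hl e e0; have h1 := hN N (leqnn _); have h2 := hN N.+1 (leqnSn _).
  rewrite -[l u - _](subrKA (op_iter N.+1 u)).
  have -> : 2 * nrm u * e = e * nrm u + 2^-1 * (e * nrm u + e * nrm u) by field.
  apply: le_trans (nrmD _ _) _; apply: lerD; first by rewrite nrm_distC.
  rewrite [op_iter N.+1 u]/= -scalerBr opprD addrACA subrr add0r nrmZ nrmc_half.
  rewrite ler_wpM2l ?invr_ge0//.
  rewrite -[_ - l (l u)](subrKA (op_iter N (l u))) -bopB//.
  apply: le_trans (nrmD _ _) _; apply: lerD.
    apply: le_trans (ny _ _) _; apply: le_trans (h1 u).
    by rewrite -[leRHS]mul1r ler_wpM2r ?nrm_ge0//; exact: t1.
  by apply: le_trans (h1 _) _; rewrite ler_wpM2l ?(ltW e0).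
exists (fun u => u - l u); split.
- exact: bop_sub bop_id bl.
- by move=> u v; rewrite hdotBl hdotBr sl.
- move=> u; rewrite bopB//.
  have : l u + l u = x u + l (l u) by rewrite {1 2}(fl u) -scalerDr half2.
  rewrite /x => h; rewrite opprB addrA addrAC -[u - l u - l u]addrA -opprD h.
  by rewrite opprD addrA subrK subKr.
- move=> u; rewrite hdotBr ReB -nrm_sqr subr_ge0 expr2.
  apply: le_trans (ler_norm _) _; apply: le_trans (Re_le_nrmc _) _.
  by apply: le_trans (cauchy_schwarz _ _) _; rewrite ler_wpM2l ?nrm_ge0.
- move=> T bT hT u; rewrite bopB//; congr (_ - _).
  have hy n : forall u, T (op_iter n u) = op_iter n (T u).
    elim: n => [|n IH] u' /=; first exact: bop0.
    by rewrite bopZ// bopD// /x bopB// !hT !IH.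
  have [M M0 hM] := bop_bound bT.
  apply/eqP; rewrite -subr_eq0; apply/eqP/nrm_eq0.
  apply: (eq0_eps (c := M * nrm u + nrm (T u))); rewrite ?nrm_ge0//.
    by rewrite addr_ge0 ?mulr_ge0 ?nrm_ge0// ltW.
  move=> e e0; have [N hN] := hl e e0.
  rewrite -[_ - l (T u)](subrKA (op_iter N (T u))) mulrDl; apply: le_trans (nrmD _ _) _.
  apply: lerD; last by rewrite mulrC; exact: hN.
  rewrite -hy -bopB// -mulrA; apply: le_trans (hM _) _.
  by rewrite ler_pM2l// nrm_distC mulrC; exact: hN.
Qed.

End SquareRoot.

(* [f] is the projection onto the kernel of [|h| - h]. *)
Lemma spectral_cut (X : set (H -> H)) (h : H -> H) : star_closed X -> bicommutant X h ->
  (forall u v, hdot (h u) v = hdot u (h v)) ->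
  exists f, [/\ projection f, bicommutant X f,
    forall u, f u = u -> 0 <= complex.Re (hdot u (h u)),
    forall u, f u = 0 -> complex.Re (hdot u (h u)) <= 0
    & forall T, bop T -> (forall u, T (h u) = h (T u)) ->
        (forall u, adj T (h u) = h (adj T u)) -> forall u, T (f u) = f (T u)].
Proof.
move=> sX Mh sh; have bh := commutant_bop Mh.
have [C C0 hC] := bop_bound bh.
pose k u := (C^-1)%:C *: h u.
have bk : bop k by exact: bop_scale.
have hk u : h u = C%:C *: k u by rewrite /k scalerA -rmorphM /= divff ?gt_eqF// scale1r.
have sk u v : hdot (k u) v = hdot u (k v) by rewrite /k hdotZl hdotZr conjr sh.
have nk u : nrm (k u) <= nrm u.
  by rewrite nrmZ nrmc_real ger0_norm ?invr_ge0 ?(ltW C0)// ler_pdivrMl.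
have [s [bs ss s2 s0 sc]] := op_sqrt bk sk nk.
have kcomm T : bop T -> (forall u, T (h u) = h (T u)) -> forall u, T (k u) = k (T u).
  by move=> bT hT u; rewrite /k bopZ// hT.
have ks u : k (s u) = s (k u) by apply: sc.
pose V := [set u | s u = k u].
have cV : csub V.
  split; first split; first by rewrite /V /= (bop0 bs) (bop0 bk).
    by move=> c u v; rewrite /V /= => hu hv; rewrite (bopD _ _ bs) (bopD _ _ bk) (bopZ _ _ bs) (bopZ _ _ bk) hu hv.
  by move=> u; apply: (clos_eq bs bk).
have inv T : bop T -> (forall u, T (h u) = h (T u)) -> forall u, V u -> V (T u).
  move=> bT hT u; rewrite /V /= => hu.
  by rewrite -sc ?hu ?kcomm//; exact: kcomm.
have Re_h u : complex.Re (hdot u (h u)) = C * complex.Re (hdot u (k u)).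
  by rewrite hk hdotZr ReZ.
exists (pj V); split.
- exact: projection_pj.
- apply: pj_commutant => //; first exact: commutant_star.
  move=> T u hT; apply: inv; first exact: commutant_bop hT.
  by move=> v; rewrite (comm_app _ Mh hT).
- move=> u hu; rewrite Re_h mulr_ge0 ?(ltW C0)//.
  have : V (pj V u) by exact: pj_in.
  by rewrite hu /V /= => <-.
- move=> u hu; rewrite Re_h.
  (* [s + k] maps into [V], because [s^2 = k^2] and [s] commutes with [k]; being self-adjoint, it
     kills every vector orthogonal to [V]. *)
  have : s u + k u = 0.
    apply: hdot_all0 => w; rewrite hdotDr -ss -sk -hdotDl.
    have : V (s w + k w) by rewrite /V /= (bopD _ _ bs) (bopD _ _ bk) s2 ks addrC.
    by move=> /(pj_orth cV u); rewrite hu subr0.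
  move=> /eqP; rewrite addrC addr_eq0 => /eqP ->.
  by rewrite hdotNr ReN mulrN oppr_le0 mulr_ge0 ?(ltW C0).
- move=> T bT hT hT' u.
  apply/esym/pj_unique => //; first by apply: inv => //; exact: pj_in.
  move=> w Vw; rewrite -bopB// -adjl//.
  apply: pj_orth => //; apply: inv => //; exact: bop_adj.
Qed.

End OperatorLimits.

(** * Minimal projections of a von Neumann algebra *)

Section MinimalProjections.
Context {R : realType} {H : hilbertType R}.
Variable (X : set (H -> H)).
Hypothesis sX : star_closed X.

Let M := bicommutant X.
Let sX' := commutant_star sX.
Let bX' := star_closed_bop sX'.

Definition minimal_projection (e : H -> H) : Prop :=
  [/\ projection e, M e, e <> cst 0 & forall q, projection q -> M q ->
    (forall u, e (q u) = q u) -> q = cst 0 \/ q = e].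

Lemma proj_le_comm (p q : H -> H) u : projection p -> projection q ->
  (forall u, p (q u) = q u) -> q (p u) = q u.
Proof. by move=> hp hq h; apply: hdot_inj => w; rewrite -!proj_sa// h. Qed.

Lemma projection_sub (p q : H -> H) : projection p -> projection q ->
  (forall u, p (q u) = q u) -> projection (fun u => p u - q u).
Proof.
move=> hp hq h; have bp := proj_bop hp; have bq := proj_bop hq.
split; first exact/bounded_opP/bop_sub.
  apply/funext => u /=; rewrite (bopB _ _ bp) (bopB _ _ bq) proj_idem// h (proj_le_comm _ hp hq h).
  by rewrite proj_idem// subrr subr0.
by move=> u v; rewrite hdotBl hdotBr !proj_sa.
Qed.

(** Without a minimal projection below [f] there is a strictly decreasing sequence of projections
    starting at [f]. Its successive differences are nonzero and mutually orthogonal, and [N + 1] of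
    them contradict the bound. *)
Lemma minimal_projection_exists (f : H -> H) (N : nat) : projection f -> M f -> f <> cst 0 ->
  (forall (n : nat) (q : nat -> H -> H),
     (forall i, (i < n)%N -> [/\ projection (q i), M (q i), q i <> cst 0
        & forall u, f (q i u) = q i u]) ->
     (forall i j, (i < j < n)%N -> forall u, q i (q j u) = 0) -> (n <= N)%N) ->
  exists e, minimal_projection e /\ forall u, f (e u) = e u.
Proof.
move=> pf Mf f0 bound; apply: contrapT => nomin.
pose P g := [/\ projection g, M g, g <> cst 0 & forall u, f (g u) = g u].
have ex g : exists q, P g -> [/\ P q, forall u, g (q u) = q u & q <> g].
  have [Pg|nP] := pselect (P g); last by exists g.
  have [pg Mg g0 fg] := Pg.
  apply: contrapT => /forallNP nq; apply: nomin; exists g; split=> //; split=> // q pq Mq gq.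
  apply: contrapT => /not_orP [q0 qg]; apply: (nq q) => _; split=> //; split=> // u.
  by rewrite -gq fg.
have [sub hsub] := choice ex.
pose g n := iter n sub f.
have Pg n : P (g n).
  elim: n => [|n IH]; last by case: (hsub _ IH).
  by split=> // u; exact: proj_idem.
have gS n u : g n (g n.+1 u) = g n.+1 u by have [_ h _] := hsub _ (Pg n); exact: h.
have gle i k u : g i (g (i + k)%N u) = g (i + k)%N u.
  elim: k u => [|k IH] u; first by rewrite addn0 proj_idem//; case: (Pg i).
  by rewrite addnS -gS IH.
pose q n u := g n u - g n.+1 u.
have bg n : bop (g n) by case: (Pg n) => /proj_bop.
have := bound N.+1 q; rewrite ltnn => H0; suff : false by []; apply: H0.
  move=> i _; have [pi Mi i0 fi] := Pg i; have [pS MS S0 fS] := Pg i.+1; split.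
  - exact: projection_sub (gS i).
  - exact: commutant_sub.
  - move=> q0; have [_ _ ne] := hsub _ (Pg i); apply: ne; apply/funext => u.
    have /(congr1 (fun h => h u)) /= := q0; rewrite /q => /eqP; rewrite subr_eq0 => /eqP.
    by rewrite /g /= => <-.
  - by move=> u; rewrite /q (bopB _ _ (proj_bop pf)) fi fS.
move=> i j /andP[ij _] u; rewrite /q.
have h v : g i (g j v) = g j v /\ g i.+1 (g j v) = g j v.
  by rewrite -{1 3}(subnKC ij) gle subnKC// -{1}(subnKC (ltnW ij)) gle subnKC// ltnW.
have h' v : g i (g j.+1 v) = g j.+1 v /\ g i.+1 (g j.+1 v) = g j.+1 v.
  have [h1 h2] := h (g j.+1 v); by rewrite gS in h1 h2.
rewrite (bopB _ _ (bg i)) (bopB _ _ (bg i.+1)).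
by have [-> ->] := h u; have [-> ->] := h' u; rewrite subrr.
Qed.

(** Testing the hypothesis on [T u + u] leaves [2 |T u|^2]. *)
Lemma sa_zero (T : H -> H) : bop T -> (forall u v, hdot (T u) v = hdot u (T v)) ->
  (forall u, complex.Re (hdot u (T u)) = 0) -> forall u, T u = 0.
Proof.
move=> bT sT h u; apply: nrm_eq0; apply/eqP; rewrite -sqrf_eq0; apply/eqP.
have := h (T u + u); rewrite (bopD _ _ bT) hdotDl !hdotDr !ReD !h addr0 add0r.
rewrite -[hdot u _]sT hdot_nrm /=; lra.
Qed.

(** If [e y e], for self-adjoint [y], took two different values on unit vectors of the range of [e],
    the spectral cut at their midpoint would give a projection of [M] strictly between [0] and [e].
    A general [x] is split into its self-adjoint parts. *)
Lemma minimal_scalar (e x : H -> H) : minimal_projection e -> M x ->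
  exists c : R[i], forall u, e (x (e u)) = c *: e u.
Proof.
move=> [pe Me e0 mine].
have be := proj_bop pe.
have sae (y : H -> H) : M y -> (forall u v, hdot (y u) v = hdot u (y v)) ->
    exists c : R[i], forall u, e (y (e u)) = c *: e u.
  move=> My sy; have by_ := commutant_bop My.
  pose k u := e (y (e u)).
  have bk : bop k by exact: (bop_comp (bop_comp be by_) be).
  have Mk : M k by exact: (commutant_comp Me (commutant_comp My Me)).
  have sk u v : hdot (k u) v = hdot u (k v) by rewrite /k proj_sa// sy proj_sa.
  have ek u : e (k u) = k u by rewrite /k proj_idem.
  have ke u : k (e u) = k u by rewrite /k proj_idem.
  have cmp v w : e v = v -> e w = w -> nrm v = 1 -> nrm w = 1 ->
      complex.Re (hdot v (k v)) < complex.Re (hdot w (k w)) -> False.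
    move=> ev ew nv nw lt; set a := complex.Re _ in lt; set b := complex.Re _ in lt.
    pose t := (a + b) / 2.
    pose h u := k u - t%:C *: e u.
    have Mh : M h by apply: commutant_sub => //; exact: commutant_scale.
    have sh u u' : hdot (h u) u' = hdot u (h u').
      by rewrite /h hdotBl hdotBr hdotZl hdotZr conjr sk proj_sa.
    have eh u : e (h u) = h (e u).
      by rewrite /h (bopB _ _ be) (bopZ _ _ be) ek ke.
    have [f [pf Mf f1 f0 fc]] := spectral_cut sX Mh sh.
    have ae : adj e = e by apply/esym/adj_unique => // u u'; rewrite proj_sa.
    have ef u : e (f u) = f (e u) by apply: fc => // u'; rewrite ?ae eh.
    have val u : e u = u -> nrm u = 1 ->
        complex.Re (hdot u (h u)) = complex.Re (hdot u (k u)) - t.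
      by move=> eu nu; rewrite /h eu hdotBr hdotZr hdot_nrm nu expr1n mulr1 ReB.
    have pq : projection (f \o e).
      split; first exact/bounded_opP/(bop_comp be (proj_bop pf)).
        by apply/funext => u /=; rewrite ef !proj_idem.
      by move=> u u' /=; rewrite proj_sa// proj_sa// ef.
    have Mq : M (f \o e) by exact: commutant_comp.
    have [|q0|qe] := mine _ pq Mq.
    - by move=> u /=; rewrite ef proj_idem.
    - have /(congr1 (fun g => g w)) /= := q0; rewrite ew => /f0.
      rewrite val// -/b /t; lra.
    - have /(congr1 (fun g => g v)) /= := qe; rewrite ev => /f1.
      rewrite val// -/a /t; lra.
  have [u0 eu0] := proj_neq0 e0.
  pose v0 := (nrm (e u0))^-1%:C *: e u0.
  have n0 := nrm_gt0 eu0.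
  have unit v : v <> 0 -> nrm ((nrm v)^-1%:C *: v) = 1.
    move=> /nrm_gt0 nv; rewrite nrmZ nrmc_real ger0_norm ?invr_ge0 ?(ltW nv)//.
    by rewrite mulVf// gt_eqF.
  have ev0 : e v0 = v0 by rewrite /v0 (bopZ _ _ be) proj_idem.
  have nv0 : nrm v0 = 1 by exact: unit.
  pose t := complex.Re (hdot v0 (k v0)).
  have all_t w : e w = w -> complex.Re (hdot w (k w)) = t * nrm w ^+ 2.
    have [->|/eqP w0] := eqVneq w 0.
      by rewrite hdot0l nrm0 expr0n mulr0.
    move=> ew; have nw := nrm_gt0 w0.
    pose w1 := (nrm w)^-1%:C *: w.
    have ew1 : e w1 = w1 by rewrite /w1 (bopZ _ _ be) ew.
    have nw1 : nrm w1 = 1 by exact: unit.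
    have h : complex.Re (hdot w1 (k w1)) = t.
      have [lt|lt|//] := ltgtP (complex.Re (hdot w1 (k w1))) t.
        by case: (cmp w1 v0).
      by case: (cmp v0 w1).
    rewrite -h /w1 (bopZ _ _ bk) hdotZl hdotZr conjr !ReZ.
    by field; rewrite gt_eqF.
  exists t%:C => u; apply/eqP; rewrite -subr_eq0; apply/eqP.
  apply: (sa_zero (T := fun u => k u - t%:C *: e u)).
  - by apply: bop_sub => //; exact: bop_scale.
  - by move=> v w; rewrite hdotBl hdotBr hdotZl hdotZr conjr sk proj_sa.
  - move=> v; have h := all_t (e v) (proj_idem _ pe).
    have -> : hdot v (k v - t%:C *: e v) = hdot (e v) (k (e v)) - t%:C * hdot (e v) (e v).
      by rewrite hdotBr hdotZr ke proj_sa// ek (proj_sa v)// proj_idem.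
    by rewrite ReB h ReZ -nrm_sqr subrr.
move=> Mx; have bx := commutant_bop Mx; have Mx' : M (adj x) by case: (commutant_star sX' Mx).
have [|u v|c hc] := sae (fun u => x u + adj x u).
- exact: commutant_add.
- exact: re_part_sa.
have [|u v|d hd] := sae (fun u => 'i%C *: (x u - adj x u)).
- by apply: commutant_scale => //; exact: commutant_sub.
- exact: im_part_sa.
exists (2^-1%:C * (c - 'i%C * d)) => u.
rewrite [x (e u)]cartesian_decomposition (bopZ _ _ be) (bopB _ _ be) (bopZ _ _ be) hc hd.
by rewrite scalerA -scalerBl scalerA.
Qed.

End MinimalProjections.

(** * Rank one operators and irreducibility *)

Section RankOne.
Context {R : realType} {H : hilbertType R}.

Definition rank_one (z : H) : H -> H := fun u => hdot z u *: z.

Lemma bop_rank_one z : bop (rank_one z).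
Proof.
split=> [c u v|]; first by rewrite /rank_one hdotDr hdotZr scalerDl scalerA.
exists (nrm z ^+ 2) => [|u]; first exact: sqr_ge0.
rewrite nrmZ mulrC expr2 -mulrA ler_wpM2l ?nrm_ge0//; exact: cauchy_schwarz.
Qed.

Lemma rank_one_sa z u v : hdot (rank_one z u) v = hdot u (rank_one z v).
Proof. by rewrite hdotZl hdotZr -hdot_conj mulrC. Qed.

Definition irreducible (X : set (H -> H)) : Prop :=
  forall T, commutant X T -> exists c : R[i], T = (fun u => c *: u).

Lemma irreducible_bicommutant X T : irreducible X -> bop T -> bicommutant X T.
Proof.
by move=> iX bT; apply: commutantP => // S u /iX [c ->]; rewrite bopZ.
Qed.

End RankOne.

(** * Irreducibility for pure states and the parity unitary *)

Section PureStates.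
Context {R : realType} {A : cstarType R}.
Variables (psi : A -> R[i]) (H : hilbertType R) (pi : A -> H -> H) (Omega : H).
Hypotheses (psi_pure : pure_state psi) (hG : GNS setT psi pi Omega).

Let hpi := GNS_rep hG.
Let hpsi : state setT psi := psi_pure.1.
Let X := [set pi a | a in setT].
Let sX : star_closed X := rep_star_closed csa_setT hpi.

Lemma pure_irreducible : irreducible X.
Proof.
have nO := GNS_nrm csa_setT hG hpsi.
have vals a : hdot Omega (pi a Omega) = psi a by exact: (GNS_state hG).
(* An operator [T] of the commutant with [0 < T < 1] decomposes [psi]. *)
have key T : commutant X T -> (forall u v, hdot (T u) v = hdot u (T v)) ->
    (forall u, 4^-1 * nrm u ^+ 2 <= complex.Re (hdot u (T u)) <= 3 / 4 * nrm u ^+ 2) ->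
    exists c : R[i], T = (fun u => c *: u).
  move=> cT sT bnd; have bT := commutant_bop cT.
  have Tpi a u : T (pi a u) = pi a (T u) by exact: (com_rep (S := setT) u cT I).
  have real u : hdot u (T u) = (complex.Re (hdot u (T u)))%:C.
    by apply: conj_fix_Re; rewrite -hdot_conj sT.
  set t := complex.Re (hdot Omega (T Omega)).
  have /andP[t1 t2] : 4^-1 <= t <= 3 / 4 by have := bnd Omega; rewrite nO expr1n !mulr1.
  have t0 : 0 < t by lra.
  have t10 : 0 < 1 - t by lra.
  pose f (q : R) (Q : H -> H) a := (q^-1)%:C * hdot Omega (Q (pi a Omega)).
  have f_state q Q : 0 < q -> commutant X Q -> hdot Omega (Q Omega) = q%:C ->
      (forall u, 0 <= complex.Re (hdot u (Q u))) ->
      (forall u v, hdot (Q u) v = hdot u (Q v)) -> state setT (f q Q).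
    move=> q0 cQ Qq Q0 sQ; have bQ := commutant_bop cQ; split.
    - move=> c a b _ _; rewrite /f (rep_lin hpi)// (bopD _ _ bQ) (bopZ _ _ bQ).
      by rewrite hdotDr hdotZr; ring.
    - have Qpi a u : Q (pi a u) = pi a (Q u) by apply: (comm_app u cQ); exists a.
      move=> a _; rewrite /f (repM hpi)// Qpi -(rep_adj hpi)//.
      rewrite (conj_fix_Re (z := hdot (pi a Omega) (Q (pi a Omega)))).
        by rewrite -rmorphM ler0c mulr_ge0 ?invr_ge0 ?(ltW q0).
      by rewrite -hdot_conj sQ.
    - by rewrite /f (rep1 hpi) Qq -rmorphM /= mulVf ?gt_eqF.
  have cQ2 : commutant X (fun u => u - T u).
    by apply: commutant_sub => //; [exact: star_closed_bop|exact: commutant_id].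
  have T0 u : 0 <= complex.Re (hdot u (T u)).
    have /andP[h _] := bnd u; apply: le_trans h; apply: mulr_ge0; last exact: sqr_ge0.
    by rewrite invr_ge0.
  have [_ pure] := psi_pure.
  have [|||| e1 _] := pure (f t T) (f (1 - t) (fun u => u - T u)) t%:C.
  - exact: (f_state t T t0 cT (real Omega) T0 sT).
  - apply: (f_state (1 - t) _ t10 cQ2).
    + by rewrite hdotBr real hdot_nrm nO expr1n -rmorphB.
    + move=> u; rewrite hdotBr ReB -nrm_sqr; have /andP[_ h] := bnd u.
      by have := sqr_ge0 (nrm u); lra.
    + by move=> u v; rewrite hdotBl hdotBr sT.
  - by rewrite -[0]/(0%:C) -[1]/(1%:C) !ltcR; apply/andP; split; lra.
  - move=> a; rewrite /f !mulrA -[1]/(1%:C) -rmorphB -!rmorphM /= !mulfV ?gt_eqF//.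
    by rewrite !rmorph1 !mul1r hdotBr addrC subrK vals.
  (* Purity gives [f t T = psi], so [T] agrees with the scalar [t] on the cyclic orbit. *)
  exists t%:C; apply: (GNS_ext hG) => //.
    by apply: bop_scale; exact: bop_id.
  move=> a _; apply: hdot_inj => w.
  apply/eqP; rewrite -subr_eq0 -hdotBr; apply/eqP/hdot_sym0.
  apply: clos_orth (GNS_orbit hG w) => _ [b _ <-].
  apply: hdot_sym0.
  rewrite hdotBr hdotZr Tpi !(rep_adj hpi)// -!(repM hpi)// -Tpi.
  have := congr1 (fun g => g (star b * a)) e1; rewrite /f -vals => <-.
  by rewrite mulrA -rmorphM /= mulfV ?gt_eqF// mul1r subrr.
have sa T : commutant X T -> (forall u v, hdot (T u) v = hdot u (T v)) ->
    exists c : R[i], T = (fun u => c *: u).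
  move=> cT sT; have bT := commutant_bop cT; have [M M0 hM] := bop_bound bT.
  (* [r T + 1/2] takes its values between [1/4] and [3/4], so that it and its difference from [1]
     are both positive with nonzero weight in the state. *)
  pose r : R := (4 * M)^-1; have r0 : 0 < r by rewrite invr_gt0 mulr_gt0.
  have rM : r * M = 4^-1 by rewrite /r; field; rewrite gt_eqF.
  have bX := star_closed_bop sX.
  have [|u v|u|c hc] := key (fun u => r%:C *: T u + (2^-1)%:C *: u).
  - apply: commutant_add => //; first exact: commutant_scale.
    by apply: commutant_scale => //; exact: commutant_id.
  - by rewrite hdotDl hdotDr !hdotZl !hdotZr !conjr sT.
  - rewrite hdotDr !hdotZr ReD !ReZ -nrm_sqr.
    have h : `|complex.Re (hdot u (T u))| <= M * nrm u ^+ 2.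
      apply: le_trans (Re_le_nrmc _) _; apply: le_trans (cauchy_schwarz _ _) _.
      by rewrite expr2 mulrCA ler_wpM2l ?nrm_ge0.
    have h2 : `|r * complex.Re (hdot u (T u))| <= 4^-1 * nrm u ^+ 2.
      by rewrite normrM (gtr0_norm r0) -rM -mulrA ler_wpM2l ?(ltW r0).
    by move: h2; rewrite ler_norml => /andP[h2 h3]; apply/andP; split; lra.
  exists (r^-1%:C * (c - (2^-1)%:C)); apply/funext => u.
  have /(congr1 (fun g => g u)) /= h := hc.
  rewrite -scalerA scalerBl -h addrK scalerA -rmorphM /= mulVf ?gt_eqF//.
  by rewrite scale1r.
move=> T cT; have bT := commutant_bop cT.
have bX := star_closed_bop sX.
have cT' : commutant X (adj T) by case: (commutant_star sX cT).
have [|u v|c hc] := sa (fun u => T u + adj T u).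
- exact: commutant_add.
- exact: re_part_sa.
have [|u v|d hd] := sa (fun u => 'i%C *: (T u - adj T u)).
- by apply: commutant_scale => //; exact: commutant_sub.
- exact: im_part_sa.
exists ((2^-1)%:C * (c - 'i%C * d)); apply/funext => u.
have /(congr1 (fun g => g u)) /= hcu := hc.
have /(congr1 (fun g => g u)) /= hdu := hd.
by rewrite [T u]cartesian_decomposition hcu hdu scalerA -scalerBl scalerA.
Qed.

Section Parity.
Variable (Theta : {lrmorphism A -> A}).
Hypotheses (parity_star : forall a, Theta (star a) = star (Theta a))
  (Theta2 : forall a, Theta (Theta a) = a) (psi_inv : invariant_state Theta setT psi).

Lemma rep_twist (K : hilbertType R) (rho : A -> K -> K) S :
  (forall a, S a -> S (Theta a)) -> representation S rho -> representation S (rho \o Theta).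
Proof.
move=> hS hr; split=> /=.
- by move=> a Sa; case: hr => h _ _ _ _; exact/h/hS.
- by move=> c a b Sa Sb; rewrite linearP; case: hr => _ h _ _ _; apply: h; exact: hS.
- by move=> a b Sa Sb; rewrite rmorphM; case: hr => _ _ h _ _; apply: h; exact: hS.
- by rewrite rmorph1; case: hr.
- by move=> a Sa; rewrite parity_star; case: hr => _ _ _ _ h; apply: h; exact: hS.
Qed.

(** [Omega] induces the same state through [pi] and through [pi \o Theta], so [state_isometry]
    relates the two; cyclicity makes the resulting map a self-adjoint involution. *)
Lemma parity_unitary : exists G : H -> H, [/\ bop G, forall u, G (G u) = u,
  forall u v, hdot (G u) v = hdot u (G v), forall a u, G (pi a u) = pi (Theta a) (G u)
  & G Omega = Omega].
Proof.
have hr := rep_twist (S := setT) (fun _ _ => I) hpi.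
have [|G [bG Gi GO GO' _]] := state_isometry csa_setT hpi hr (w1 := Omega) (w2 := Omega).
  by move=> a _ /=; rewrite !(GNS_state hG)// psi_inv.
have Gi' a u : G (pi a u) = pi (Theta a) (G u) by exact: Gi.
have G2 u : G (G u) = u.
  rewrite -[G (G u)]/((G \o G) u) (GNS_ext hG (T' := id) (bop_comp bG bG) bop_id)// => a _ /=.
  by rewrite !Gi' !GO Theta2.
exists G; split=> // u v.
suff e : G = adj G by rewrite {1}e adjl.
apply: (GNS_ext hG) => //; first exact: bop_adj.
move=> a _; rewrite Gi' GO -{2}(Theta2 a).
by rewrite (intertwiner_adj csa_setT hpi hr bG Gi (a := Theta a))// GO'.
Qed.

End Parity.

End PureStates.

Section RepSub.
Context {R : realType} {A : cstarType R} {H : hilbertType R}.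

Lemma rep_sub (S : set A) (pi : A -> H -> H) : representation setT pi -> representation S pi.
Proof.
by move=> [h1 h2 h3 h4 h5]; split=> //; [move=> a _|move=> c a b _ _|move=> a b _ _|move=> a _];
  [exact: h1|exact: h2|exact: h3|exact: h5].
Qed.

Lemma state_sub (S : set A) (phi : A -> R[i]) : state setT phi -> state S phi.
Proof.
by move=> [h1 h2 h3]; split=> //; [move=> c a b _ _; exact: h1|move=> a _; exact: h2].
Qed.

End RepSub.

(** * Vectors whose states factorize over an algebra and its commutant *)

Section PureVectors.
Context {R : realType} {A : cstarType R} {H : hilbertType R}.
Variables (S : set A) (hS : cstar_subalgebra S) (pi : A -> H -> H).
Hypothesis hpi : representation S pi.

Let X := [set pi a | a in S].
Let sX : star_closed X := rep_star_closed hS hpi.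

(** [state_bound] is applied to the vector state of the normalized [u]. *)
Lemma rep_contractive a u : S a -> nrm (pi a u) <= cn a * nrm u.
Proof.
move=> Sa; have ba := rep_bop hpi Sa.
have [->|/eqP u0] := eqVneq u 0; first by rewrite (bop0 ba) nrm0 mulr0.
have nu := nrm_gt0 u0; pose v := ((nrm u)^-1)%:C *: u.
have i0 : 0 <= (nrm u)^-1 by rewrite invr_ge0 ltW.
have nv : nrm v = 1 by rewrite nrmZ nrmc_real ger0_norm// mulVf// gt_eqF.
have := state_bound hS (rep_state hS hpi nv) Sa (csa1 hS).
rewrite !mulr1 star1 (rep1 hpi) hdot_nrm nv expr1n /= mulr1 -(rep_nrm_sqr hS hpi)//.
rewrite ler_pXn2r ?nnegrE ?nrm_ge0 ?cn_ge0// /v (bopZ _ _ ba) nrmZ nrmc_real ger0_norm//.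
by rewrite ler_pdivrMl// mulrC.
Qed.

(** The hypothesis says that the component of [y v] along the orbit of [v] is a multiple of [v]. The
    compression of [y] commutes with the represented algebra, so the same multiple occurs on the
    whole orbit. *)
Lemma product_vector_scalar (v : H) (lam : A -> R[i]) : v <> 0 ->
  (forall a y, S a -> commutant X y -> hdot v (pi a (y v)) = lam a * hdot v (y v)) ->
  forall y, commutant X y -> exists c : R[i],
    forall u, orbit S pi v u -> pj (orbit S pi v) (y u) = c *: u.
Proof.
move=> v0 hv y hy; have cO := csub_orbit hS hpi v.
have v2 : hdot v v != 0 by apply/eqP => /hdot_eq0.
pose c := hdot v (y v) / hdot v v.
have Pyv : pj (orbit S pi v) (y v) = c *: v.
  apply: pj_unique => //; first exact: (linZ c cO.1 (orbit_self hS hpi v)).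
  move=> w Ow; apply: hdot_sym0.
  apply: clos_orth Ow => _ [a Sa <-].
  apply: hdot_sym0.
  have Sa' := csa_star hS Sa.
  rewrite hdotBr hdotZr !(rep_adj hpi)// hv//.
  by have := hv _ _ Sa' (commutant_id X); rewrite /= /c => ->; field.
have cP : commutant X (pj (orbit S pi v)) := pj_orbit_com hS hpi v.
exists c => u Ou; have by_ := commutant_bop hy.
apply: (clos_eq (T := pj (orbit S pi v) \o y) (S := fun u => c *: u) _ _ _ Ou).
- exact: bop_comp by_ (bop_pj cO).
- by apply: bop_scale; exact: bop_id.
move=> _ [a Sa <-] /=; rewrite (comm_app v hy); last by exists a.
by rewrite (comm_app (y v) cP) ?Pyv ?(bopZ _ _ (rep_bop hpi Sa))//; exists a.
Qed.

(* The projection onto the closure of [pi(S)' w] is abelian. *)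
Lemma abelian_projection_of_vector (w : H) (lam : A -> R[i]) : w <> 0 ->
  (forall a y, S a -> commutant X y -> hdot w (pi a (y w)) = lam a * hdot w (y w)) ->
  exists e, [/\ abelian_projection (vN_of S pi) e, e <> cst 0
    & forall z, commutant X z -> vN_of S pi z -> z w = w -> z \o e = e].
Proof.
move=> w0 hw; set M := vN_of S pi.
have sX' := commutant_star sX.
pose E0 := [set y w | y in commutant X].
have linE : linear_set E0.
  split; first by exists (cst 0) => //; apply: commutant0; exact: star_closed_bop.
  move=> c _ _ [y hy <-] [y' hy' <-]; exists (fun u => c *: y u + y' u) => //.
  by apply: commutant_lin => //; exact: star_closed_bop.
pose E := clos E0; have cE : csub E := clos_linear linE.
pose e := pj E.
have Me : M e.
  apply: pj_commutant => // T u hT; apply: bop_clos; first exact: commutant_bop hT.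
  by move=> _ [y hy <-]; exists (T \o y) => //; exact: commutant_comp.
have Ew : E w by apply: clos_sub; exists id => //; exact: commutant_id.
have w2 : hdot w w != 0 by apply/eqP => /hdot_eq0.
pose P := pj (orbit S pi w); have cO := csub_orbit hS hpi w.
pose mu (y : H -> H) := hdot w (y w) / hdot w w.
have Py y : commutant X y -> P (y w) = mu y *: w.
  move=> hy; have [c hc] := product_vector_scalar w0 hw hy.
  have Ow := orbit_self hS hpi w; have Pw := hc w Ow; rewrite [P _]Pw.
  congr (_ *: _); apply: (mulIf w2).
  by rewrite /mu mulfVK// -hdotZr -Pw -pj_sa// pj_id.
have cP : commutant X P := pj_orbit_com hS hpi w.
(* The left side pairs [adj x w], which lies in the orbit of [w] because [P] commutes with [M], with
   [adj y1 (y2 w)], whose projection to that orbit is a multiple of [w]. *)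
have comp x y1 y2 : M x -> commutant X y1 -> commutant X y2 ->
    hdot (y1 w) (x (y2 w)) = hdot w (x w) / hdot w w * hdot (y1 w) (y2 w).
  move=> Mx c1 c2; have [b1 c1'] := sX' _ c1.
  have bx := commutant_bop Mx.
  have [_ Mx'] := bicommutant_star sX Mx.
  have -> : hdot (y1 w) (x (y2 w)) = hdot (adj x w) ((adj y1 \o y2) w).
    by rewrite /= (adjl _ _ bx) (comm_app _ Mx c1') adjr.
  have Px : P (adj x w) = adj x w.
    by rewrite -(comm_app _ Mx' cP) /P pj_id//; exact: (orbit_self hS hpi w).
  rewrite -Px pj_sa// -/P Py; last exact: commutant_comp.
  by rewrite hdotZr adjl// /mu /= adjr//; ring.
have scal x : M x -> forall u, e (x (e u)) = (hdot w (x w) / hdot w w) *: e u.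
  move=> Mx u; have bx := commutant_bop Mx.
  apply: (clos_eq (T := e \o x) (S := fun v => (hdot w (x w) / hdot w w) *: v) _ _ _ (pj_in cE u)).
  - exact: bop_comp bx (bop_pj cE).
  - by apply: bop_scale; exact: bop_id.
  - move=> _ [y hy <-]; apply: pj_unique => //.
      exact: (linZ _ cE.1 (clos_sub (ex_intro2 _ _ y hy erefl))).
    move=> v Ev; apply: hdot_sym0.
    apply: clos_orth Ev => _ [y' hy' <-].
    apply: hdot_sym0.
    by rewrite hdotBr hdotZr (comp x y' y Mx hy' hy) subrr.
exists e; split.
- split=> [|//|x y Mx My]; first exact: projection_pj.
  apply/funext => u /=; have be : bop e := bop_pj cE.
  have ee v : e (e v) = e v by apply: pj_id => //; exact: pj_in.
  have bx := commutant_bop Mx; have by_ := commutant_bop My.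
  rewrite !ee (scal y My) (scal x Mx) (bopZ _ _ bx) (bopZ _ _ by_) !(bopZ _ _ be).
  by rewrite (scal y My) (scal x Mx) !scalerA mulrC.
- move=> e0; apply: w0; have := congr1 (fun g => g w) e0.
  by rewrite /= /e pj_id.
- move=> z cz Mz zw; apply/funext => u /=.
  apply: (clos_eq (T := z) (S := id) _ bop_id _ (pj_in cE u)).
    exact: commutant_bop cz.
  by move=> _ [y hy <-]; rewrite (comm_app _ Mz hy) zw.
Qed.

End PureVectors.

(** * From a dominated self-adjoint operator to a product vector *)

Section Domination.
Context {R : realType} {A : cstarType R} {H1 H2 : hilbertType R}.
Variables (S : set A) (hS : cstar_subalgebra S).
Variables (pi1 : A -> H1 -> H1) (pi2 : A -> H2 -> H2).
Hypotheses (hpi1 : representation S pi1) (hpi2 : representation S pi2).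
Variables (w1 : H1) (h : H2 -> H2) (C : R) (b : H2).
Hypotheses (Mh : vN_of S pi2 h) (sh : forall u v, hdot (h u) v = hdot u (h v))
  (C0 : 0 <= C) (hC : forall a u, S a -> nrm (pi2 a (h u)) <= C * nrm (pi1 a w1) * nrm u)
  (hb : 0 < complex.Re (hdot b (h b))).

Let X1 := [set pi1 a | a in S].
Let X2 := [set pi2 a | a in S].
Let sX2 : star_closed X2 := rep_star_closed hS hpi2.
Let bX2 := star_closed_bop sX2.

Lemma dominated_intertwiner u : exists L : H1 -> H2,
  [/\ bop L, forall a v, S a -> L (pi1 a v) = pi2 a (L v), L w1 = h u,
    forall v, (forall a, S a -> hdot (pi1 a w1) v = 0) -> L v = 0
    & forall v, nrm (adj L v) <= C * nrm u * nrm v].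
Proof.
have [||L [bL Li L1 L0 Ln]] := intertwiner hS hpi1 hpi2 (w1 := w1) (w2 := h u) (C := C * nrm u).
- by rewrite mulr_ge0 ?nrm_ge0.
- by move=> a Sa; rewrite mulrAC; exact: hC.
exists L; split=> // v; apply: adj_bound => //; rewrite mulr_ge0 ?nrm_ge0//.
Qed.

Lemma positive_cut : exists2 d : R, 0 < d & exists f, [/\ projection f, vN_of S pi2 f, f <> cst 0
  & forall u, f u = u -> d * nrm u ^+ 2 <= complex.Re (hdot u (h u))].
Proof.
have b0 : b <> 0 by move=> b0; move: hb; rewrite b0 hdot0l ltxx.
have nb := nrm_gt0 b0.
(* Half the normalized expectation of [h] at [b]: the operator [h - d] is still positive at [b], so
   its cut is nonzero. *)
pose d := complex.Re (hdot b (h b)) / (2 * nrm b ^+ 2).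
have d0 : 0 < d by rewrite divr_gt0// mulr_gt0// exprn_gt0.
exists d => //.
have [||f [pf Mf f1 f0 _]] := spectral_cut (h := fun u => h u - d%:C *: u) sX2.
- apply: commutant_sub => //; first exact: commutant_bops.
  by apply: commutant_scale; [exact: commutant_bops|exact: commutant_id].
- by move=> u v; rewrite hdotBl hdotBr hdotZl hdotZr conjr sh.
have e u : complex.Re (hdot u (h u - d%:C *: u)) = complex.Re (hdot u (h u)) - d * nrm u ^+ 2.
  by rewrite hdotBr hdotZr ReB ReZ -nrm_sqr.
exists f; split=> //.
  move=> fz; have := f0 b; rewrite fz e => /(_ erefl).
  have -> : d * nrm b ^+ 2 = complex.Re (hdot b (h b)) / 2.
    by rewrite /d; field; rewrite gt_eqF.
  by rewrite subr_le0 leNgt ltr_pdivrMr// ltr_pMr// ltr1n.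
by move=> u /f1; rewrite e subr_ge0.
Qed.

(** Orthogonal projections [q i] below the cut, with unit vectors [u i] in their ranges, give
    vectors [w i = adj (L i) (u i)]. These are orthogonal because [L j \o adj (L i)] lies in the
    commutant and so commutes with [q i]; they satisfy [|w i| <= C], and their inner products with
    [w1] are at least [d]. *)
Lemma dominated_minimal : exists e (d : R), [/\ minimal_projection X2 e, 0 < d
  & forall u, e u = u -> d * nrm u ^+ 2 <= complex.Re (hdot u (h u))].
Proof.
have [d d0 [f [pf Mf f0 hf]]] := positive_cut.
(* For the sum [s n] of the [w i], the estimates [n d <= |w1| |s n|] and [|s n|^2 <= n C^2] give
   [n <= (C |w1| / d)^2]. *)
have [|e [me fe]] := minimal_projection_exists sX2 (N := Num.truncn ((C * nrm w1 / d) ^+ 2)) pf Mf f0; last first.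
  by exists e, d; split=> // u eu; apply: hf; rewrite -eu fe.
move=> n q hq qorth.
have ex i : exists u L, (i < n)%N -> [/\ q i u = u, nrm u = 1, bop L,
    forall a v, S a -> L (pi1 a v) = pi2 a (L v) & L w1 = h u /\ nrm (adj L u) <= C].
  have [i_n|] := boolP (i < n)%N; last by exists 0, (cst 0).
  have [pq Mq /proj_neq0 [v qv] _] := hq _ i_n.
  have nv := nrm_gt0 qv.
  pose u := ((nrm (q i v))^-1)%:C *: q i v.
  have nu : nrm u = 1.
    by rewrite nrmZ nrmc_real ger0_norm ?invr_ge0 ?(ltW nv)// mulVf// gt_eqF.
  have [L [bL Li L1 _ Ln]] := dominated_intertwiner u.
  exists u, L => _; split=> //.
    by rewrite /u (bopZ _ _ (proj_bop pq)) proj_idem.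
  by split=> //; have := Ln u; rewrite nu !mulr1.
have [u /choice [L hL]] := choice ex.
pose w i := adj (L i) (u i).
have worth i j : (i < j < n)%N -> hdot (w i) (w j) = 0.
  move=> /andP[ij jn]; have i_n := ltn_trans ij jn.
  have [qi _ bi Li _] := hL _ i_n; have [qj _ bj Lj _] := hL _ jn.
  have [pqi Mqi _ _] := hq _ i_n; have [pqj _ _ _] := hq _ jn.
  have cK : commutant X2 (L j \o adj (L i)).
    apply: com_repP; first exact: bop_comp (bop_adj bi) bj.
    by move=> a v Sa /=; rewrite (intertwiner_adj hS hpi1 hpi2 bi Li)// Lj.
  rewrite /w adjr// -{1}qi -/((L j \o adj (L i)) (q i (u i))).
  rewrite -(comm_app (u i) Mqi cK) proj_sa// -qj qorth ?hdot0r//.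
  by rewrite ij.
have wval i : (i < n)%N -> d <= complex.Re (hdot w1 (w i)).
  move=> i_n; have [qi nu bi Li [L1 _]] := hL _ i_n; have [_ _ _ fq] := hq _ i_n.
  rewrite /w adjr// L1 sh; have := hf (u i); rewrite nu expr1n mulr1; apply.
  by rewrite -qi fq.
(* Bessel's inequality for the orthogonal vectors [w i]. *)
pose s m := \sum_(i < m) w i.
have sval m : (m <= n)%N -> m%:R * d <= complex.Re (hdot w1 (s m)) /\ nrm (s m) ^+ 2 <= m%:R * C ^+ 2.
  elim: m => [_|m IH mn].
    by rewrite /s big_ord0 hdot0r nrm0 expr0n /= !mul0r.
  have [h1 h2] := IH (ltnW mn); rewrite /s big_ord_recr /= -/(s m) hdotDr ReD; split.
    by rewrite -natr1 mulrDl mul1r lerD// wval.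
  have s0 : hdot (s m) (w m) = 0.
    apply: hdot_sym0.
    have : forall k, (k <= m)%N -> hdot (w m) (s k) = 0.
      elim=> [_|k IHk km]; first by rewrite /s big_ord0 hdot0r.
      rewrite /s big_ord_recr /= -/(s k) hdotDr IHk ?(ltnW km)// add0r.
      by rewrite hdot_conj worth ?rmorph0// km.
    exact.
  have [_ _ _ _ [_ wn]] := hL _ mn.
  rewrite nrm_sqrD s0 /= mulr0 addr0 -natr1 mulrDl mul1r lerD//.
  by rewrite ler_pXn2r ?nnegrE ?nrm_ge0.
have [h1 h2] := sval n (leqnn n).
have h3 : n%:R * d <= nrm w1 * nrm (s n).
  apply: le_trans h1 _; apply: le_trans (ler_norm _) _.
  by apply: le_trans (Re_le_nrmc _) _; exact: cauchy_schwarz.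
have h4 : (n%:R * d) ^+ 2 <= nrm w1 ^+ 2 * (n%:R * C ^+ 2).
  apply: (@le_trans _ _ ((nrm w1 * nrm (s n)) ^+ 2)).
    by rewrite ler_pXn2r ?nnegrE ?mulr_ge0 ?nrm_ge0 ?ler0n ?(ltW d0).
  by rewrite exprMn ler_wpM2l// sqr_ge0.
have [->//|n0] := posnP n.
have n0' : (0 : R) < n%:R by rewrite ltr0n.
have h5 : n%:R <= (C * nrm w1 / d) ^+ 2.
  rewrite expr_div_n ler_pdivlMr ?exprn_gt0// -(ler_pM2l n0').
  have -> : n%:R * (n%:R * d ^+ 2) = (n%:R * d) ^+ 2 by ring.
  by have -> : n%:R * (C * nrm w1) ^+ 2 = nrm w1 ^+ 2 * (n%:R * C ^+ 2) by ring.
by rewrite truncn_ge_nat// sqr_ge0.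
Qed.

(** Take [w = adj L u] with [u] in the range of the minimal [e]. The operator [L \o y \o adj L] lies
    in the commutant and so commutes with [e], while [e] compresses [pi2 a] to [lam a]. As [L] kills
    the complement of the orbit of [w1], every projection of the commutant that fixes [w1] fixes
    [w]. *)
Lemma dominated_product_vector : exists w lam, [/\ w <> 0,
  forall a y, S a -> commutant X1 y -> hdot w (pi1 a (y w)) = lam a * hdot w (y w)
  & forall z, projection z -> commutant X1 z -> z w1 = w1 -> z w = w].
Proof.
have [e [d [me d0 he]]] := dominated_minimal; have [pe Me e0 _] := me.
have sc a : exists c : R[i], S a -> forall u, e (pi2 a (e u)) = c *: e u.
  have [ha|na] := pselect (S a); last by exists 0.
  have [|c hc] := minimal_scalar sX2 (x := pi2 a) me; last by exists c.
  by apply: bicommutant_sub => //; exists a.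
have [lam hlam] := choice sc.
have [v ev] := proj_neq0 e0; set u := e v in ev.
have eu : e u = u by rewrite /u proj_idem.
have [L [bL Li L1 L0 _]] := dominated_intertwiner u.
exists (adj L u), lam; split.
- move=> w0; have := he u eu; rewrite -(sh u u) -L1 -adjr// w0 hdot0r.
  by rewrite leNgt mulr_gt0 ?exprn_gt0 ?nrm_gt0.
- move=> a y Sa hy.
  have cK : commutant X2 (L \o y \o adj L).
    apply: com_repP; first exact: bop_comp (bop_comp (bop_adj bL) (commutant_bop hy)) bL.
    move=> c x Sc /=; rewrite (intertwiner_adj hS hpi1 hpi2 bL Li)//.
    by rewrite (com_rep _ hy)// Li.
  rewrite adjl// Li// adjl//; set k := _ \o adj L in cK.
  rewrite -[L (y (adj L u))]/(k u) -{1 2 4}eu -(comm_app u Me cK) proj_sa// hlam// hdotZr.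
  by rewrite -(proj_sa u)// eu.
move=> z pz hz zw; apply: hdot_inj => y; apply/eqP; rewrite -subr_eq0; apply/eqP.
rewrite hdot_conj [hdot y (adj L u)]hdot_conj -rmorphB; apply/eqP; rewrite fmorph_eq0; apply/eqP.
rewrite proj_sa// -hdotBr adjl// L0 ?hdot0r// => a Sa.
by rewrite hdotBr -proj_sa// (com_rep _ hz)// zw subrr.
Qed.

End Domination.

(** * Amplification to two copies *)

Section Diagonal.
Context {R : realType} {H : hilbertType R}.

Definition diag (T : H -> H) : dsum H -> dsum H := fun u => (T u.1, T u.2).

Lemma bop_fst : bop (fun u : dsum H => u.1).
Proof. by split=> //; exists 1 => // u; rewrite mul1r; case: (dsum_nrm_ge u). Qed.

Lemma bop_snd : bop (fun u : dsum H => u.2).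
Proof. by split=> //; exists 1 => // u; rewrite mul1r; case: (dsum_nrm_ge u). Qed.

Lemma bop_pair (K : hilbertType R) (S T : K -> H) : bop S -> bop T ->
  bop (fun u => (S u, T u) : dsum H).
Proof.
move=> bS bT; split=> [c u v|].
  by rewrite (bopD _ _ bS) (bopD _ _ bT) (bopZ _ _ bS) (bopZ _ _ bT).
have [M1 m1 h1] := bop_bound bS; have [M2 m2 h2] := bop_bound bT.
exists (M1 + M2) => [|u]; first by rewrite addr_ge0 ?ltW.
by apply: le_trans (dsum_nrm_le ((S u, T u) : dsum H)) _; rewrite mulrDl; apply: lerD; [exact: h1|exact: h2].
Qed.

Lemma bop_diag T : bop T -> bop (diag T).
Proof. by move=> bT; apply: bop_pair; [exact: bop_comp bop_fst bT|exact: bop_comp bop_snd bT]. Qed.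

(** The blocks of an operator that commutes with the doubled set commute with [X], hence with
    [T]. *)
Lemma bicommutant_diag (X : set (H -> H)) T : X `<=` bop -> bicommutant X T ->
  bicommutant [set diag x | x in X] (diag T).
Proof.
move=> bX hT; apply: commutantP => [|S u hS]; first exact/bop_diag/(commutant_bop hT).
have bS := commutant_bop hS.
have b1 : bop (fun u : H => (u, 0) : dsum H) by apply: bop_pair; [exact: bop_id|exact: bop_cst0].
have b2 : bop (fun u : H => (0, u) : dsum H) by apply: bop_pair; [exact: bop_cst0|exact: bop_id].
have [s1 s2] : (forall u, S (T u, 0) = diag T (S (u, 0))) /\ (forall u, S (0, T u) = diag T (S (0, u))).
  have h (i : H -> dsum H) : bop i -> (forall x v, X x -> i (x v) = diag x (i v)) ->
      forall v, S (i (T v)) = diag T (S (i v)).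
    move=> bi hi v; have bSi := bop_comp bi bS.
    have c1 : commutant X (fun v => (S (i v)).1).
      apply: commutantP => [|x w Xx]; first exact: bop_comp bSi bop_fst.
      by rewrite hi// (comm_app _ hS)//; exists x.
    have c2 : commutant X (fun v => (S (i v)).2).
      apply: commutantP => [|x w Xx]; first exact: bop_comp bSi bop_snd.
      by rewrite hi// (comm_app _ hS)//; exists x.
    rewrite /diag (comm_app v hT c1) (comm_app v hT c2).
    by case: (S (i (T v))).
  by split; apply: h => // x v Xx; rewrite /diag /= (bop0 (bX _ Xx)).
have e (v : dsum H) : v = (v.1, 0) + (0, v.2).
  by case: v => a b; rewrite -[RHS]/((a + 0, 0 + b) : dsum H) addr0 add0r.
have -> : S (diag T u) = S (T u.1, 0) + S (0, T u.2) by rewrite -(bopD _ _ bS) -(e (diag T u)).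
have -> : S u = S (u.1, 0) + S (0, u.2) by rewrite -(bopD _ _ bS) -e.
by rewrite (bopD _ _ (bop_diag (commutant_bop hT))) s1 s2.
Qed.

End Diagonal.

(** * Compression of an operator into a von Neumann algebra *)

Section Compression.
Context {R : realType} {A : cstarType R} {H H2 : hilbertType R}.
Variables (S : set A) (hS : cstar_subalgebra S).
Variables (rho : A -> H -> H) (pi2 : A -> H2 -> H2) (Y : H2 -> H) (P : H -> H).
Hypotheses (hrho : representation setT rho) (hpi2 : representation S pi2) (bY : bop Y)
  (hP : vN_of setT rho P) (sP : forall u v, hdot (P u) v = hdot u (P v)).
Hypothesis hY : forall b b', (forall a, S a -> hdot b (pi2 a b) = hdot b' (pi2 a b')) ->
  forall a, hdot (Y b) (rho a (Y b)) = hdot (Y b') (rho a (Y b')).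

Let X2 := [set pi2 a | a in S].
Let sX2 : star_closed X2 := rep_star_closed hS hpi2.
Let bX2 := star_closed_bop sX2.

(** For self-adjoint [T] in the commutant and any [a], the vectors [T a + i a] and [T a - i a]
    induce the same state on [S]. By [hY] and [vN_state_eq] the compression [h] has the same
    expectation in both, and the difference of the two expectations is a multiple of the expectation
    at [a] of the commutator of [h] and [T]. *)
Lemma compression_bicommutant : vN_of S pi2 (adj Y \o P \o Y).
Proof.
set h := _ \o Y; have bP := commutant_bop hP.
have bh : bop h := bop_comp (bop_comp bY bP) (bop_adj bY).
have hE u v : hdot u (h v) = hdot (Y u) (P (Y v)) by rewrite /h /= adjr.
have sh u v : hdot (h u) v = hdot u (h v) by rewrite hE -sP /h /= adjl.
have sa T u : commutant X2 T -> (forall u v, hdot (T u) v = hdot u (T v)) -> h (T u) = T (h u).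
  move=> hT sT; have bT := commutant_bop hT.
  apply/eqP; rewrite -subr_eq0; apply/eqP.
  have i0 : 'i%C != 0 :> R[i] by rewrite eq_complex /= oner_eq0 andbF.
  suff e : 'i%C *: (h (T u) - T (h u)) = 0.
    by move/eqP: e; rewrite scaler_eq0 (negbTE i0) => /eqP.
  apply: (sa_zero (T := fun u => 'i%C *: (h (T u) - T (h u)))).
  - by apply: bop_scale; apply: bop_sub; [exact: bop_comp bT bh|exact: bop_comp bh bT].
  - move=> v w; rewrite hdotZl hdotZr conji hdotBl hdotBr sh !sT sh; ring.
  move=> a; pose b := T a + 'i%C *: a; pose b' := T a + (- 'i%C) *: a.
  have expand (k : H2 -> H2) (c : R[i]) : bop k -> hdot (T a + c *: a) (k (T a + c *: a)) =
      hdot (T a) (k (T a)) + c * hdot (T a) (k a) + Num.conj c * hdot a (k (T a))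
      + Num.conj c * c * hdot a (k a).
    move=> bk; rewrite (bopD _ _ bk) (bopZ _ _ bk) hdotDl !hdotDr !hdotZl !hdotZr; ring.
  have /hY hbb : forall x, S x -> hdot b (pi2 x b) = hdot b' (pi2 x b').
    move=> x Sx; have bx := rep_bop hpi2 Sx.
    rewrite /b /b' !expand// !rmorphN /= !conji !sT !(com_rep _ hT)//.
    ring.
  have := vN_state_eq csa_setT hrho (fun x _ => hbb x) hP.
  rewrite -!hE /b /b' !expand// !rmorphN /= !conji !sT => e.
  have {}e : (2 * 'i%C) * (hdot a (h (T a)) - hdot a (T (h a))) = 0 :> R[i].
    move/eqP: e; rewrite -subr_eq0 => /eqP e; rewrite -[RHS]oppr0 -e; ring.
  move/eqP: e; rewrite !mulf_eq0 (negbTE i0) pnatr_eq0 /= -hdotBr => /eqP e.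
  by rewrite hdotZr e mulr0.
apply: commutantP => // T u hT; have bT := commutant_bop hT.
have hT' : commutant X2 (adj T) by case: (commutant_star sX2 hT).
have h1 := sa _ u (commutant_add bX2 hT hT') (fun v w => re_part_sa v w bT).
have h2 := sa _ u (commutant_scale 'i%C bX2 (commutant_sub bX2 hT hT'))
  (fun v w => im_part_sa v w bT).
rewrite [T u]cartesian_decomposition [T (h u)]cartesian_decomposition.
by rewrite (bopZ _ _ bh) (bopB _ _ bh) (bopZ _ _ bh) h1 h2.
Qed.

End Compression.

Lemma orthocomplement_csub {R : realType} {H : hilbertType R} (D : set H) :
  csub [set u | forall d, D d -> hdot d u = 0].
Proof.
split.
  split=> [d _|c u v hu hv d Dd]; first exact: hdot0r.
  by rewrite hdotDr hdotZr hu// hv// mulr0 addr0.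
by move=> u hu d Dd; apply: clos_orth hu => w; apply.
Qed.

(** On the range of another [z j] the idempotent [G (z i) G = d - z i] is [d], so [d] is [0] or [1];
    the value [0] would make [- z i] idempotent and [z i] zero. Then [0 = G (z 0) (z 1) G = (1 - z
    0) (1 - z 1)] yields [1 = z 0 + z 1], which leaves no room for [z 2]. *)
Lemma no_three_projections {R : realType} {H : hilbertType R} (G : H -> H) (z : nat -> H -> H) :
  bop G -> (forall u, G (G u) = u) -> (forall i, bop (z i)) ->
  (forall i, (i < 3)%N -> [/\ forall u, z i (z i u) = z i u, exists u, z i u <> 0
    & exists d : R[i], forall u, z i u + G (z i (G u)) = d *: u]) ->
  (forall i j u, (i < 3)%N -> (j < 3)%N -> i != j -> z i (z j u) = 0) -> False.
Proof.
move=> bG G2 bz hz orth.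
have d1 i j : (i < 3)%N -> (j < 3)%N -> i != j -> forall u, G (z i (G u)) = u - z i u.
  move=> i3 j3 ij; have [zz [u0 zu0] [d hd]] := hz i i3; have [_ [u1 zu1] _] := hz j j3.
  have GzG u : G (z i (G u)) = d *: u - z i u by rewrite -hd addrC addKr.
  have idem u : G (z i (G (G (z i (G u))))) = G (z i (G u)) by rewrite G2 zz.
  have e1 := idem (z j u1); rewrite !GzG orth// !subr0 (bopZ _ _ (bz i)) orth// scaler0 subr0 in e1.
  have {e1} /eqP : (d * d - d) *: z j u1 = 0 by rewrite scalerBl -scalerA e1 subrr.
  rewrite scaler_eq0 => /orP[|/eqP//]; rewrite -{3}[d]mulr1 -mulrBr mulf_eq0 subr_eq0.
  case/orP => /eqP d0 u; rewrite GzG d0 ?scale1r//.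
  exfalso; apply: zu0; have e2 := idem (z i u0).
  rewrite !GzG d0 !scale0r !sub0r !zz (bopN _ (bz i)) zz opprK in e2.
  by have := half2 (z i u0); rewrite {1}e2 addNr scaler0.
have e0 := @d1 0 1%N isT isT isT; have e1 := @d1 1%N 0%N isT isT isT.
have [_ [u zu] _] := hz 2 isT; apply: zu.
have s : u = z 0%N u + z 1%N u.
  have h : G (z 0%N (G (G (z 1%N (G u))))) = 0 by rewrite G2 orth// (bop0 bG).
  rewrite e1 e0 (bopB _ _ (bz 0%N)) orth// subr0 in h.
  by move/eqP: h; rewrite -addrA -opprD subr_eq0 addrC => /eqP.
by rewrite s (bopD _ _ (bz 2)) !orth// addr0.
Qed.

Lemma GNS_isometry {R : realType} {A : cstarType R} (S : set A) (hS : cstar_subalgebra S)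
    (phi : A -> R[i]) {H K : hilbertType R} (pi : A -> H -> H) (rho : A -> K -> K) (Om : H) (v : K)
    (T : H -> K) : GNS S phi pi Om -> representation S rho -> bop T ->
  (forall a u, S a -> T (pi a u) = rho a (T u)) -> T Om = v -> adj T v = Om ->
  forall u, adj T (T u) = u.
Proof.
move=> hG hrho bT Ti TO Ta u; rewrite -[LHS]/((adj T \o T) u).
rewrite (GNS_ext hG (T' := id) (bop_comp bT (bop_adj bT)) bop_id)// => a ha /=.
by rewrite Ti// TO (intertwiner_adj hS (GNS_rep hG) hrho bT Ti)// Ta.
Qed.

Lemma rep_scalar {R : realType} {A : cstarType R} {H : hilbertType R} (pi : A -> H -> H) (c : R[i]) u :
  representation setT pi -> pi (c *: 1) u = c *: u.
Proof.
move=> hpi; have -> : c *: (1 : A) = (c - 1) *: 1 + 1 by rewrite scalerBl scale1r subrK.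
by rewrite (rep_lin hpi)// !(rep1 hpi) scalerBl scale1r subrK.
Qed.

(** * The two local algebras *)

Section LocalAlgebras.
Context {R : realType} {K : hilbertType R} {A : cstarType R}.
Variables (J : K -> K) (B : {linear K -> A}) (Theta : {lrmorphism A -> A}).
Hypotheses (J_conj : conjugation J) (hCAR : selfdual_CAR J B)
  (hTheta : parity_automorphism B Theta).

Lemma parity_star a : Theta (star a) = star (Theta a).
Proof. by case: hTheta. Qed.

Lemma parity_B f : Theta (B f) = - B f.
Proof. by case: hTheta. Qed.

Lemma parity_contractive a : cn (Theta a) <= cn a.
Proof. exact: (star_hom_contractive parity_star). Qed.

Lemma CAR_induction (T : set A) : cstar_subalgebra T -> (forall f, T (B f)) -> forall a, T a.
Proof.
move=> hT hB a; case: hCAR => _ _ gen.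
have : cstar_generated (range B) a by rewrite gen.
by apply => // _ [f _ <-].
Qed.

Lemma parityK a : Theta (Theta a) = a.
Proof.
apply: (CAR_induction (T := [set a | Theta (Theta a) = a])); last first.
  by move=> f /=; rewrite parity_B raddfN /= parity_B opprK.
split=> /=.
- by rewrite !rmorph1.
- by move=> c x y /= hx hy; rewrite !linearP /= hx hy.
- by move=> x y /= hx hy; rewrite !rmorphM /= hx hy.
- by move=> x /= hx; rewrite !parity_star hx.
apply: (norm_closed_eq (F := fun a => Theta (Theta a)) (G := id) (M := 1) (N := 1)) => //= x.
- by move=> y; rewrite !rmorphB.
- by rewrite mul1r; exact: le_trans (parity_contractive _) (parity_contractive _).
- by rewrite mul1r.
Qed.

Lemma parity_local (V : set K) a : linear_set V -> local_algebra B V a -> local_algebra B V (Theta a).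
Proof.
move=> lV ha; have hL : cstar_subalgebra (local_algebra B V) := csa_generated _.
apply: (ha [set a | local_algebra B V (Theta a)]); last first.
  move=> _ [f Vf <-] /=; rewrite parity_B -linearN; apply: gen_sub.
  by exists (- f) => //; rewrite -scaleN1r; exact: linZ.
split=> /=.
- by rewrite rmorph1; exact: csa1.
- move=> c x y hx hy; rewrite linearP /=; have [_ h] := csa_lin hL; exact: h.
- by move=> x y hx hy; rewrite rmorphM /=; exact: (csaM hL).
- by move=> x hx; rewrite parity_star; exact: (csa_star hL).
apply/norm_closedP => x hx /=; apply: csa_closed => // e e0.
have [b hb xb] := hx e e0; exists (Theta b) => //.
by rewrite -raddfB; apply: le_lt_trans (parity_contractive _) xb.
Qed.

Definition half : R[i] := (2^-1)%:C.
Definition evenp (a : A) : A := half *: (a + Theta a).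
Definition oddp (a : A) : A := half *: (a - Theta a).

Lemma halfE : (2^-1 : R[i]) = half.
Proof. by rewrite /half fmorphV rmorph_nat. Qed.

Lemma even_partE a : even_part Theta a = evenp a.
Proof. by rewrite /even_part halfE. Qed.

Lemma even_odd a : a = evenp a + oddp a.
Proof. by rewrite /evenp /oddp -scalerDr addrACA subrr addr0 half2. Qed.

Lemma parity_even a : Theta (evenp a) = evenp a.
Proof. by rewrite /evenp linearZ /= raddfD /= parityK addrC. Qed.

Lemma parity_odd a : Theta (oddp a) = - oddp a.
Proof. by rewrite /oddp linearZ /= raddfB /= parityK -scalerN opprB. Qed.

Lemma evenp_id a : Theta a = a -> evenp a = a.
Proof. by rewrite /evenp => ->; exact: half2. Qed.

Lemma evenp_odd a : Theta a = - a -> evenp a = 0.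
Proof. by rewrite /evenp => ->; rewrite subrr scaler0. Qed.

Lemma local_even V a : linear_set V -> local_algebra B V a -> local_algebra B V (evenp a).
Proof.
move=> lV ha; have lL : linear_set (local_algebra B V) := csa_lin (csa_generated _).
exact: (linZ half lL (linD lL ha (parity_local lV ha))).
Qed.

Lemma local_odd V a : linear_set V -> local_algebra B V a -> local_algebra B V (oddp a).
Proof.
move=> lV ha; have lL : linear_set (local_algebra B V) := csa_lin (csa_generated _).
exact: (linZ half lL (linB lL ha (parity_local lV ha))).
Qed.

(** * Graded commutation of two regions *)

Section TwoRegions.
Variables (V W : set K).
Hypotheses (lV : linear_set V) (lW : linear_set W).
Hypotheses (JV : forall f, V f -> V (J f)) (JW : forall f, W f -> W (J f)).
Hypothesis VW_orth : forall v w, V v -> W w -> hdot v w = 0.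

Let AV := local_algebra B V.
Let AW := local_algebra B W.
Let hV : cstar_subalgebra AV := csa_generated _.
Let hW : cstar_subalgebra AW := csa_generated _.

Lemma B_anticommute v w : V v -> W w -> B v * B w = - (B w * B v).
Proof.
move=> Vv Ww; case: hCAR => hs hc _; case: J_conj => _ JJ _.
have := hc v (J w); rewrite hs JJ hdot_conj VW_orth//; last exact: JW.
by rewrite rmorph0 scale0r => /eqP; rewrite addr_eq0 => /eqP.
Qed.

(** Moving [B v] through a word of the other region costs one sign per letter, which is what [Theta]
    counts. *)
Lemma B_local P v : V v -> AW P -> B v * P = Theta P * B v.
Proof.
move=> Vv hP; move: v Vv; apply: (hP [set P | forall v, V v -> B v * P = Theta P * B v]); last first.
  by move=> _ [w Ww <-] v Vv /=; rewrite parity_B mulNr; exact: B_anticommute.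
case: hCAR => hs _ _; case: J_conj => _ JJ _; split=> /=.
- by move=> v _; rewrite rmorph1 mul1r mulr1.
- move=> c x y hx hy v Vv; rewrite mulrDr -scalerAr hx// hy// linearP /=.
  by rewrite mulrDl -scalerAl.
- by move=> x y hx hy v Vv; rewrite mulrA hx// -mulrA hy// rmorphM mulrA.
- move=> x hx v Vv.
  have e : x * B (J v) = B (J v) * Theta x.
    have := congr1 Theta (hx _ (JV Vv)).
    by rewrite !rmorphM /= parity_B parityK mulNr mulrN => /oppr_inj ->.
  have := congr1 (@star _ A) e; rewrite !starM hs JJ => ->.
  by rewrite parity_star.
apply/norm_closedP => x hx v Vv.
have /norm_closedP : norm_closed [set x | B v * x = Theta x * B v].
  apply: (norm_closed_eq (F := fun a => B v * a) (G := fun a => Theta a * B v)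
    (M := cn (B v)) (N := cn (B v))) => [a b|a b|a|a||]; rewrite ?cn_ge0//=.
  - by rewrite mulrBr.
  - by rewrite rmorphB /= mulrBl.
  - exact: cnM.
  - by apply: le_trans (cnM _ _) _; rewrite mulrC ler_wpM2l ?cn_ge0// parity_contractive.
by apply=> e e0; have [b hb xb] := hx e e0; exists b => //; exact: hb.
Qed.

(** Fixing the parity of [P] makes each relation multiplicative in [Q]. For adjoints the relation is
    applied to [star P], which has the parity of [P]. *)
Lemma local_commute Q P : AV Q -> AW P ->
  (Theta P = P -> Q * P = P * Q) /\ (Theta P = - P -> Q * P = P * Theta Q).
Proof.
move=> hQ hP; move: P hP.
apply: (hQ [set Q | forall P, AW P ->
  (Theta P = P -> Q * P = P * Q) /\ (Theta P = - P -> Q * P = P * Theta Q)]); last first.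
  move=> _ [v Vv <-] P hP /=; rewrite B_local//; split=> ->//.
  by rewrite parity_B mulNr mulrN.
split=> /=.
- by move=> P hP; rewrite rmorph1 mul1r mulr1.
- move=> c x y hx hy P hP; have [x1 x2] := hx P hP; have [y1 y2] := hy P hP.
  split=> h; rewrite mulrDl -scalerAl; first by rewrite x1// y1// mulrDr -scalerAr.
  by rewrite x2// y2// linearP /= mulrDr -scalerAr.
- move=> x y hx hy P hP; have [x1 x2] := hx P hP; have [y1 y2] := hy P hP.
  split=> h; rewrite -mulrA; first by rewrite y1// mulrA x1// mulrA.
  by rewrite y2// mulrA x2// rmorphM mulrA.
- move=> x hx P hP; have [x1 x2] := hx _ (csa_star hW hP).
  split=> h.
    have := x1; rewrite parity_star h => /(_ erefl) /(congr1 (@star _ A)).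
    by rewrite !starM starK => ->.
  have := x2; rewrite parity_star h starN => /(_ erefl) /(congr1 Theta).
  rewrite !rmorphM /= parityK parity_star h starN mulNr mulrN => /oppr_inj.
  by move=> /(congr1 (@star _ A)); rewrite !starM starK parity_star => <-.
apply/norm_closedP => x hx P hP.
have cl (th : A -> A) : {morph th : x y / x - y} -> (forall a, cn (th a) <= cn a) ->
    (forall y, (forall P, AW P -> (Theta P = P -> y * P = P * y) /\
      (Theta P = - P -> y * P = P * Theta y)) -> y * P = P * th y) -> x * P = P * th x.
  move=> thB thN hth; have /norm_closedP : norm_closed [set x | x * P = P * th x].
    apply: (norm_closed_eq (F := fun a => a * P) (G := fun a => P * th a)
      (M := cn P) (N := cn P)) => [a b|a b|a|a||]; rewrite ?cn_ge0//=.
    - by rewrite mulrBl.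
    - by rewrite thB mulrBr.
    - by rewrite mulrC; exact: cnM.
    - by apply: le_trans (cnM _ _) _; rewrite ler_wpM2l ?cn_ge0.
  by apply=> e e0; have [b hb xb] := hx e e0; exists b => //; exact: hth.
split=> h; first by apply: (cl id) => // y hy; case: (hy P hP) => h1 _; exact: h1.
apply: (cl Theta) => [a b|a|y hy]; [exact: rmorphB|exact: parity_contractive|].
by case: (hy P hP) => _ h2; exact: h2.
Qed.

Hypothesis VW_total : forall u, exists v w, [/\ V v, W w & u = v + w].

(** The closed linear span [D] of the products [Q * P] is a C*-subalgebra containing all [B f],
    because [swap] rewrites [P * Q] by products in the right order. It is defined as the smallest
    closed linear set containing them, so that its closure under the operations is itself proved by
    induction. *)
Lemma product_induction (T : set A) : linear_set T -> cclos T `<=` T ->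
  (forall Q P, AV Q -> AW P -> T (Q * P)) -> forall a, T a.
Proof.
move=> lT cT pT a; pose D := [set a | forall T : set A, linear_set T -> cclos T `<=` T ->
  (forall Q P, AV Q -> AW P -> T (Q * P)) -> T a].
suff : D a by apply.
have lD : linear_set D.
  split=> [T' lT' _ _|c x y hx hy T' lT' cT' pT']; first exact: lin0.
  by case: (lT') => _; apply; [exact: hx|exact: hy].
have cD : cclos D `<=` D.
  move=> x hx T' lT' cT' pT'; apply: (cT') => e e0; have [b hb xb] := hx e e0.
  by exists b => //; exact: hb.
have pD Q P : AV Q -> AW P -> D (Q * P) by move=> hQ hP T' _ _; apply.
have swap Q P : AV Q -> AW P -> P * Q = Q * evenp P + Theta Q * oddp P.
  move=> hQ hP; have hE := local_even lW hP; have hO := local_odd lW hP.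
  have [h1 _] := local_commute hQ hE; have [_ h2] := local_commute (parity_local lV hQ) hO.
  rewrite {1}(even_odd P) mulrDl -h1 ?parity_even//.
  by rewrite -[in X in _ + X](parityK Q) -h2 ?parity_odd// parityK.
have sub1 Q P : AV Q -> AW P -> forall b, D b -> D (Q * P * b).
  move=> hQ hP b hb; apply: (hb [set b | D (Q * P * b)]) => [|x hx /=|Q' P' hQ' hP' /=].
  - split=> [|c x y hx hy /=]; first by rewrite /= mulr0; exact: lin0.
    by rewrite mulrDr -scalerAr; case: lD => _; apply.
  - apply: cD => e e0; have [d d0 hd] := eps_scale (cn_ge0 (Q * P)) e0.
    have [y hy /hd xy] := hx d d0; exists (Q * P * y) => //.
    by rewrite -mulrBr; exact: le_lt_trans (cnM _ _) xy.
  - have -> : Q * P * (Q' * P') = (Q * Q') * (evenp P * P') + (Q * Theta Q') * (oddp P * P').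
      by rewrite mulrA -(mulrA Q) (swap Q' P hQ' hP) mulrDr mulrDl !mulrA.
    have tQ' := parity_local lV hQ'.
    have eP := local_even lW hP; have oP := local_odd lW hP.
    apply: (linD lD); first exact: (pD _ _ (csaM hV hQ hQ') (csaM hW eP hP')).
    exact: (pD _ _ (csaM hV hQ tQ') (csaM hW oP hP')).
apply: (CAR_induction (T := D)) => [|f].
  split.
  - by rewrite -[1]mulr1; apply: pD; [exact: csa1|exact: csa1].
  - by case: lD.
  - move=> x y hx hy; apply: (hx [set x | D (x * y)]) => [|z hz /=|Q P hQ hP /=]; last exact: sub1.
      split=> [|c u v hu hv /=]; first by rewrite /= mul0r; exact: lin0.
      by rewrite mulrDl -scalerAl; case: lD => _; apply.
    apply: cD => e e0; have [d d0 hd] := eps_scale (cn_ge0 y) e0.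
    have [u hu /hd xu] := hz d d0; exists (u * y) => //.
    by rewrite -mulrBl; apply: le_lt_trans (cnM _ _) _; rewrite mulrC.
  - move=> x hx; apply: (hx [set x | D (star x)]) => [|z hz /=|Q P hQ hP /=].
    + split=> [|c u v hu hv /=]; first by rewrite /= star0; exact: lin0.
      by rewrite starD starZ; case: lD => _; apply.
    + apply: cD => e e0; have [u hu zu] := hz e e0; exists (star u) => //.
      by rewrite -starB cn_star.
    + have sQ := csa_star hV hQ; have sP := csa_star hW hP.
      rewrite /= starM swap//; apply: (linD lD).
        exact: (pD _ _ sQ (local_even lW sP)).
      exact: (pD _ _ (parity_local lV sQ) (local_odd lW sP)).
  - exact/norm_closedP.
have [v [w [Vv Ww ->]]] := VW_total f; rewrite linearD; apply: (linD lD).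
  by rewrite -[B v]mulr1; apply: pD; [apply: gen_sub; exists v|exact: csa1].
by rewrite -[B w]mul1r; apply: pD; [exact: csa1|apply: gen_sub; exists w].
Qed.

Lemma odd_even_swap x q : AV x -> AW q ->
  x * q = evenp q * x + oddp q * Theta x.
Proof.
move=> hx hq; have eq := local_even lW hq; have oq := local_odd lW hq.
have [c1 _] := local_commute hx eq.
have [_ c2] := local_commute hx oq.
rewrite {1}(even_odd q) mulrDr (c1 (parity_even q)).
by rewrite (c2 (parity_odd q)).
Qed.

(** [N] is an abstract norm, so that one density argument serves for vectors and for scalars; the
    products are in the order [q * x] of the graded product. *)
Lemma kernel_induction (D : lmodType R[i]) (F : A -> D) (N : D -> R) (C : R) : 0 <= C ->
  (forall x, 0 <= N x) -> (forall x, N x = 0 -> x = 0) ->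
  (forall c a b, F (c *: a + b) = c *: F a + F b) -> (forall a, N (F a) <= C * cn a) ->
  (forall q x, AW q -> AV x -> F (q * x) = 0) -> forall a, F a = 0.
Proof.
move=> C0 N0 Neq0 Flin FC Fqx.
have FB : {morph F : x y / x - y}.
  move=> x y; have -> : x - y = (-1) *: y + x by rewrite scaleN1r addrC.
  by rewrite Flin scaleN1r addrC.
apply: (product_induction (T := [set a | F a = 0])).
- split=> [|c x y /= hx hy]; last by rewrite Flin hx hy scaler0 addr0.
  by have := FB 0 0; rewrite !subrr.
- by move=> x hx; apply: (closed_kernel (F := F) (N := N) (C := C) _ _ _ _ _ _ hx).
move=> x q hx hq /=; rewrite odd_even_swap// -[evenp _ * x]scale1r Flin !Fqx ?scaler0 ?addr0//.
- exact: (local_odd lW hq).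
- exact: (parity_local lV hx).
- exact: (local_even lW hq).
Qed.

(** After [odd_even_swap], an invariant [psi2] sees only the even part of [x] in both terms, and an
    invariant [psi1] discards the odd part of [q]. *)
Lemma graded_product_sym (psi1 psi2 phi : A -> R[i]) : state AW psi1 -> state AV psi2 ->
  graded_product Theta AW AV psi1 psi2 phi -> graded_product Theta AV AW psi2 psi1 phi.
Proof.
move=> s1 s2 [sphi inv h1 h2].
have swap x q : AV x -> AW q -> phi (x * q) = phi (evenp q * x) + phi (oddp q * Theta x).
  by move=> hx hq; rewrite odd_even_swap// (stateD sphi).
split=> //; first by case: inv; [right|left].
- move=> i2 x q hx hq; rewrite swap// !(h2 i2) ?even_partE//; last first.
  + exact: (local_even lW hq).
  + exact: (parity_local lV hx).
  + exact: (local_odd lW hq).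
  have e1 : evenp (Theta x) = evenp x by rewrite /evenp parityK addrC.
  have e2 : psi1 q = psi1 (evenp q) + psi1 (oddp q).
    rewrite {1}(even_odd q) (stateD s1)//; first exact: (local_even lW hq).
    exact: (local_odd lW hq).
  by rewrite e1 e2 -mulrDl mulrC.
- move=> i1 x q hx hq; rewrite swap// !(h1 i1) ?even_partE//; last first.
  + exact: (local_even lW hq).
  + exact: (parity_local lV hx).
  + exact: (local_odd lW hq).
  rewrite (evenp_odd (parity_odd q)) (state0 hW s1) mul0r addr0.
  by rewrite (evenp_id (parity_even q)) mulrC.
Qed.

(** * From type I to the split property *)

Section ParityUnitary.
Context {H : hilbertType R}.
Variables (pi : A -> H -> H) (G : H -> H).
Hypotheses (hpi : representation setT pi) (bG : bop G) (G2 : forall u, G (G u) = u)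
  (sG : forall u v, hdot (G u) v = hdot u (G v))
  (Gpi : forall a u, G (pi a u) = pi (Theta a) (G u)).

Let X := [set pi a | a in AV].
Let hpiV : representation AV pi := rep_sub AV hpi.
Let sX : star_closed X := rep_star_closed hV hpiV.
Let bX := star_closed_bop sX.
Let C := commutant X.

Lemma even_in_commutant q : AW q -> Theta q = q -> C (pi q).
Proof.
move=> hq eq; apply: (com_repP (rep_bop hpi I)) => a u ha.
have [c1 _] := local_commute ha hq.
by rewrite -!(repM hpi)// c1.
Qed.

Lemma odd_in_commutant q : AW q -> Theta q = - q -> C (pi q \o G).
Proof.
move=> hq oq; apply: com_repP; first exact: bop_comp bG (rep_bop hpi I).
move=> a u ha /=.
have [_ c2] := local_commute ha hq.
by rewrite Gpi -!(repM hpi)// c2.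
Qed.

Lemma parity_conj_commutant y : C y -> C (G \o y \o G).
Proof.
move=> hy; have by_ := commutant_bop hy.
apply: com_repP; first exact: bop_comp bG (bop_comp by_ bG).
move=> a u ha /=; rewrite Gpi (comm_app _ hy) ?Gpi ?parityK//.
by exists (Theta a) => //; exact: (parity_local lV ha).
Qed.

Lemma rep_intertwine_all (T : H -> H) : bop T ->
  (forall q x u, AW q -> AV x -> T (pi (q * x) u) = pi (q * x) (T u)) ->
  forall a u, T (pi a u) = pi a (T u).
Proof.
move=> bT h a u; apply/eqP; rewrite -subr_eq0; apply/eqP.
have [M M0 hM] := bop_bound bT.
apply: (kernel_induction (F := fun a => T (pi a u) - pi a (T u)) (N := @nrm R H)
  (C := M * nrm u + nrm (T u))).
- by rewrite addr_ge0 ?mulr_ge0 ?nrm_ge0// ltW.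
- exact: nrm_ge0.
- exact: nrm_eq0.
- move=> c b b'; rewrite !(rep_lin hpi)// (bopD _ _ bT) (bopZ _ _ bT) scalerBr opprD.
  by rewrite addrACA.
- move=> b; apply: le_trans (nrmB _ _) _; rewrite mulrDl; apply: lerD.
    apply: le_trans (hM _) _; rewrite -mulrA ler_wpM2l ?(ltW M0)// mulrC.
    exact: (rep_contractive csa_setT hpi).
  rewrite mulrC; exact: (rep_contractive csa_setT hpi).
- by move=> q x hq hx; rewrite h// subrr.
Qed.

(** [T] commutes with the even elements of the other algebra and with the odd ones composed with
    [G]. Commuting with [G] too, it commutes with the whole represented algebra. *)
Lemma graded_irreducible (T : H -> H) : irreducible [set pi a | a in setT] ->
  C T -> commutant C T -> (forall u, T (G u) = G (T u)) -> exists c : R[i], T = (fun u => c *: u).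
Proof.
move=> irr cT cT' GT; have bT := commutant_bop cT; apply: irr.
have Tq q u : AW q -> T (pi q u) = pi q (T u).
  move=> hq; rewrite (even_odd q).
  have eq := local_even lW hq; have oq := local_odd lW hq.
  have piD v : pi (evenp q + oddp q) v = pi (evenp q) v + pi (oddp q) v.
    by rewrite (repD hpi).
  rewrite !piD (bopD _ _ bT); congr (_ + _).
    by rewrite (comm_app _ cT')//; apply: even_in_commutant => //; exact: parity_even.
  have co := odd_in_commutant oq (parity_odd q).
  by have /= := comm_app (G u) cT' co; rewrite G2 GT G2.
apply: com_repP => // a u _; apply: rep_intertwine_all => // q x v hq hx.
by rewrite !(repM hpi)// Tq// (comm_app _ cT)//; exists x.
Qed.

Let sC : star_closed C := commutant_star sX.

Let even_C q : AW q -> Theta q = q -> C (pi q).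
Proof. exact: even_in_commutant. Qed.
Let odd_C q : AW q -> Theta q = - q -> C (pi q \o G).
Proof. exact: odd_in_commutant. Qed.
Let conj_C y : C y -> C (G \o y \o G).
Proof. exact: parity_conj_commutant. Qed.
Let C_pi y x u : C y -> AV x -> y (pi x u) = pi x (y u).
Proof. by move=> hy hx; apply: (comm_app u hy); exists x. Qed.

(** The factorization over the commutant covers the even elements of the other algebra; for the odd
    ones the vanishing is a separate condition. Both conditions are homogeneous in [w], so that [w]
    can be normalized. *)
Lemma graded_vector_normalize (w : H) : w <> 0 ->
  (forall x y, AV x -> C y -> hdot w (pi x (y w)) * hdot w w = hdot w (pi x w) * hdot w (y w)) ->
  (forall q x, AW q -> Theta q = - q -> AV x -> hdot w (pi q (pi x w)) = 0) ->
  exists2 w', nrm w' = 1 & forall q x, AW q -> AV x ->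
    hdot w' (pi (q * x) w') = hdot w' (pi (evenp q) w') * hdot w' (pi x w').
Proof.
move=> w0 ha hb; have nw := nrm_gt0 w0.
have nw2 : (nrm w ^+ 2)%:C != 0 :> R[i].
  by rewrite eq_complex /= eqxx andbT expf_neq0// gt_eqF.
pose c : R[i] := ((nrm w)^-1)%:C.
have cc : Num.conj c * c = ((nrm w ^+ 2)%:C)^-1.
  by rewrite /c conjr -fmorphV /= -rmorphM /= -expr2 exprVn.
exists (c *: w).
  by rewrite nrmZ nrmc_real ger0_norm ?invr_ge0 ?nrm_ge0// mulVf// gt_eqF.
have E a : hdot (c *: w) (pi a (c *: w)) = Num.conj c * c * hdot w (pi a w).
  by rewrite (bopZ _ _ (rep_bop hpi I)) hdotZl hdotZr mulrA.
move=> q x hq hx; rewrite !E cc.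
have hqe := local_even lW hq; have hqo := local_odd lW hq.
have e1 := ha x _ hx (even_C hqe (parity_even q)).
have e2 := hb _ _ hqo (parity_odd q) hx.
have -> : hdot w (pi (q * x) w) = hdot w (pi x (pi (evenp q) w)).
  rewrite {1}(even_odd q) mulrDl (repD hpi)// hdotDr !(repM hpi)// e2 addr0.
  by rewrite (C_pi _ (even_C hqe (parity_even q)) hx).
rewrite hdot_nrm in e1.
set h := hdot w (pi x (pi _ w)) in e1 *.
have -> : h = hdot w (pi x w) * hdot w (pi (evenp q) w) / (nrm w ^+ 2)%:C.
  by rewrite -e1 mulfK.
move: (((nrm w ^+ 2)%:C)^-1) => m; ring.
Qed.

Lemma graded_product_vector (v : H) (lam : A -> R[i]) : v <> 0 ->
  (forall a y, AV a -> C y -> hdot v (pi a (y v)) = lam a * hdot v (y v)) ->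
  exists2 w, nrm w = 1 & forall q x, AW q -> AV x ->
    hdot w (pi (q * x) w) = hdot w (pi (evenp q) w) * hdot w (pi x w).
Proof.
move=> v0 hv; pose E := orbit AV pi v; have cE : csub E := csub_orbit hV hpiV v.
pose P := pj E; have cP : C P := pj_orbit_com hV hpiV v.
have bP : bop P := bop_pj cE.
have Ev : E v := orbit_self hV hpiV v.
have Epi x u : AV x -> E u -> E (pi x u) := @orbit_inv _ _ _ hV _ _ hpiV v x u.
have scal y : C y -> exists c, forall u, E u -> P (y u) = c *: u.
  by move=> hy; exact: (product_vector_scalar hV hpiV v0 hv hy).
have prodE k x y c : E k -> AV x -> (forall u, E u -> P (y u) = c *: u) ->
    hdot k (pi x (y k)) = c * hdot k (pi x k).
  move=> Ek hx hc; have Ex : E (pi (star x) k) := Epi _ _ (csa_star hV hx) Ek.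
  rewrite !(rep_adjl hV hpiV)// -{1}(pj_id cE Ex) pj_sa// -/P hc//.
  by rewrite hdotZr.
(* Either [P y G P = 0] for all [y] in the commutant, and [v] is good enough, or a multiple
   of some [g = P y G] is a symmetry of [E]; then [k + s G k] works for an eigenvector [k]
   of [g] in [E] and a suitable sign [s]. *)
have [caseB|] := pselect (forall y u, C y -> E u -> P (y (G u)) = 0).
  apply: (graded_vector_normalize v0) => [x y hx hy|q x hq oq hx].
    have [c hc] := scal _ hy.
    have := prodE _ 1 _ _ Ev (csa1 hV) hc; rewrite !(rep1 hpi) => ->.
    by rewrite (prodE _ _ _ _ Ev hx hc); ring.
  have := caseB _ _ (odd_C hq oq) (Epi _ _ hx Ev); rewrite /= G2 => h0.
  by rewrite -{1}(pj_id cE Ev) pj_sa// -/P h0 hdot0r.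
move=> /existsNP [y0] /existsNP [u0] /not_implyP [hy0] /not_implyP [Eu0 gu0].
have by0 := commutant_bop hy0.
have [_ hy0'] := sC hy0; have by0' := bop_adj by0.
pose g u := P (y0 (G u)).
pose t0 := G \o (P \o y0) \o G.
have ht0 : C t0 by apply: conj_C; exact: commutant_comp.
(* On the orbit [E] the square of [g] is the scalar [al], and [g] multiplies squared norms by a
   constant [be]; since [g u0] is not [0], neither constant vanishes. *)
have [al hal] := scal _ (commutant_comp hy0 ht0).
have gg u : E u -> g (g u) = al *: u by move=> Eu; rewrite -hal.
have [be hbe] := scal _ (conj_C (commutant_comp hy0' (commutant_comp cP hy0))).
have gnorm u : E u -> hdot (g u) (g u) = be * hdot u u.
  move=> Eu; rewrite -hdotZr -hbe// -(pj_sa cE u) (pj_id cE Eu) /= -sG adjr//.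
  by rewrite /g (pj_sa cE) (pj_id cE (pj_in cE _)).
have be0 : be <> 0 by move=> b0; apply: gu0; apply: hdot_eq0; rewrite gnorm// b0 mul0r.
have Eg u : E (g u) by exact: pj_in.
have al0 : al <> 0.
  move=> a0; apply: gu0; apply: hdot_eq0.
  have := gnorm (g u0) (Eg u0); rewrite gg// a0 scale0r hdot0l => /esym /eqP.
  by rewrite mulf_eq0 => /orP[/eqP//|/eqP].
have bg : bop g by exact: bop_comp (bop_comp bG by0) bP.
pose z := sqrtC al; have z2 : z * z = al by rewrite -expr2 sqrtCK.
have z0 : z <> 0 by move=> h0; apply: al0; rewrite -z2 h0 mul0r.
(* Since [g^2 = z^2] on [E], the vector [z *: v + g v] is an eigenvector of [g] unless it vanishes,
   in which case [v] is one for [- z]. *)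
have [k [Ek k0] [z' z'0 gk]] : exists2 k, E k /\ k <> 0 & exists2 z' : R[i], z' <> 0 & g k = z' *: k.
  have [h0|h0] := pselect (z *: v + g v = 0).
    exists v => //; exists (- z); first by move=> /eqP; rewrite oppr_eq0 => /eqP.
    by apply/eqP; rewrite scaleNr -addr_eq0 addrC h0.
  exists (z *: v + g v).
    by split=> //; apply: (linD cE.1) => //; exact: linZ cE.1 Ev.
  exists z => //; rewrite (bopD _ _ bg) (bopZ _ _ bg) gg// scalerDr scalerA z2.
  by rewrite addrC.
have z'n : z' != 0 by apply/eqP.
(* On [k] the operator [G] acts like an element of the commutant, which brings [k + s G k] into the
   form [t k] with [t] in the commutant. *)
have Gk : G k = z'^-1 *: t0 k.
  have -> : t0 k = G (g k) by [].
  by rewrite gk (bopZ _ _ bG) scalerA mulVf// scale1r.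
(* [k + G k] and [k - G k] cannot both vanish. *)
have [s ss w0] : exists2 s : R[i], s * s = 1 /\ Num.conj s = s & k + s *: G k <> 0.
  have [h0|h0] := pselect (k + 1 *: G k = 0); last by exists 1; rewrite ?mulr1 ?rmorph1.
  exists (-1); first by rewrite mulrNN mulr1 rmorphN rmorph1.
  move=> h1; apply: k0; have := half2 k; have -> : k + k = (k + 1 *: G k) + (k + -1 *: G k).
    by rewrite scaleN1r scale1r addrACA subrr addr0.
  by rewrite h0 h1 addr0 scaler0.
have [s1 sr] := ss.
set w := k + s *: G k in w0.
pose t u := (s * z'^-1) *: t0 u + u.
have ht : C t by apply: commutant_lin => //; exact: commutant_id.
have wt : w = t k by rewrite /w /t Gk scalerA addrC.
have [bt ht'] := sC ht.
have Gw : G w = s *: w.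
  by rewrite /w (bopD _ _ bG) (bopZ _ _ bG) G2 scalerDr scalerA s1 scale1r addrC.
have wprod y : C y -> exists f, forall x, AV x -> hdot w (pi x (y w)) = f * hdot k (pi x k).
  move=> hy; have [f hf] := scal _ (commutant_comp ht' (commutant_comp hy ht)).
  exists f => x hx; rewrite -(prodE _ _ _ _ Ek hx hf) /= -(C_pi _ ht' hx) adjr//.
  by rewrite -wt.
have ha x y : AV x -> C y -> hdot w (pi x (y w)) * hdot w w = hdot w (pi x w) * hdot w (y w).
  move=> hx hy; have [f hf] := wprod y hy; have [f1 hf1] := wprod id (commutant_id X).
  have h1 := hf1 _ (csa1 hV); have h2 := hf _ (csa1 hV).
  rewrite !(rep1 hpi) in h1 h2; rewrite /= in h1.
  by rewrite hf// (hf1 x hx) h1 h2; ring.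
apply: (graded_vector_normalize w0 ha) => q x hq oq hx.
(* [w] is an eigenvector of [G] for a sign and [G] anticommutes with [pi q], so this expectation is
   its own negative. *)
have qw0 : hdot w (pi q w) = 0.
  have h : hdot w (pi q w) = hdot (G w) (pi q (G w)).
    by rewrite Gw (bopZ _ _ (rep_bop hpi I)) hdotZl hdotZr sr mulrA s1 mul1r.
  have h2 : hdot w (pi q w) = - hdot w (pi q w).
    transitivity (hdot w (pi ((-1) *: 1 * q) w)).
      by rewrite {1}h sG Gpi G2 oq -scalerAl mul1r scaleN1r.
    by rewrite (repM hpi)// (rep_scalar _ _ hpi) hdotZr mulN1r.
  have h3 : 2 * hdot w (pi q w) = 0 by rewrite mulr2n mulrDl mul1r {1}h2 addNr.
  by move/eqP: h3; rewrite mulf_eq0 pnatr_eq0 /= => /eqP.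
have tx : AV (Theta x) := parity_local lV hx.
(* Moving [pi x] to the left costs a twist by [Theta]; then [ha] applies with [pi q \o G] as the
   element of the commutant. *)
have e : pi q (pi x w) = s *: pi (Theta x) ((pi q \o G) w).
  rewrite -(C_pi _ (odd_C hq oq) tx) /= Gpi parityK Gw.
  rewrite !(bopZ _ _ (rep_bop hpi I)) scalerA s1 scale1r//.
have := ha _ _ tx (odd_C hq oq); rewrite /= Gw (bopZ _ _ (rep_bop hpi I)) [X in _ = _ * X]hdotZr qw0 mulr0 mulr0.
move=> /eqP; rewrite mulf_eq0 => /orP[/eqP h|/eqP /hdot_eq0 //].
rewrite e hdotZr /= Gw (bopZ _ _ (rep_bop hpi I)) h mulr0//.
Qed.

Hypothesis irr : irreducible [set pi a | a in setT].
Context {H1 : hilbertType R}.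
Variables (pi1 : A -> H1 -> H1) (J1 : H1 -> H).
Hypotheses (hpi1 : representation AV pi1) (bJ1 : bop J1)
  (J1pi : forall a u, AV a -> J1 (pi1 a u) = pi a (J1 u))
  (J1iso : forall u, adj J1 (J1 u) = u).

Let X1 := [set pi1 a | a in AV].
Let sX1 : star_closed X1 := rep_star_closed hV hpi1.
Let bX1 := star_closed_bop sX1.
Let M1 := vN_of AV pi1.

Lemma compress_commutant y : C y -> commutant X1 (adj J1 \o y \o J1).
Proof.
move=> hy; have by_ := commutant_bop hy.
apply: com_repP => [|a u ha /=]; first exact: bop_comp (bop_comp bJ1 by_) (bop_adj bJ1).
by rewrite J1pi// C_pi// (intertwiner_adj hV hpi1 hpiV).
Qed.

Lemma compress_dot u v x y : AV x -> C y ->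
  hdot (J1 u) (pi x (y (J1 v))) = hdot u (pi1 x ((adj J1 \o y \o J1) v)).
Proof.
by move=> hx hy; rewrite -adjr// (intertwiner_adj hV hpi1 hpiV).
Qed.

Lemma abelian_at_most_two e (n : nat) (q : nat -> H1 -> H1) : abelian_projection M1 e ->
  (forall i, (i < n)%N -> [/\ projection (q i), M1 (q i), q i <> cst 0
     & forall u, e (q i u) = q i u]) ->
  (forall i j, (i < j < n)%N -> forall u, q i (q j u) = 0) -> (n <= 2)%N.
Proof.
move=> [pe Me abe] hq qorth; rewrite leqNgt; apply/negP => n3.
have hq3 i : (i < 3)%N -> (i < n)%N by move=> i3; exact: leq_trans i3 n3.
have be := proj_bop pe.
have qq i j : (i < 3)%N -> (j < 3)%N -> i != j -> forall u, q i (q j u) = 0.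
  move=> i3 j3; have [pi_ _ _ _] := hq _ (hq3 _ i3); have [pj_ _ _ _] := hq _ (hq3 _ j3).
  rewrite neq_ltn => /orP[ij|ij] u; first by apply: qorth; rewrite ij hq3.
  apply: hdot_inj => w; rewrite hdot0r -!proj_sa// qorth ?hdot0l//.
  by rewrite ij hq3.
(* Commutativity of the compressions of [q i] and [x] to [e] moves [x] past [q i]: elements of [M1]
   do not connect orthogonal subprojections of [e]. *)
have qxq i j x u : (i < 3)%N -> (j < 3)%N -> i != j -> M1 x -> q i (x (q j u)) = 0.
  move=> i3 j3 ij Mx; have [pi_ Mi _ ei] := hq _ (hq3 _ i3); have [pj_ _ _ ej] := hq _ (hq3 _ j3).
  have /(congr1 (fun g => g (q j u))) /= := abe _ _ Mi Mx.
  rewrite !(proj_idem _ pe) !ej ei.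
  rewrite (proj_le_comm _ pe pi_ ei) qq// (bop0 be) (bop0 (commutant_bop Mx)) (bop0 be).
  by [].
pose D i := [set v | exists x y u, [/\ AV x, C y & v = pi x (y (J1 (q i u)))]].
(* [1 - pj (U i)] projects onto the closed span of the orbit of [J1 (q i H1)] under
   [pi(S)] and [pi(S)']; it is central, and these projections are mutually orthogonal. *)
pose U i := [set v | forall d, D i d -> hdot d v = 0].
have cU i : csub (U i) by exact: orthocomplement_csub.
have Cp i : C (pj (U i)).
  apply: pj_commutant => // _ v [a ha <-] hv _ [x [y [u [hx hy ->]]]].
  rewrite (rep_adjl hV hpiV)// -(repM hpi)//; apply: hv.
  by exists (star a * x), y, u; split=> //; apply: (csaM hV) => //; exact: (csa_star hV ha).
have C'p i : commutant C (pj (U i)).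
  apply: pj_commutant => // T v hT hv _ [x [y [u [hx hy ->]]]].
  have [bT hT'] := sC hT; rewrite -adjl//; apply: hv.
  by exists x, (adj T \o y), u; split=> //; [exact: commutant_comp|rewrite /= C_pi].
have DU i j v : (i < 3)%N -> (j < 3)%N -> i != j -> D i v -> U j v.
  move=> i3 j3 ij [x [y [u [hx hy ->]]]] _ [x' [y' [u' [hx' hy' ->]]]].
  have [by' hy'a] := sC hy'.
  rewrite (rep_adj hpi)// -(repM hpi)//; have hxx : AV (star x' * x).
    by apply: (csaM hV) => //; exact: (csa_star hV hx').
  rewrite -adjr// (C_pi _ hy'a)// -/((adj y' \o y) (J1 (q i u))).
  have hyy := commutant_comp hy'a hy.
  have [pi_ Mi _ _] := hq _ (hq3 _ i3); have [pj_ Mj _ _] := hq _ (hq3 _ j3).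
  rewrite compress_dot// -(comm_app u Mi (compress_commutant hyy)) proj_sa//.
  rewrite qxq ?hdot0r//; first by rewrite eq_sym.
  by apply: bicommutant_sub => //; exists (star x' * x).
pose z i u := u - pj (U i) u.
have bp i : bop (pj (U i)) := bop_pj (cU i).
apply: (@no_three_projections _ _ G z bG G2) => [i|i i3|i j u i3 j3 ij].
- by apply: bop_sub => //; exact: bop_id.
- split.
  + move=> u; rewrite /z (bopB _ _ (bp i)) (pj_id (cU i) (pj_in (cU i) _)) subrr subr0//.
  + have [_ _ /proj_neq0 [u qu] _] := hq _ (hq3 _ i3); exists (J1 (q i u)).
    rewrite /z => h; apply: qu; rewrite -(J1iso (q i u)).
    suff -> : J1 (q i u) = 0 by rewrite (bop0 (bop_adj bJ1)).
    apply: hdot_eq0; have : U i (J1 (q i u)).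
      have hh := pj_in (cU i) (J1 (q i u)).
      by move/eqP: h; rewrite subr_eq0 => /eqP h; rewrite -h in hh.
    apply; exists 1, id, u; split; [exact: (csa1 hV)|exact: commutant_id|].
    by rewrite (rep1 hpi).
  (* The sum of [pj (U i)] and its conjugate by [G] lies in both commutants and commutes with [G],
     so it is a scalar [c]; for [z i = 1 - pj (U i)] the scalar is [2 - c]. *)
  + have [||u|c hc] := graded_irreducible (T := fun u => pj (U i) u + G (pj (U i) (G u))) irr.
    * exact: (commutant_add bX (Cp i) (conj_C (Cp i))).
    * apply: (commutant_add (@commutant_bops _ _ _) (C'p i)).
      apply: commutantP => [|y u hy /=]; first exact: bop_comp bG (bop_comp (bp i) bG).
      have := comm_app (G u) (C'p i) (conj_C hy); rewrite /= G2 => ->.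
      by rewrite G2.
    * by rewrite (bopD _ _ bG) !G2 addrC.
    exists (2 - c) => u; have /(congr1 (fun g => g u)) /= h := hc.
    rewrite /z (bopB _ _ bG) G2 addrACA -opprD h scalerBl -[2]/(1 + 1) scalerDl.
    by rewrite !scale1r.
- rewrite {1}/z pj_id ?subrr// => d Dd.
  exact: (pj_orth (cU j) u (DU _ _ _ i3 j3 ij Dd)).
Qed.

(** [adj J1 \o y \o J1] commutes with the minimal projection [d], and [d] compresses [pi1 a] to
    [lam a]; so [J1 (d v1)] is a product vector for [AV] and its commutant. *)
Lemma type_one_graded_vector e : abelian_projection M1 e -> e <> cst 0 ->
  exists2 w, nrm w = 1 & forall q x, AW q -> AV x ->
    hdot w (pi (q * x) w) = hdot w (pi (evenp q) w) * hdot w (pi x w).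
Proof.
move=> abe e0; have [pe Me _] := abe.
have [|d [md _]] := minimal_projection_exists sX1 (N := 2) pe Me e0.
  by move=> n q h1 h2; exact: abelian_at_most_two abe h1 h2.
have [pd Md d0 _] := md.
have sc a : exists c : R[i], AV a -> forall u, d (pi1 a (d u)) = c *: d u.
  have [ha|na] := pselect (AV a); last by exists 0.
  have [|c hc] := minimal_scalar sX1 (x := pi1 a) md; last by exists c.
  by apply: bicommutant_sub => //; exists a.
have [lam hlam] := choice sc.
have [v1 dv] := proj_neq0 d0.
apply: (graded_product_vector
  (v := J1 (d v1)) (lam := lam)).
  by move=> h; apply: dv; rewrite -(J1iso (d v1)) h (bop0 (bop_adj bJ1)).
move=> a y ha hy; have hk := compress_commutant hy; set k := _ \o J1 in hk.
have -> : hdot (J1 (d v1)) (y (J1 (d v1))) = hdot (d v1) (d (k v1)).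
  by rewrite (comm_app v1 Md hk) /k /= adjr.
have := compress_dot (d v1) (d v1) ha hy; rewrite -/k => ->.
rewrite -(comm_app v1 Md hk) proj_sa// hlam// hdotZr.
by rewrite (proj_sa v1)// proj_idem.
Qed.

End ParityUnitary.

Lemma split_property_sym psi : split_property Theta AW AV psi -> split_property Theta AV AW psi.
Proof.
move=> [psi1 [psi2 [phi [s1 s2 gp qe]]]]; exists psi2, psi1, phi; split=> //.
exact: (graded_product_sym s1 s2 gp).
Qed.

(** Setting [x = 1] shows that on [AW] the state depends only on even parts, hence is invariant
    there. *)
Lemma graded_product_of_vector (phi : A -> R[i]) : state setT phi ->
  (forall q x, AW q -> AV x -> phi (q * x) = phi (evenp q) * phi x) ->
  graded_product Theta AW AV phi phi phi.
Proof.
move=> sphi hphi; have phiE q : AW q -> phi (evenp q) = phi q.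
  by move=> hq; have := hphi q 1 hq (csa1 hV); rewrite mulr1 (state1 sphi) mulr1.
split=> //.
- left=> q hq; rewrite -phiE; last exact: (parity_local lW hq).
  by rewrite -[RHS]phiE// /evenp parityK addrC.
- by move=> _ q x hq hx; rewrite even_partE hphi.
move=> inv q x hq hx; rewrite hphi// phiE// even_partE; congr (_ * _).
rewrite /evenp (stateZ csa_setT sphi)// (stateD sphi)// inv// -halfE.
by field.
Qed.

Lemma irreducible_cyclic {H : hilbertType R} (pi : A -> H -> H) (w : H) :
  representation setT pi -> irreducible [set pi a | a in setT] -> w <> 0 ->
  dense [set pi a w | a in setT].
Proof.
move=> hpi irr w0; have cO := csub_orbit csa_setT hpi w.
have [c hc] := irr _ (pj_orbit_com csa_setT hpi w).
have pw := pj_id cO (orbit_self csa_setT hpi w).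
have /(congr1 (fun g => g w)) /= := hc; rewrite pw => /eqP.
rewrite -{1}[w]scale1r -subr_eq0 -scalerBl scaler_eq0 subr_eq0 => /orP[|/eqP//] /eqP c1.
apply/dense_clos => u; have := pj_in cO u.
by rewrite hc -c1 scale1r.
Qed.

Lemma type_I_split psi : pure_state psi -> invariant_state Theta setT psi ->
  type_I_state AV psi -> split_property Theta AW AV psi.
Proof.
move=> psi_pure psi_inv [H1 [pi1 [Om1 [hG1 tI]]]].
have hpsi := psi_pure.1; have hpi1 := GNS_rep hG1.
have [H [pi [Om hG]]] := GNS_exists csa_setT hpsi; have hpi := GNS_rep hG.
have [G [bG G2 sG Gpi _]] := parity_unitary hG parity_star parityK psi_inv.
have irr := pure_irreducible psi_pure hG.
have hpiV := rep_sub AV hpi.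
have [|J1 [bJ1 J1pi J1O J1a _]] := state_isometry hV hpi1 hpiV (w1 := Om1) (w2 := Om).
  by move=> a ha; rewrite (GNS_state hG1)// (GNS_state hG).
have J1iso u : adj J1 (J1 u) = u.
  rewrite -[adj J1 (J1 u)]/((adj J1 \o J1) u).
  rewrite (GNS_ext hG1 (T' := id) (bop_comp bJ1 (bop_adj bJ1)) bop_id)// => a ha /=.
  by rewrite J1pi// J1O (intertwiner_adj hV hpi1 hpiV bJ1 J1pi)// J1a.
have nO := GNS_nrm hV hG1 (state_sub AV hpsi).
have [||||e [abe e0 _]] := tI id.
- by split=> //; apply/bounded_opP; exact: bop_id.
- exact: commutant_id.
- exact: commutant_id.
- by move=> /(congr1 (fun g => nrm (g Om1))) /=; rewrite nO nrm0 => /eqP; rewrite oner_eq0.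
have [w nw hw] := type_one_graded_vector hpi bG G2 sG Gpi irr hpi1 bJ1 J1pi J1iso abe e0.
pose phi a := hdot w (pi a w); have sphi : state setT phi := rep_state csa_setT hpi nw.
exists phi, phi, phi; split; [exact: state_sub|exact: state_sub| |].
  exact: graded_product_of_vector.
exists H, H, pi, pi, Om, w; split=> //.
  split=> //; apply: irreducible_cyclic => // w0.
  by move/eqP: nw; rewrite w0 nrm0 eq_sym oner_eq0.
(* Both vectors are cyclic for the same representation, so the identity serves as the
   isomorphism. *)
exists id; split=> //.
by split=> [x //|x y _ _|x hx] //; exists x.
Qed.

(** * From the split property to type I *)

Definition normal_rep (Hs H : hilbertType R) (pis : A -> Hs -> Hs) (rho : A -> H -> H)
    (tau : (Hs -> Hs) -> (H -> H)) : Prop :=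
  [/\ representation setT rho, forall a, tau (pis a) = rho a,
      forall x y, bop x -> bop y -> tau (x \o y) = tau x \o tau y,
      forall x, bop x -> vN_of setT rho (tau x)
    & forall x y, bop x -> bop y -> adjoint_pair x y -> adjoint_pair (tau x) (tau y)].

(** The GNS representation of [psi] is irreducible, so every bounded operator lies in its von
    Neumann algebra, [tau] applies to [G], and [g = tau G] implements the parity where [phi] lives.
    The average of [phi] and [phi \o Theta] is then the vector state of [(Omf, g Omf)], divided by
    the root of 2, in the doubled representation. It factorizes over arbitrary elements, without
    even parts. The clause on [tau x] is the injectivity of [tau], tested on the orbit of [Om]. *)
Lemma split_model psi : pure_state psi -> invariant_state Theta setT psi ->
  split_property Theta AW AV psi ->
  exists (Hs H : hilbertType R) (pis : A -> Hs -> Hs) (Oms : Hs) (rho : A -> H -> H)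
    (tau : (Hs -> Hs) -> (H -> H)) (Om : H),
    [/\ GNS setT psi pis Oms, normal_rep pis rho tau,
      forall x, bop x -> (forall a, tau x (rho a Om) = 0) -> x = cst 0,
      nrm Om = 1 /\ (forall a, hdot Om (rho (Theta a) Om) = hdot Om (rho a Om))
    & forall q x, AW q -> AV x ->
        hdot Om (rho (q * x) Om) = hdot Om (rho q Om) * hdot Om (rho x Om)].
Proof.
move=> psi_pure psi_inv [psi1 [psi2 [phi [s1 s2 [sphi inv gp1 gp2]]]]].
move=> [Hs [Hf [pis [pif [Oms [Omf [Gs Gf [tau [tbij tlin tmul tadj tpi]]]]]]]]].
have hpis := GNS_rep Gs; have hpif := GNS_rep Gf.
have irr := pure_irreducible psi_pure Gs.
have allM x : bop x -> vN_of setT pis x by exact: irreducible_bicommutant.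
have [tfun tinj _] := tbij.
have tM x : bop x -> vN_of setT pif (tau x) by move=> /allM; exact: tfun.
have [G [bG G2 sG Gpi _]] := parity_unitary Gs parity_star parityK psi_inv.
pose g := tau G; have bg : bop g := commutant_bop (tM _ bG).
have bpis a : bop (pis a) by exact: (rep_bop hpis I).
have tau1 : tau id = id.
  have -> : id = pis 1 by apply/funext => u; rewrite (rep1 hpis).
  by rewrite tpi//; apply/funext => u; rewrite (rep1 hpif).
have g2 u : g (g u) = u.
  have -> : g (g u) = (tau G \o tau G) u by [].
  rewrite -tmul; [|exact: allM|exact: allM].
  by have -> : G \o G = id; [apply/funext => v /=; rewrite G2|rewrite tau1].
have gpi a u : g (pif a u) = pif (Theta a) (g u).
  have -> : g (pif a u) = (tau G \o tau (pis a)) u by rewrite tpi.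
  rewrite -tmul; [|exact: allM|exact: allM].
  have -> : G \o pis a = pis (Theta a) \o G by apply/funext => v /=; rewrite Gpi.
  by rewrite tmul ?tpi//; exact: allM.
have sg u v : hdot (g u) v = hdot u (g v).
  by apply: (tadj G G (allM _ bG) (allM _ bG)) => ? ?; exact: sG.
pose r : R := (Num.sqrt 2)^-1; pose c : R[i] := r%:C.
have cc : Num.conj c * c = half.
  by rewrite /c conjr -rmorphM /= -expr2 /r exprVn sqr_sqrtr.
pose Om : dsum Hf := c *: ((Omf, g Omf) : dsum Hf).
pose rho a : dsum Hf -> dsum Hf := diag (pif a).
have val a : hdot Om (rho a Om) = half * (phi a + phi (Theta a)).
  have bd : bop (rho a) by apply: bop_diag; exact: (rep_bop hpif I).
  rewrite /Om (bopZ _ _ bd) hdotZl hdotZr mulrA cc dsumE /= (GNS_state Gf)//.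
  by rewrite sg gpi g2 (GNS_state Gf).
have phi1 : phi 1 = 1 := state1 sphi.
have mul1 q : AW q -> phi q = phi (q * 1) by rewrite mulr1.
have mul2 x : AV x -> phi x = phi (1 * x) by rewrite mul1r.
exists Hs, (dsum Hf), pis, Oms, rho, (fun x => diag (tau x)), Om; split=> //.
- split.
  + split.
    * by move=> a _; apply/bounded_opP/bop_diag; exact: (rep_bop hpif I).
    * move=> d a b _ _; apply/funext => u; rewrite /rho /diag /=.
      by rewrite !(rep_lin hpif).
    * by move=> a b _ _; apply/funext => u; rewrite /rho /diag /= !(repM hpif).
    * by apply/funext => -[u v]; rewrite /rho /diag /= !(rep1 hpif).
    * move=> a _ u v; rewrite !dsumE /= !(rep_adj hpif)//.
  + by move=> a; rewrite tpi.
  + by move=> x y hx hy; rewrite tmul//; exact: allM.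
  + move=> x hx; have := bicommutant_diag (rep_bops csa_setT hpif) (tM _ hx).
    by rewrite image_comp.
  + move=> x y hx hy xy u v; have txy := tadj _ _ (allM _ hx) (allM _ hy) xy.
    by rewrite !dsumE /= !txy.
- move=> x hx h0.
  have t0 : tau (cst 0) = cst 0.
    have h := tlin 1 (cst 0) (cst 0) (allM _ bop_cst0) (allM _ bop_cst0).
    have e : (fun u => 1 *: (cst 0 : Hs -> Hs) u + (cst 0 : Hs -> Hs) u) = cst 0.
      by apply/funext => u /=; rewrite scaler0 addr0.
    rewrite e in h; apply/funext => u.
    by have /(congr1 (fun k => k u)) /= := h; rewrite scale1r => /addr_fix0.
  apply: tinj; [exact/mem_set/allM|exact/mem_set/allM/bop_cst0|].
  rewrite t0; apply: (GNS_ext Gf); [exact: commutant_bop (tM _ hx)|exact: bop_cst0|].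
  move=> a _; have btx : bop (tau x) := commutant_bop (tM _ hx).
  have := congr1 (fun u : dsum Hf => u.1) (h0 a).
  rewrite /= (bopZ _ _ (rep_bop hpif I)) (bopZ _ _ btx) => /eqP.
  rewrite scaler_eq0 => /orP[/eqP c0|/eqP//].
  have := cc; rewrite c0 mulr0 => /esym /eqP.
  by rewrite eq_complex /= invr_eq0 pnatr_eq0.
- split.
    apply/eqP; rewrite -(eqrXn2 (n := 2)) ?nrm_ge0// expr1n; apply/eqP.
    have := val 1; rewrite rmorph1 phi1.
    have -> : rho 1 Om = Om by rewrite /rho /diag /= !(rep1 hpif).
    rewrite hdot_nrm => /(congr1 (@complex.Re R)) /= ->.
    by field.
  by move=> a; rewrite !val parityK addrC.
move=> q x hq hx; rewrite !val rmorphM.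
have tq := parity_local lW hq; have tx := parity_local lV hx.
have o1 : AW 1 := csa1 hW; have o2 : AV 1 := csa1 hV.
have ev a : even_part Theta (Theta a) = even_part Theta a by rewrite /even_part parityK addrC.
have ev1 : even_part Theta 1 = 1 by rewrite even_partE evenp_id// rmorph1.
rewrite (mul1 q)// (mul1 (Theta q))// (mul2 x)// (mul2 (Theta x))//.
have p1 := state1 s1; have p2 := state1 s2.
case: inv => inv.
  rewrite !(gp1 inv)// !ev ev1 p1 p2 -halfE.
  by field.
rewrite !(gp2 inv)// !ev ev1 p1 p2 -halfE.
by field.
Qed.

Section Model.
Context {H HR : hilbertType R}.
Variables (rho : A -> H -> H) (Om : H) (piR : A -> HR -> HR) (OmR : HR) (Vm : HR -> H).
Hypotheses (hrho : representation setT rho)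
  (hinv : forall a, hdot Om (rho (Theta a) Om) = hdot Om (rho a Om))
  (hprod : forall q x, AW q -> AV x ->
        hdot Om (rho (q * x) Om) = hdot Om (rho q Om) * hdot Om (rho x Om)).
Let phi a := hdot Om (rho a Om).
Hypotheses (hGR : GNS AV phi piR OmR) (bV : bop Vm)
  (Vpi : forall a u, AV a -> Vm (piR a u) = rho a (Vm u)) (VO : Vm OmR = Om)
  (VV : forall u, adj Vm (Vm u) = u).
Let hpiR := GNS_rep hGR.

(** The other algebra compresses to scalars on the GNS space of [AV]: in [phi (star x * (q * y))]
    the even part of [q] moves past [star x], and the odd part does not contribute because [phi] is
    invariant. *)
Lemma product_isometry q u v : AW q -> hdot (Vm u) (rho q (Vm v)) = phi q * hdot u v.
Proof.
move=> hq; have bq := rep_bop hrho (a := q) I.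
have phiD a b : phi (a + b) = phi a + phi b by rewrite /phi (repD hrho)// hdotDr.
have phiN a : phi (- a) = - phi a.
  have := phiD a (- a); rewrite subrr => /eqP.
  have -> : phi 0 = 0 by apply: addr_fix0; rewrite -phiD addr0.
  by rewrite eq_sym addrC addr_eq0 => /eqP.
have phiM a b : AW a -> AV b -> phi (a * b) = phi a * phi b by exact: hprod.
have phi_odd a : Theta a = - a -> phi a = 0.
  move=> oa; have := hinv a; rewrite -/(phi _) -/(phi a) oa phiN => /eqP.
  rewrite eq_sym -addr_eq0 -mulr2n mulrn_eq0 /= => /eqP//.
have elem x y : AV x -> AV y -> phi (star x * (q * y)) = phi q * phi (star x * y).
  move=> hx hy; have sx := csa_star hV hx.
  have eq := local_even lW hq; have oq := local_odd lW hq.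
  rewrite [star x * (q * y)]mulrA (odd_even_swap sx hq) mulrDl phiD -!mulrA.
  rewrite (phiM _ _ eq (csaM hV sx hy)) (phiM _ _ oq (csaM hV (parity_local lV sx) hy)).
  rewrite (phi_odd _ (parity_odd q)) mul0r addr0.
  by rewrite [in RHS](even_odd q) phiD (phi_odd _ (parity_odd q)) addr0.
suff e : adj Vm \o rho q \o Vm = (fun u => phi q *: u).
  by rewrite -adjr// -[X in hdot u X]/((adj Vm \o rho q \o Vm) v) e hdotZr.
apply: (GNS_ext hGR).
- exact: bop_comp (bop_comp bV bq) (bop_adj bV).
- by apply: bop_scale; exact: bop_id.
move=> y hy; apply: hdot_inj => w.
apply/eqP; rewrite -subr_eq0 -hdotBr; apply/eqP/hdot_sym0.
apply: clos_orth (GNS_orbit hGR w) => _ [x hx <-].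
apply: hdot_sym0.
rewrite hdotBr hdotZr /= adjr// !Vpi// VO (rep_adj hrho)// -!(repM hrho)//.
rewrite -/(phi _) -mulrA elem// (rep_adj hpiR)// -(repM hpiR)//; last exact: (csa_star hV hx).
rewrite (GNS_state hGR) ?subrr//.
by apply: (csaM hV) => //; exact: (csa_star hV hx).
Qed.

End Model.

(** The twist is the identity or [Theta] according to the parity of [Q]. With it, multiplication by
    [Q] intertwines the twisted and the original action of [AV]. *)
Lemma homogeneous_twist {HR : hilbertType R} (piR : A -> HR -> HR) Q :
  representation AV piR -> AW Q -> Theta Q = Q \/ Theta Q = - Q ->
  exists th : A -> A, [/\ forall x, AV x -> AV (th x), forall x, AV x -> x * Q = Q * th x
    & representation AV (piR \o th)].
Proof.
move=> hR hQ [eQ|oQ]; have hc x hx := local_commute (Q := x) hx hQ.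
  by exists id; split=> // x hx; case: (hc x hx) => c _; exact: c.
have hT x : AV x -> AV (Theta x) := parity_local lV (a := x).
exists Theta; split=> // [x hx|]; first by case: (hc x hx) => _ c; exact: c.
exact: (rep_twist (S := AV) parity_star hT hR).
Qed.

Section NormalRep.
Context {Hs H : hilbertType R}.
Variables (pis : A -> Hs -> Hs) (rho : A -> H -> H) (tau : (Hs -> Hs) -> (H -> H)).
Hypotheses (hpis : representation setT pis) (hn : normal_rep pis rho tau).

Lemma normal_rank_one_sa (ze : Hs) u v :
  hdot (tau (rank_one ze) u) v = hdot u (tau (rank_one ze) v).
Proof.
have [_ _ _ _ tadj] := hn; have bp := bop_rank_one ze.
by apply: (tadj _ _ bp bp) => u' v'; exact: rank_one_sa.
Qed.

(** For the rank one operator [p] of [ze], compressing [pis (star a * a)] by [p] gives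
    [|pis a ze|^2] times [p], and [tau] transports this identity. It is the source of the domination
    by [|x z Om1|]. *)
Lemma normal_rank_one_nrm (ze : Hs) a v :
  nrm (rho a (tau (rank_one ze) v)) ^+ 2 =
  nrm (pis a ze) ^+ 2 * complex.Re (hdot v (tau (rank_one ze) v)).
Proof.
have [hrho tpi tmul _ _] := hn; have bp := bop_rank_one ze; set p := rank_one ze in bp *.
have bpis x : bop (pis x) by exact: (rep_bop hpis I).
have e : p \o (pis (star a * a) \o p) = pis ((nrm (pis a ze) ^+ 2)%:C *: 1) \o p.
  apply/funext => u; rewrite /= (rep_scalar _ _ hpis) /p /rank_one (bopZ _ _ (bpis _)) hdotZr.
  by rewrite (repM hpis)// -(rep_adj hpis)// hdot_nrm scalerA mulrC.
rewrite nrm_sqr (rep_adj hrho)// normal_rank_one_sa -(repM hrho)//.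
have -> : tau p (rho (star a * a) (tau p v)) = (tau p \o (tau (pis (star a * a)) \o tau p)) v.
  by rewrite tpi.
rewrite -tmul// -tmul//; last exact: bop_comp.
rewrite e tmul// tpi /= (rep_scalar _ _ hrho) hdotZr ReZ//.
Qed.

End NormalRep.

Lemma split_type_I psi : pure_state psi -> invariant_state Theta setT psi ->
  split_property Theta AW AV psi -> type_I_state AV psi.
Proof.
move=> psi_pure psi_inv hsplit; have hpsi := psi_pure.1.
have [Hs [H [pis [Oms [rho [tau [Om]]]]]]] := split_model psi_pure psi_inv hsplit.
move=> [Gs hn tnz [nOm hinv] hprod]; have hpis := GNS_rep Gs.
have [hrho tpi _ tM _] := hn; have hrhoV := rep_sub AV hrho.
have hphi : state AV (fun a => hdot Om (rho a Om)) := rep_state hV hrhoV nOm.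
have [HR [piR [OmR GR]]] := GNS_exists hV hphi; have hpiR := GNS_rep GR.
have [|Vm [bVm Vpi VO Va _]] := state_isometry hV hpiR hrhoV (w1 := OmR) (w2 := Om).
  by move=> a ha; rewrite (GNS_state GR).
have VV u : adj Vm (Vm u) = u.
  exact: (GNS_isometry hV GR hrhoV bVm Vpi VO Va).
have [H1 [pi1 [Om1 G1]]] := GNS_exists hV (state_sub AV hpsi); have hpi1 := GNS_rep G1.
have hpisV := rep_sub AV hpis.
have [|J1 [bJ1 J1pi J1O J1a J1n]] := state_isometry hV hpi1 hpisV (w1 := Om1) (w2 := Oms).
  by move=> a ha; rewrite (GNS_state G1)// (GNS_state Gs).
have J1iso u : adj J1 (J1 u) = u.
  exact: (GNS_isometry hV G1 hpisV bJ1 J1pi J1O J1a).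
exists H1, pi1, Om1; split=> // z pz Mz cMz z0.
have sX1 := rep_star_closed hV hpi1; have bX1 := star_closed_bop sX1.
have cz : commutant [set pi1 a | a in AV] z by rewrite -tricommutant.
pose w1 := z Om1.
have w10 : w1 <> 0.
  move=> w0; apply: z0; apply: (GNS_ext G1); [exact: proj_bop|exact: bop_cst0|].
  by move=> a ha; rewrite (com_rep _ cz)// -/w1 w0 (bop0 (rep_bop hpi1 ha)).
pose ze := J1 w1; pose p := rank_one ze; have bp := bop_rank_one ze.
have ze0 : ze <> 0 by move=> h; apply: w10; rewrite -(J1iso w1) -/ze h (bop0 (bop_adj bJ1)).
have nze := nrm_gt0 ze0.
pose P := tau p; have hP : vN_of setT rho P := tM _ bp; have bP := commutant_bop hP.
have sP : forall u v, hdot (P u) v = hdot u (P v) := normal_rank_one_sa hn ze.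
have nP := normal_rank_one_nrm hpis hn ze; rewrite -/p -/P in nP.
(* If all these vectors vanished, [P] would kill every [rho (q * x) Om], hence the orbit of [Om],
   and [p] would be [0]. *)
have [Q [hQ QQ [b Pb]]] : exists Q, [/\ AW Q, Theta Q = Q \/ Theta Q = - Q
    & exists b, P (rho Q (Vm b)) <> 0].
  apply: contrapT => nQ.
  have hom Q b : AW Q -> Theta Q = Q \/ Theta Q = - Q -> P (rho Q (Vm b)) = 0.
    by move=> hQ hh; apply: contrapT => h; apply: nQ; exists Q; split=> //; exists b.
  have p0 : p = cst 0.
    apply: (tnz _ bp); have [M M0 hM] := bop_bound bP.
    apply: (kernel_induction (N := @nrm R H)
      (F := fun a => P (rho a Om))
      (C := M * nrm Om)).
    - by rewrite mulr_ge0 ?nrm_ge0 ?(ltW M0).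
    - exact: nrm_ge0.
    - exact: nrm_eq0.
    - by move=> c a b; rewrite (rep_lin hrho)// (bopD _ _ bP) (bopZ _ _ bP).
    - move=> a; apply: le_trans (hM _) _; rewrite -mulrA ler_wpM2l ?(ltW M0)// mulrC.
      exact: (rep_contractive csa_setT hrho).
    - move=> q x hq hx; rewrite (repM hrho)// -VO -Vpi// (even_odd q) (repD hrho)//.
      rewrite (bopD _ _ bP) !hom ?addr0//.
      + exact: (local_odd lW hq).
      + by right; exact: (parity_odd).
      + exact: (local_even lW hq).
      + by left; exact: parity_even.
  have /(congr1 (fun g => g ze)) /= := p0; rewrite /p /rank_one => /eqP.
  by rewrite scaler_eq0 => /orP[/eqP /hdot_eq0|/eqP].
have [th [hth Qth hpi2]] := homogeneous_twist hpiR hQ QQ.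
set pi2 := piR \o th in hpi2.
have bQ := rep_bop hrho (a := Q) I.
pose Y := rho Q \o Vm; have bY : bop Y := bop_comp bVm bQ.
have Ypi a u : AV a -> Y (pi2 a u) = rho a (Y u).
  move=> ha; rewrite /Y /pi2 /= Vpi; last exact: hth.
  by rewrite -!(repM hrho)// Qth.
have hiso q u v : AW q -> hdot (Vm u) (rho q (Vm v)) = hdot Om (rho q Om) * hdot u v.
  exact: (product_isometry hrho hinv hprod GR bVm Vpi VO).
(* Since [star Q * q * Q] lies in [AW], [hiso] shows that on products the state of [Y u] depends
   only on the state induced by [u] on [AV]. *)
have hY (u u' : HR) : (forall a, AV a -> hdot u (pi2 a u) = hdot u' (pi2 a u')) ->
    forall a, hdot (Y u) (rho a (Y u)) = hdot (Y u') (rho a (Y u')).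
  move=> huu a; apply/eqP; rewrite -subr_eq0; apply/eqP.
  have val q x v : AW q -> AV x -> hdot (Y v) (rho (q * x) (Y v)) =
      hdot Om (rho (star Q * q * Q) Om) * hdot v (pi2 x v).
    move=> hq hx; rewrite (repM hrho)// -Ypi// /Y /= (rep_adj hrho)// -!(repM hrho)//.
    exact: (hiso _ _ _ (csaM hW (csaM hW (csa_star hW hQ) hq) hQ)).
  apply: (kernel_induction (N := @nrmc R)
    (F := fun a => hdot (Y u) (rho a (Y u)) - hdot (Y u') (rho a (Y u')) : R[i]^o)
    (C := nrm (Y u) ^+ 2 + nrm (Y u') ^+ 2)).
  - by rewrite addr_ge0// sqr_ge0.
  - exact: nrmc_ge0.
  - exact: nrmc_eq0.
  - move=> c x y; rewrite !(rep_lin hrho)// !hdotDr !hdotZr /GRing.scale /=; ring.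
  - move=> x; apply: le_trans (nrmcD _ _) _; rewrite nrmcN mulrDl.
    by apply: lerD; apply: le_trans (cauchy_schwarz _ _) _; rewrite expr2 -mulrA ler_wpM2l ?nrm_ge0// mulrC;
      exact: (rep_contractive csa_setT hrho).
  - by move=> q x hq hx; rewrite !val// huu// subrr.
pose h := adj Y \o P \o Y.
have Mh : vN_of AV pi2 h := compression_bicommutant hV hrho hpi2 bY hP sP hY.
have sh u v : hdot (h u) v = hdot u (h v) by rewrite /h /= adjl// sP adjr.
have [M M0 hM] := bop_bound bP; have [N N0 hN] := bop_bound bY.
(* The square root of this bound enters below, and [(M + 1)^2] is a perfect square above [M]. *)
have PE v : complex.Re (hdot v (P v)) <= (M + 1) ^+ 2 * nrm v ^+ 2.
  apply: le_trans (ler_norm _) _; apply: le_trans (Re_le_nrmc _) _.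
  apply: le_trans (cauchy_schwarz _ _) _.
  apply: (@le_trans _ _ (nrm v * (M * nrm v))); first by rewrite ler_wpM2l ?nrm_ge0.
  rewrite mulrCA -expr2 ler_wpM2r ?sqr_ge0//; nra.
have hC a u : AV a -> nrm (pi2 a (h u)) <= N * (M + 1) * N * nrm (pi1 a w1) * nrm u.
  move=> ha; rewrite /h /= -(intertwiner_adj hV hpi2 hrhoV bY Ypi)//.
  apply: le_trans (adj_bound bY (ltW N0) hN _) _.
  have : nrm (rho a (P (Y u))) <= nrm (pi1 a w1) * ((M + 1) * nrm (Y u)).
    rewrite -(ler_pXn2r (n := 2)) ?nnegrE ?mulr_ge0 ?nrm_ge0 ?addr_ge0 ?(ltW M0)//.
    rewrite nP exprMn exprMn; apply: ler_pM; [exact: sqr_ge0| |  |exact: PE].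
      rewrite -(pmulr_rge0 _ (exprn_gt0 2 nze)); have := nP 1 (Y u).
      by rewrite (rep1 hpis) => <-; exact: sqr_ge0.
    by rewrite ler_pXn2r ?nnegrE ?nrm_ge0// /ze -J1pi.
  move=> le1; have le2 := hN u.
  have c1 := nrm_ge0 (pi1 a w1).
  apply: (@le_trans _ _ (N * (nrm (pi1 a w1) * ((M + 1) * (N * nrm u))))).
    rewrite ler_wpM2l ?(ltW N0)//; apply: le_trans le1 _.
    by rewrite ler_wpM2l// ler_wpM2l// addr_ge0// ltW.
  by rewrite le_eqVlt; apply/orP; left; apply/eqP; ring.
(* By [nP] at [1], [|ze|^2] times this expectation is [|P (Y b)|^2], which is positive by the choice
   of [Q] and [b]. *)
have hb : 0 < complex.Re (hdot b (h b)).
  rewrite /h /= adjr// -(pmulr_rgt0 _ (exprn_gt0 2 nze)).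
  have := nP 1 (Y b); rewrite (rep1 hpis) (rep1 hrho) => <-.
  by rewrite exprn_gt0// nrm_gt0.
have C0 : 0 <= N * (M + 1) * N by rewrite !mulr_ge0 ?addr_ge0 ?ltW.
have [w [lam [w0 hw zw]]] := dominated_product_vector hV hpi1 hpi2 Mh sh C0 hC hb.
have [e [abe e0 ez]] := abelian_projection_of_vector hV hpi1 w0 hw.
exists e; split=> //; apply: ez => //; apply: zw => //.
exact: proj_idem.
Qed.

End TwoRegions.

End LocalAlgebras.

Theorem theorem3 (R : realType) (K : hilbertType R) (J : K -> K)
    (KL KR : set K) (A : cstarType R) (B : {linear K -> A})
    (Theta : {lrmorphism A -> A}) (psi : A -> R[i])
    (K_separable : separable_space K)
    (J_conj : conjugation J)
    (KL_sub : closed_subspace KL) (KR_sub : closed_subspace KR)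
    (KL_inf : infinite_dim KL) (KR_inf : infinite_dim KR)
    (KL_J : J @` KL `<=` KL) (KR_J : J @` KR `<=` KR)
    (K_decomp : orthogonal_decomposition KL KR)
    (A_CAR : selfdual_CAR J B)
    (Theta_parity : parity_automorphism B Theta)
    (psi_pure : pure_state psi)
    (psi_inv : invariant_state Theta setT psi) :
  let AL := local_algebra B KL in
  let AR := local_algebra B KR in
  (split_property Theta AL AR psi ->
     type_I_state AR psi /\ type_I_state AL psi) /\
  ((type_I_state AR psi -> split_property Theta AL AR psi) /\
   (type_I_state AL psi -> split_property Theta AL AR psi)).
Proof.
move=> AL AR; have [lL _] := closed_csub KL_sub; have [lR _] := closed_csub KR_sub.
have JL f : KL f -> KL (J f) by move=> h; apply: KL_J; exists f.
have JR f : KR f -> KR (J f) by move=> h; apply: KR_J; exists f.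
have [LR totLR] := K_decomp.
have RL v w : KR v -> KL w -> hdot v w = 0.
  by move=> hv hw; rewrite hdot_conj LR// rmorph0.
have totRL u : exists v w, [/\ KR v, KL w & u = v + w].
  by have [v [w [hv hw ->]]] := totLR u; exists w, v; rewrite addrC.
(* Each implication concerns the second region of an ordered pair, so the two halves are exchanged
   by reversing the graded product. *)
have symLR := split_property_sym J_conj A_CAR Theta_parity lR lL JR JL RL (psi := psi).
have symRL := split_property_sym J_conj A_CAR Theta_parity lL lR JL JR LR (psi := psi).
split=> [hs|]; [split|split=> h].
- exact: (split_type_I J_conj A_CAR Theta_parity lR lL JR JL RL totRL psi_pure psi_inv hs).
- apply: (split_type_I J_conj A_CAR Theta_parity lL lR JL JR LR totLR psi_pure psi_inv).
  exact: symLR.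
- exact: (type_I_split J_conj A_CAR Theta_parity lR lL JR JL RL totRL psi_pure psi_inv h).
- apply: symRL.
  exact: (type_I_split J_conj A_CAR Theta_parity lL lR JL JR LR totLR psi_pure psi_inv h).
Qed.
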